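(* Let $W$ be a random vector in $\mathbb{C}^k$ and, for each $\epsilon>0$, let $W_\epsilon$ be a random vector in $\mathbb{C}^k$ defined on the same probability space, with the same distribution as $W$, such that $\lim_{\epsilon\to0}W_\epsilon=W$ almost surely. Let $Z=(Z_1,\ldots,Z_k)$ be a standard complex Gaussian random vector in $\mathbb{C}^k$, i.e. the corresponding random vector in $\mathbb{R}^{2k}$ is a centered Gaussian with covariance matrix $\frac12 I_{2k}$. Suppose there are a function $\lambda(\epsilon)>0$ and complex $k\times k$ random matrices $\Gamma=[\gamma_{ij}]$ and $\Lambda=[\lambda_{ij}]$ such that the following conditions hold. (i) $\dfrac{1}{\lambda(\epsilon)}\,\mathbb{E}\left[W_\epsilon-W\,\middle|\,W\right]\longrightarrow -W$ in $L_1$ as $\epsilon\to0$. (ii) $\dfrac{1}{2\lambda(\epsilon)}\,\mathbb{E}\left[(W_\epsilon-W)(W_\epsilon-W)^*\,\middle|\,W\right]\longrightarrow I_k+\mathbb{E}\left[\Gamma\,\middle|\,W\right]$ in $L_1$ as $\epsilon\to0$. (iii) $\dfrac{1}{2\lambda(\epsilon)}\,\mathbb{E}\left[(W_\epsilon-W)(W_\epsilon-W)^T\,\middle|\,W\right]\longrightarrow \mathbb{E}\left[\Lambda\,\middle|\,W\right]$ in $L_1$ as $\epsilon\to0$. (iv) For each $\rho>0$, $\displaystyle\lim_{\epsilon\to0}\frac{1}{\lambda(\epsilon)}\,\mathbb{E}\left[|W_\epsilon-W|^2\,\mathbb{I}\left(|W_\epsilon-W|^2>\rho\right)\right]=0$.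 Then $$d_W(W,Z)\le\mathbb{E}\|\Gamma\|_{H.S.}+\mathbb{E}\|\Lambda\|_{H.S.}.$$
   Context: $\mathbb{C}^k$ is identified with $\mathbb{R}^{2k}$, and $|\cdot|$ is the Euclidean norm; $A^*$ is the conjugate transpose and $A^T$ the (unconjugated) transpose; $I_m$ is the $m\times m$ identity matrix; $\mathbb{I}(\cdot)$ is the indicator of an event; $\|A\|_{H.S.}=\sqrt{\operatorname{Tr}(AA^* )}$. $L_1$ convergence of random vectors and matrices is entrywise. The Wasserstein distance is $$d_W(X,Y)=\sup_{M_1(g)\le1}\left|\mathbb{E}g(X)-\mathbb{E}g(Y)\right|,\qquad M_1(g)=\sup_{x\ne y}\frac{|g(x)-g(y)|}{|x-y|},$$ the supremum being over real-valued functions $g$ on $\mathbb{C}^k\cong\mathbb{R}^{2k}$ with Lipschitz constant $M_1(g)\le 1$. The random variables whose conditional expectations appear in the hypotheses (including $\Gamma$ and $\Lambda$) are assumed integrable. *)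

(* Defs.v *)
From HB Require Import structures.
From mathcomp Require Import all_boot all_order all_algebra.
From mathcomp Require Import all_classical all_reals all_analysis.
From mathcomp Require Export complex.

Set Implicit Arguments.
Unset Strict Implicit.
Unset Printing Implicit Defensive.

Import Order.TTheory GRing.Theory Num.Theory.
Import numFieldNormedType.Exports.

Local Open Scope classical_set_scope.
Local Open Scope ring_scope.
Local Open Scope complex_scope.

Definition measure_complex_display : measure_display -> measure_display.
Proof. exact. Qed.

Section complex_measurable.
Context {R : realType}.

HB.instance Definition _ := isPointed.Build R[i] (0 +i* 0).

Let Re' : R[i] -> R := @complex.Re R.
Let Im' : R[i] -> R := @complex.Im R.

Let set0_mc : g_sigma_preimageU Re' Im' set0.
Proof. exact: sigma_algebra0. Qed.

Let setC_mc A : g_sigma_preimageU Re' Im' A -> g_sigma_preimageU Re' Im' (~` A).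
Proof. exact: sigma_algebraC. Qed.

Let bigcup_mc (F : (set R[i])^nat) :
  (forall i, g_sigma_preimageU Re' Im' (F i)) ->
  g_sigma_preimageU Re' Im' (\bigcup_i F i).
Proof. exact: sigma_algebra_bigcup. Qed.

HB.instance Definition _ := @isMeasurable.Build (measure_complex_display R.-ocitv)
  R[i] (g_sigma_preimageU Re' Im') set0_mc setC_mc bigcup_mc.

End complex_measurable.

Definition measure_matrix_display : measure_display -> measure_display.
Proof. exact. Qed.

Definition g_sigma_entries d (T : measurableType d) (m n : nat) :
    set (set 'M[T]_(m, n)) :=
  <<s \bigcup_(p : 'I_m * 'I_n)
        preimage_set_system setT (fun M : 'M[T]_(m, n) => M p.1 p.2)
          measurable >>.

Section matrix_measurable.
Context {d} {T : measurableType d} {m n : nat}.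

Let set0_mm : @g_sigma_entries d T m n set0.
Proof. exact: sigma_algebra0. Qed.

Let setC_mm A : @g_sigma_entries d T m n A -> @g_sigma_entries d T m n (~` A).
Proof. exact: sigma_algebraC. Qed.

Let bigcup_mm (F : (set 'M[T]_(m, n))^nat) :
  (forall i, @g_sigma_entries d T m n (F i)) ->
  @g_sigma_entries d T m n (\bigcup_i F i).
Proof. exact: sigma_algebra_bigcup. Qed.

HB.instance Definition _ := @isMeasurable.Build (measure_matrix_display d)
  'M[T]_(m, n) (@g_sigma_entries d T m n) set0_mm setC_mm bigcup_mm.

End matrix_measurable.

Section euclidean.
Context {R : realType}.

(* The identification of C^k with R^(2k): real parts on top of imaginary
   parts. *)
Definition realify k (v : 'cV[R[i]]_k) : 'cV[R]_(k + k) :=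
  col_mx (map_mx (@complex.Re R) v) (map_mx (@complex.Im R) v).

Definition enorm n (x : 'cV[R]_n) : R := Num.sqrt (\sum_i x i 0 ^+ 2).

Definition cnorm k (v : 'cV[R[i]]_k) : R := enorm (realify v).

Definition adjmx m n (A : 'M[R[i]]_(m, n)) : 'M[R[i]]_(n, m) :=
  map_mx (@conjc R) A^T.

(* The trace below is a nonnegative real; Re extracts it from R[i]. *)
Definition hs_norm m n (A : 'M[R[i]]_(m, n)) : R :=
  Num.sqrt (complex.Re (\tr (A *m adjmx A))).

End euclidean.

Section gaussian.
Context {R : realType}.

(* Lebesgue integral over R^n, as an iterated integral; meant for nonnegative
   Borel integrands, for which it is the integral against the product measure
   by Tonelli's theorem. *)
Fixpoint lebesgue_int n : ('cV[R]_n -> \bar R) -> \bar R :=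
  match n with
  | 0 => fun f => f 0
  | p.+1 => fun f => (\int[lebesgue_measure]_(t in [set: R])
      lebesgue_int (fun y : 'cV[R]_p => f (col_mx (t%:M : 'cV[R]_1) y)))%E
  end.

Definition gaussian_pdf n (mu : 'cV[R]_n) (Sigma : 'M[R]_n) (x : 'cV[R]_n) : R :=
  expR (- (((x - mu)^T *m invmx Sigma *m (x - mu)) 0 0 / 2))
    / Num.sqrt ((2 * pi) ^+ n * \det Sigma).

(* Only meant for positive definite Sigma (degenerate Gaussian laws have no
   density). *)
Definition is_gaussian d (T : measurableType d) (P : probability T R) n
    (mu : 'cV[R]_n) (Sigma : 'M[R]_n) (X : T -> 'cV[R]_n) : Prop :=
  forall A : set 'cV[R]_n, measurable A ->
    P (X @^-1` A) =
    lebesgue_int (fun x => (\1_A x * gaussian_pdf mu Sigma x)%:E).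

Definition standard_complex_gaussian d (T : measurableType d)
    (P : probability T R) k (Z : {RV P >-> 'cV[R[i]]_k}) : Prop :=
  is_gaussian P 0 (2^-1)%:M (fun w => realify (Z w)).

End gaussian.

Section wasserstein.
Context {R : realType}.
Local Open Scope ereal_scope.

Definition M1 k (g : 'cV[R[i]]_k -> R) : \bar R :=
  ereal_sup [set (`|g p.1 - g p.2| / cnorm (p.1 - p.2))%R%:E
            | p in [set p : 'cV[R[i]]_k * 'cV[R[i]]_k | p.1 <> p.2]].

Definition wasserstein d (T : measurableType d) (P : probability T R)
    d' (T' : measurableType d') (P' : probability T' R) k
    (X : {RV P >-> 'cV[R[i]]_k}) (Y : {RV P' >-> 'cV[R[i]]_k}) : \bar R :=
  ereal_sup [set `| 'E_P[g \o X] - 'E_P'[g \o Y] |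
            | g in [set g : 'cV[R[i]]_k -> R | M1 g <= 1]].

End wasserstein.

Section conditional_expectation.
Context d (T : measurableType d) (R : realType) (P : probability T R).
Context d' (S : measurableType d') (W : T -> S).

Definition is_condexp (X V : T -> R) : Prop :=
  [/\ measurable_fun [set: g_sigma_algebra_preimageType W]
        (V : g_sigma_algebra_preimageType W -> R),
      P.-integrable [set: T] (EFin \o V) &
      forall A, g_sigma_algebra_preimage W A ->
        (\int[P]_(w in A) (V w)%:E = \int[P]_(w in A) (X w)%:E)%E].

(* A version of E[X | W]; meaningful only for integrable X. *)
Definition condexp (X : T -> R) : T -> R := xget (cst 0) (is_condexp X).

Definition condexp_mx m n (M : T -> 'M[R[i]]_(m, n)) (w : T) :
    'M[R[i]]_(m, n) :=
  \matrix_(i, j) (condexp (fun w => complex.Re (M w i j)) w +i*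
                  condexp (fun w => complex.Im (M w i j)) w).

Definition integrable_mx m n (M : T -> 'M[R[i]]_(m, n)) : Prop :=
  forall i j, P.-integrable [set: T] (fun w => (complex.Re (M w i j))%:E) /\
              P.-integrable [set: T] (fun w => (complex.Im (M w i j))%:E).

Definition L1_cvg m n (M : R -> T -> 'M[R[i]]_(m, n))
    (L : T -> 'M[R[i]]_(m, n)) : Prop :=
  forall i j, ('E_P[fun w => (Normc.normc (M e w i j - L w i j))%R]
    @[e --> 0^'+] --> 0)%E.

End conditional_expectation.

(* Main.v *)
(* Identify C^k with R^(2k), let [gam] be the law of [Z] and, for a 1-Lipschitz
   [g], put [S b w y = E(g(y + b Z) w(Z))] and
   [phi(b) = E(g(sqrt(1 - b^2) W + b Z))], so that [phi 0 = E g(W)] and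
   [phi 1 = E g(Z)]; it suffices to bound the growth of [phi] on [0, 1] by
   [B = E|Gamma| + E|Lambda|].  The only property of [gam] that is needed is the
   Cameron-Martin formula: it determines [gam], hence makes [gam x gam] rotation
   invariant, and it expands [S b 1] to second order with remainder
   [O(min(|e|^2, |e|^3))], the coefficients being [S b w] for Hermite weights [w].

   With [a = sqrt(1 - b^2)] and [c = a / b], adding a small independent Gaussian
   vector shows that [phi] grows at the rate (up to a positive factor)
   [E(2 c^2 (S b (quad 1))(a W) - (S b (T1 (c W)))(a W))].  The same expansion of
   [0 = E h(W_e) - E h(W)] for [h = S b 1 (a .)], divided by [lambda(e)] and
   combined with (i)-(iv), turns this rate into [- 2 c^2] times the expectation of
   [S b (quad M)] at [a W], with [M] the real matrix of
   [z |-> Gamma z + Lambda conj(z)].  Finally [|S b (quad M)|] is at most [b / 2]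
   times the mean of [|M Z|]: rotate two independent Gaussian vectors and apply the
   gradient bound [|S b (T1 v)| <= b |v|] to one of them.

   Since [W] is only assumed integrable, [phi] is never differentiated; its
   increments are compared along [b' = sqrt(b^2 + (a s)^2)] as [s] tends to 0. *)

Require Import Defs.
From HB Require Import structures.
From mathcomp Require Import all_boot all_order all_algebra.
From mathcomp Require Import all_classical all_reals all_analysis.
From mathcomp Require Import complex measurable_realfun.
From mathcomp Require Import ring lra.

Set Implicit Arguments.
Unset Strict Implicit.
Unset Printing Implicit Defensive.

Import Order.TTheory GRing.Theory Num.Theory.
Import numFieldNormedType.Exports.

Local Open Scope classical_set_scope.
Local Open Scope ring_scope.
Local Open Scope complex_scope.

(** * Measurability of complex vectors and Euclidean norms *)

Section measurability.
Context {R : realType}.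

(** Three obstacles shape the proof. [g] is only Lipschitz, so no derivative ever falls on it:
    shifts are moved onto the Gaussian density, which is expanded pointwise. Next, (iv) is a
    Lindeberg condition and controls no third moment; the remainder min(|e|^2, |e|^3) is shaped for
    it, the square serving large increments and the cube small ones, whose second moments are
    bounded by the trace of (ii). Finally, conditional limits can be tested only against bounded
    functions of W, so the terms of the expansion are written as functionals that are real-linear in
    the increment and bounded in W.

    The constant one comes from an exact balance. For Z of covariance I/2 the mean of |M Z| is at
    most sqrt(sum M_ij^2 / 2), and the real matrix of a complex one has twice its sum of squared
    moduli, so the Hilbert-Schmidt norm appears with coefficient one. Over a step the rate
    contributes s^2/2 * c^2 b B = a^2 s^2 B / (2 b), while b' - b is a^2 s^2 / (b' + b): the
    quotient tends to B. *)

Lemma measurable_fun_complexP d (T : measurableType d) (f : T -> R[i]) :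
  measurable_fun setT f <->
  measurable_fun setT (fun t => complex.Re (f t)) /\
  measurable_fun setT (fun t => complex.Im (f t)).
Proof.
pose G := preimage_set_system setT (@complex.Re R) measurable `|`
          preimage_set_system setT (@complex.Im R) measurable.
split=> [mf|[mr mi]].
  have mr : measurable_fun setT (@complex.Re R).
    move=> _ A mA; suff: <<s G >> (setT `&` @complex.Re R @^-1` A) by [].
    by apply: sub_sigma_algebra; left; exists A.
  have mi : measurable_fun setT (@complex.Im R).
    move=> _ A mA; suff: <<s G >> (setT `&` @complex.Im R @^-1` A) by [].
    by apply: sub_sigma_algebra; right; exists A.
  split; [exact: (measurableT_comp mr mf)|exact: (measurableT_comp mi mf)].
apply: (@measurability _ _ _ _ setT f G) => //.
move=> _ [B BG <-]; rewrite setTI.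
move: BG => [[A mA <-]|[A mA <-]]; rewrite setTI.
  by have := mr measurableT A mA; rewrite setTI.
by have := mi measurableT A mA; rewrite setTI.
Qed.

Lemma measurable_fun_mxP d d' (T : measurableType d) (S : measurableType d')
    m n (f : T -> 'M[S]_(m, n)) :
  measurable_fun setT f <-> forall i j, measurable_fun setT (fun t => f t i j).
Proof.
pose G := \bigcup_(p : 'I_m * 'I_n)
  preimage_set_system setT (fun M : 'M[S]_(m, n) => M p.1 p.2) measurable.
split=> [mf i j|mf].
  have mij : measurable_fun setT (fun M : 'M[S]_(m, n) => M i j).
    move=> _ A mA; suff: <<s G >> (setT `&` (fun M : 'M[S]_(m, n) => M i j) @^-1` A) by [].
    by apply: sub_sigma_algebra; exists (i, j) => //; exists A.
  exact: (measurableT_comp mij mf).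
apply: (@measurability _ _ _ _ setT f G) => //.
move=> _ [B [[i j] _ [A mA <-]] <-]; rewrite !setTI.
by have := mf i j measurableT A mA; rewrite setTI.
Qed.

Lemma measurable_fun_cVP d (T : measurableType d) n (f : T -> 'cV[R]_n) :
  measurable_fun setT f <-> forall i, measurable_fun setT (fun t => f t i 0).
Proof.
rewrite measurable_fun_mxP; split=> [mf i|mf i j]; first exact: mf.
by rewrite (ord1 j); exact: mf.
Qed.

Lemma measurable_coord n (i : 'I_n) : measurable_fun setT (fun v : 'cV[R]_n => v i 0).
Proof. by have /measurable_fun_cVP := @measurable_id _ 'cV[R]_n setT; exact. Qed.

(** Countably many values leave [G] arbitrary: a preimage is the union of the fibres over those
    values that [G] sends into the set, enumerated by [unpickle]. *)
Lemma measurable_fun_countable d (T : measurableType d) (C : countType) (q : T -> C)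
    (G : C -> R) :
  (forall c, measurable (q @^-1` [set c])) -> measurable_fun setT (fun t => G (q t)).
Proof.
move=> mq _ B mB; rewrite setTI.
rewrite (_ : _ @^-1` _ = \bigcup_n
   (if @unpickle C n is Some c then if G c \in B then q @^-1` [set c] else set0 else set0)).
  apply: bigcupT_measurable => n; case: unpickle => [c|//].
  by case: ifP.
apply/seteqP; split=> [t /= GB|t [n _]].
  by exists (pickle (q t)) => //; rewrite pickleK mem_set.
by case: unpickle => [c|//]; case: ifP => // /set_mem GcB /= ->.
Qed.

End measurability.

Section dot.
Context {R : realType} {n : nat}.
Implicit Types u v w : 'cV[R]_n.

Definition dot u v : R := \sum_i u i 0 * v i 0.

Lemma dotC u v : dot u v = dot v u.
Proof. by apply: eq_bigr => i _; rewrite mulrC. Qed.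

Lemma dotDl u v w : dot (u + v) w = dot u w + dot v w.
Proof. by rewrite -big_split; apply: eq_bigr => i _; rewrite mxE mulrDl. Qed.

Lemma dotZl a u v : dot (a *: u) v = a * dot u v.
Proof. by rewrite mulr_sumr; apply: eq_bigr => i _; rewrite mxE mulrA. Qed.

Lemma dotDr u v w : dot w (u + v) = dot w u + dot w v.
Proof. by rewrite dotC dotDl !(dotC w). Qed.

Lemma dotZr a u v : dot u (a *: v) = a * dot u v.
Proof. by rewrite dotC dotZl dotC. Qed.

Lemma dotNl u v : dot (- u) v = - dot u v.
Proof. by rewrite -scaleN1r dotZl mulN1r. Qed.

Lemma dotNr u v : dot u (- v) = - dot u v.
Proof. by rewrite dotC dotNl dotC. Qed.

Lemma dot0l v : dot 0 v = 0.
Proof. by rewrite -(scale0r 0) dotZl mul0r. Qed.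

Lemma dot_ge0 u : 0 <= dot u u.
Proof. by apply: sumr_ge0 => i _; rewrite -expr2 sqr_ge0. Qed.

Lemma enorm_ge0 u : 0 <= enorm u. Proof. exact: sqrtr_ge0. Qed.

Lemma enorm_sqr u : enorm u ^+ 2 = dot u u.
Proof.
rewrite sqr_sqrtr; last by apply: sumr_ge0 => i _; rewrite sqr_ge0.
by apply: eq_bigr => i _; rewrite expr2.
Qed.

Lemma dot_le u v : `|dot u v| <= enorm u * enorm v.
Proof.
have [v0|v0] := eqVneq (dot v v) 0.
  have /eqP : v = 0.
    apply/colP => i; rewrite mxE; apply/eqP; rewrite -sqrf_eq0 expr2.
    by move/eqP: v0; rewrite psumr_eq0 => [/allP/(_ i)|j _]; rewrite -?expr2 ?sqr_ge0 ?mem_index_enum//; apply.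
  move=> /eqP ->; rewrite dotC dot0l normr0 mulr_ge0 ?enorm_ge0//.
rewrite -(@ler_pXn2r _ 2)// ?nnegrE ?mulr_ge0 ?enorm_ge0 ?normr_ge0// real_normK ?num_real//.
rewrite exprMn !enorm_sqr.
have vp : 0 < dot v v by rewrite lt_def v0 dot_ge0.
(* The component of u orthogonal to v, multiplied by <v, v> to avoid a division; its square being
   nonnegative is the Cauchy-Schwarz inequality. *)
have := dot_ge0 (dot v v *: u - dot u v *: v).
rewrite !(dotDl, dotDr, dotNl, dotNr, dotZl, dotZr) (dotC v u) => h.
have {}h : 0 <= dot v v * (dot u u * dot v v - dot u v ^+ 2).
  by apply: (le_trans h); rewrite le_eqVlt; apply/orP; left; apply/eqP; ring.
by rewrite -subr_ge0; rewrite pmulr_rge0 in h.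
Qed.

Lemma enormD u v : enorm (u + v) <= enorm u + enorm v.
Proof.
rewrite -(@ler_pXn2r _ 2)// ?nnegrE ?addr_ge0 ?enorm_ge0//.
rewrite enorm_sqr !(dotDl, dotDr) sqrrD !enorm_sqr (dotC v u).
have := le_trans (ler_norm _) (dot_le u v); lra.
Qed.

Lemma enormZ a u : enorm (a *: u) = `|a| * enorm u.
Proof.
apply/eqP; rewrite -(@eqrXn2 _ 2)// ?mulr_ge0 ?enorm_ge0 ?normr_ge0//.
by rewrite exprMn real_normK ?num_real// !enorm_sqr dotZl dotZr mulrA expr2.
Qed.

Lemma enormN u : enorm (- u) = enorm u.
Proof. by rewrite -scaleN1r enormZ normrN1 mul1r. Qed.

Lemma enorm0 : enorm (0 : 'cV[R]_n) = 0.
Proof. by rewrite -(scale0r 0) enormZ normr0 mul0r. Qed.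

Lemma coord_le_enorm u i : `|u i 0| <= enorm u.
Proof.
rewrite -(@ler_pXn2r _ 2)// ?nnegrE ?enorm_ge0 ?normr_ge0// enorm_sqr real_normK ?num_real//.
by rewrite expr2 /dot (bigD1 i)//= lerDl sumr_ge0// => j _; rewrite -expr2 sqr_ge0.
Qed.

Lemma enorm_le_sum u : enorm u <= \sum_i `|u i 0|.
Proof.
rewrite -(@ler_pXn2r _ 2)// ?nnegrE ?enorm_ge0 ?sumr_ge0// enorm_sqr expr2 mulr_sumr.
apply: ler_sum => i _; rewrite -[leLHS]ger0_norm -?expr2 ?sqr_ge0// expr2 normrM.
by rewrite ler_wpM2r// (bigD1 i)//= lerDl sumr_ge0.
Qed.

End dot.

Section measurable_vectors.
Context {R : realType} d (T : measurableType d) (n : nat).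
Implicit Types f g : T -> 'cV[R]_n.

Lemma measurable_cVD f g : measurable_fun setT f -> measurable_fun setT g ->
  measurable_fun setT (fun t => f t + g t).
Proof.
move=> /measurable_fun_cVP mf /measurable_fun_cVP mg; apply/measurable_fun_cVP => i.
by under eq_fun do rewrite mxE; exact: measurable_funD.
Qed.

Lemma measurable_cVZ (a : T -> R) f : measurable_fun setT a -> measurable_fun setT f ->
  measurable_fun setT (fun t => a t *: f t).
Proof.
move=> ma /measurable_fun_cVP mf; apply/measurable_fun_cVP => i.
by under eq_fun do rewrite mxE; exact: measurable_funM.
Qed.

Lemma measurable_cVB f g : measurable_fun setT f -> measurable_fun setT g ->
  measurable_fun setT (fun t => f t - g t).
Proof.
move=> /measurable_fun_cVP mf /measurable_fun_cVP mg; apply/measurable_fun_cVP => i.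
by under eq_fun do rewrite !mxE; exact: measurable_funB.
Qed.

Lemma measurable_dot f g : measurable_fun setT f -> measurable_fun setT g ->
  measurable_fun setT (fun t => dot (f t) (g t)).
Proof.
move=> /measurable_fun_cVP mf /measurable_fun_cVP mg.
by apply: measurable_sum => i; apply: measurable_funM.
Qed.

Lemma measurable_enorm f : measurable_fun setT f ->
  measurable_fun setT (fun t => enorm (f t)).
Proof.
move=> /measurable_fun_cVP mf.
apply: (measurableT_comp (continuous_measurable_fun (@sqrt_continuous R))) => //=.
by apply: measurable_sum => i; apply: measurable_funX.
Qed.

End measurable_vectors.

Definition lipschitz_with {R : realType} {n} (L : R) (g : 'cV[R]_n -> R) :=
  forall x y, `|g x - g y| <= L * enorm (x - y).

Section lipschitz.
Context {R : realType} {n : nat}.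

(** The sigma-algebra on vectors is generated by coordinates and not by open sets, so continuity
    does not give measurability directly. Here [g] is the pointwise limit of its values at points
    rounded down to the grid of mesh 1/(m+1), and rounding takes countably many values. *)
Lemma measurable_lipschitz (L : R) (g : 'cV[R]_n -> R) :
  lipschitz_with L g -> measurable_fun setT g.
Proof.
move=> gL.
pose q m (x : 'cV[R]_n) : 'cV[int]_n := \col_i Num.floor (m.+1%:R * x i 0).
pose r m (c : 'cV[int]_n) : 'cV[R]_n := \col_i ((c i 0)%:~R / m.+1%:R).
have mq m (c : 'cV[int]_n) : measurable (q m @^-1` [set c]).
  have -> : q m @^-1` [set c] = \bigcap_(i in [set: 'I_n])
      ((fun x : 'cV[R]_n => m.+1%:R * x i 0) @^-1` `[(c i 0)%:~R, (c i 0 + 1)%:~R[).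
    apply/seteqP; split=> x /=.
      by move=> <- i _ /=; rewrite in_itv/= mxE floor_le floorD1_gt.
    move=> h; apply/colP => i; rewrite mxE.
    by have := h i I; rewrite /= in_itv/= => /floor_def.
  apply: fin_bigcap_measurable => // i _; rewrite -[X in measurable X]setTI.
  have : measurable_fun setT (fun x : 'cV[R]_n => m.+1%:R * x i 0).
    by apply: measurable_funM => //; exact: measurable_coord.
  by apply.
apply: (@measurable_fun_cvg _ _ _ _ (fun m x => g (r m (q m x))) g) => //.
  by move=> m; apply: (measurable_fun_countable (fun c => g (r m c)) (mq m)).
move=> x _; apply/cvgrPdist_le => e e0; near=> m.
apply: (le_trans (gL _ _)).
have step : enorm (x - r m (q m x)) <= n%:R / m.+1%:R.
  apply: (le_trans (enorm_le_sum _)).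
  rewrite (_ : n%:R / m.+1%:R = \sum_(i < n) m.+1%:R^-1); last first.
    by rewrite sumr_const card_ord mulr_natl.
  apply: ler_sum => i _; rewrite !mxE.
  have m0 : 0 < m.+1%:R :> R by [].
  have := floor_le (m.+1%:R * x i 0); have := floorD1_gt (m.+1%:R * x i 0).
  set t := Num.floor _; rewrite intrD => h1 h2.
  have -> : x i 0 - t%:~R / m.+1%:R = (m.+1%:R * x i 0 - t%:~R) / m.+1%:R.
    by rewrite mulrBl mulrAC divff ?mul1r// gt_eqF.
  rewrite normrM [`|_^-1|]gtr0_norm ?invr_gt0// -[leRHS]mul1r ler_wpM2r ?invr_ge0//.
  by rewrite ger0_norm; lra.
have L0 : `|L| * n%:R / e <= m.+1%:R.
  near: m; have [N _ hN] := @nbhs_infty_ger R (`|L| * n%:R / e).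
  by exists N => // k /= /hN/le_trans; apply; rewrite ler_nat.
apply: (@le_trans _ _ (`|L| * (n%:R / m.+1%:R))).
  apply: (@le_trans _ _ (`|L| * enorm (x - r m (q m x)))).
    by rewrite ler_wpM2r ?enorm_ge0 ?ler_norm.
  by rewrite ler_wpM2l.
by rewrite mulrA ler_pdivrMr// -ler_pdivrMl// mulrC.
Unshelve. all: by end_near. Qed.

End lipschitz.

(** * Lebesgue measure on R^n *)

Section sigma_finite_measure_of.
Context {R : realType} d (S : measurableType d) (nu : {measure set S -> \bar R}).
Hypothesis nu_fin : sigma_finite setT nu.

(** A copy of [nu] whose name carries the proof of sigma-finiteness, so that an instance can be
    attached to it and then exported as an existence statement. *)
Definition sigma_finite_measure_of of sigma_finite setT nu : set S -> \bar R := nu.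
Let m := sigma_finite_measure_of nu_fin.

HB.instance Definition _ := Measure.on m.
HB.instance Definition _ := Measure_isSigmaFinite.Build _ _ _ m nu_fin.

Lemma sigma_finite_measure_exists :
  exists mu : {sigma_finite_measure set S -> \bar R}, mu = nu :> (set S -> \bar R).
Proof. by exists m. Qed.

End sigma_finite_measure_of.

Section sigma_finite_pushforward.
Context {R : realType} d1 d2 (S1 : measurableType d1) (S2 : measurableType d2).
Variables (m : {sigma_finite_measure set S1 -> \bar R}) (phi : S1 -> S2) (psi : S2 -> S1).
Hypothesis mphi : measurable_fun setT phi.
Hypothesis mpsi : measurable_fun setT psi.
Hypothesis phiK : cancel phi psi.

(** A measurable left inverse is what sigma-finiteness of the image requires: [psi] pulls the
    exhausting sets of [m] back to exhausting sets in the target. *)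
Lemma sigma_finite_image : exists mu : {sigma_finite_measure set S2 -> \bar R},
  forall f : S2 -> \bar R, measurable_fun setT f -> (forall x, 0 <= f x)%E ->
    (\int[mu]_x f x = \int[m]_x f (phi x))%E.
Proof.
have [nu nuE] : exists nu : {measure set S2 -> \bar R}, nu = pushforward m phi :> (set S2 -> \bar R).
  by exists (measure_function_pushforward__canonical__measure_function_Measure m mphi).
have nufin : sigma_finite setT nu.
  have [F UF mF] := sigma_finiteT m.
  exists (fun n => psi @^-1` F n).
    by rewrite -preimage_bigcup -UF preimage_setT.
  move=> n; have [mFn Foo] := mF n; split.
    by rewrite -[X in measurable X]setTI; exact: mpsi.
  rewrite nuE /pushforward -comp_preimage (_ : psi \o phi = id)//.
  by apply/funext => x /=; rewrite phiK.
have [mu muE] := sigma_finite_measure_exists nufin.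
exists mu => f mf f0.
rewrite -[RHS](ge0_integral_pushforward mphi _ (D := setT))//.
by apply: eq_measure_integral => A _ _; rewrite /= muE nuE.
Qed.

End sigma_finite_pushforward.

Section sigma_finite_product.
Context {R : realType} d1 d2 (S1 : measurableType d1) (S2 : measurableType d2).
Variables (m1 : {sigma_finite_measure set S1 -> \bar R}).
Variables (m2 : {sigma_finite_measure set S2 -> \bar R}).

Lemma sigma_finite_product : sigma_finite setT (m1 \x m2)%E.
Proof.
(* The exhaustions are taken increasing so that a point of F n x G m lies in the rectangle of index
   max(n, m). *)
have /sigma_finiteP[F [TF ndF Foo]] := sigma_finiteT m1.
have /sigma_finiteP[G [TG ndG Goo]] := sigma_finiteT m2.
exists (fun n => F n `*` G n).
  apply/esym/seteqP; split=> // -[x y] _.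
  have [/= n _ Fnx] : (\bigcup_n F n) x by rewrite -TF.
  have [/= m _ Gmy] : (\bigcup_n G n) y by rewrite -TG.
  exists (maxn n m) => //; split.
    by move: x Fnx; exact/subsetPset/ndF/leq_maxl.
  by move: y Gmy; exact/subsetPset/ndG/leq_maxr.
move=> n; have [mF Fn] := Foo n; have [mG Gn] := Goo n.
split; first exact: measurableX.
by rewrite product_measure1E// lte_mul_pinfty// ge0_fin_numE.
Qed.

End sigma_finite_product.

Section lebesgue_shift.
Context {R : realType}.

(** The image of Lebesgue measure under the shift has the same values on half-open intervals, and
    these determine it. *)
Lemma ge0_integral_lebesgue_shift (u : R) (f : R -> \bar R) :
  measurable_fun setT f -> (forall x, 0 <= f x)%E ->
  (\int[lebesgue_measure]_x f (x + u)%R = \int[lebesgue_measure]_x f x)%E.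
Proof.
move=> mf f0.
have mshift : measurable_fun setT (fun x : measurableTypeR R => x + u : measurableTypeR R).
  exact: measurable_funD.
rewrite -[LHS](ge0_integral_pushforward mshift _ (D := setT))//.
apply: eq_measure_integral => A mA _.
apply/esym; apply: lebesgue_measure_unique => // X [[a b] _ <-].
transitivity (lebesgue_measure (`]a - u, b - u]%classic : set R)); last first.
  congr (lebesgue_measure _).
  by apply/seteqP; split => x /=; rewrite !in_itv/= ltrBlDr lerBrDr.
by rewrite !lebesgue_measure_itv/= !lte_fin ltrD2r -!EFinB opprB addrA subrK.
Qed.

End lebesgue_shift.

Section lebesgue_int_measure.
Context {R : realType}.

Lemma measurable_col_mx p :
  measurable_fun setT (fun q : measurableTypeR R * 'cV[R]_p => col_mx (q.1%:M : 'cV[R]_1) q.2 : 'cV[R]_p.+1).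
Proof.
apply/measurable_fun_cVP => i.
under eq_fun do rewrite mxE.
case: (@fintype.split 1 p i) => j.
  by under eq_fun do rewrite (ord1 j) mxE eqxx mulr1n; exact: measurable_fst.
exact: (measurableT_comp (measurable_coord j) measurable_snd).
Qed.

Lemma measurable_uncol_mx p :
  measurable_fun setT (fun x : 'cV[R]_p.+1 => (x ord0 0, dsubmx (x : 'cV[R]_(1 + p))) : measurableTypeR R * 'cV[R]_p).
Proof.
apply: measurable_fun_pair; first exact: measurable_coord.
apply/measurable_fun_cVP => i.
by under eq_fun do rewrite mxE; exact: measurable_coord.
Qed.

(** [lebesgue_int] is an iterated integral with no measure behind it. The measure is built by
    induction, as the image under [col_mx] of the product of the line with R^p; translation
    invariance is the one property exported besides the value of the integral. *)
Lemma lebesgue_int_measure n :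
  exists mu : {sigma_finite_measure set 'cV[R]_n -> \bar R},
    forall f : 'cV[R]_n -> \bar R, measurable_fun setT f -> (forall x, 0 <= f x)%E ->
    lebesgue_int f = (\int[mu]_x f x)%E /\
    forall u, (\int[mu]_x f (x + u)%R = \int[mu]_x f x)%E.
Proof.
elim: n => [|p [mu IH]].
  exists (\d_(0 : 'cV[R]_0)) => f mf f0 /=; split.
    by rewrite integral_dirac// diracT mul1e.
  by move=> u; apply: eq_integral => x _; rewrite (flatmx0 u) addr0.
pose lm : {sigma_finite_measure set (measurableTypeR R) -> \bar R} := lebesgue_measure.
have [prod prodE] := sigma_finite_measure_exists (sigma_finite_product lm mu).
have [|nu nuE] := sigma_finite_image prod (@measurable_col_mx p) (@measurable_uncol_mx p).
  move=> [t y] /=; congr pair; last exact: col_mxKd.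
  transitivity (col_mx (t%:M : 'cV[R]_1) y (lshift p ord0) 0).
    by congr (fun_of_matrix _ _ _); exact: val_inj.
  by rewrite col_mxEu mxE eqxx.
have mf2 (f : 'cV[R]_p.+1 -> \bar R) : measurable_fun setT f ->
    measurable_fun setT (fun q : measurableTypeR R * 'cV[R]_p => f (col_mx (q.1%:M : 'cV[R]_1) q.2)).
  by move=> mf; exact: (measurableT_comp mf (@measurable_col_mx p)).
have nu2 (f : 'cV[R]_p.+1 -> \bar R) : measurable_fun setT f -> (forall x, 0 <= f x)%E ->
    (\int[nu]_x f x = \int[lebesgue_measure]_t \int[mu]_y f (col_mx (t%:M : 'cV[R]_1) y))%E.
  move=> mf f0; rewrite nuE//.
  rewrite -(@fubini_tonelli1 _ _ _ _ _ lm mu (fun q => f (col_mx (q.1%:M : 'cV[R]_1) q.2)))//; last exact: mf2.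
  by apply: eq_measure_integral => A _ _; exact: (congr1 (fun f => f A) prodE).
exists nu => f mf f0; split.
  rewrite nu2//=; apply: eq_integral => t _.
  by have [-> //] := IH _ (measurableT_comp (mf2 f mf) (pair1_measurable t)) (fun y => f0 _).
move=> u; rewrite !nu2//; last first.
  by apply: (measurableT_comp mf); apply: measurable_cVD.
(* The tail is shifted by the induction hypothesis for a fixed first coordinate; the shift of the
   first coordinate is then one-dimensional. *)
transitivity (\int[lebesgue_measure]_t (fun s : R => \int[mu]_y f (col_mx (s%:M : 'cV[R]_1) y)) (t + u ord0 0)%R)%E.
  apply: eq_integral => t _ /=.
  have [_ /(_ (dsubmx (u : 'cV[R]_(1 + p)))) <-] :=
    IH _ (measurableT_comp (mf2 f mf) (pair1_measurable (t + u ord0 0))) (fun y => f0 _).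
  apply: eq_integral => y _; congr f.
  rewrite -[u in LHS](@vsubmxK _ 1 p); etransitivity.
    exact: (@add_col_mx R 1 p 1).
  congr (@col_mx R 1 p 1 _ _).
  apply/colP => i; rewrite !mxE (ord1 i) !mulr1n; congr (_ + u _ _); exact: val_inj.
apply: (@ge0_integral_lebesgue_shift _ _
    (fun s : R => \int[mu]_y f (col_mx (s%:M : 'cV[R]_1) y))%E).
  exact: (measurable_fun_fubini_tonelli_F _ (mf2 f mf)).
by move=> x; apply: integral_ge0.
Qed.

End lebesgue_int_measure.

(** * The Cameron-Martin formula *)

Section density.
Local Open Scope ereal_scope.
Context {R : realType} d (S : measurableType d).
Import HBNNSimple.

(** A density known on sets, which is how [is_gaussian] presents it, passes to nonnegative functions
    through simple functions and monotone convergence. *)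
Lemma ge0_integral_density (m1 m2 : {measure set S -> \bar R}) (rho : S -> R) :
  measurable_fun setT rho -> (forall x, 0 <= rho x)%R ->
  (forall A, measurable A -> m1 A = \int[m2]_x ((\1_A x)%:E * (rho x)%:E)) ->
  forall f : S -> \bar R, measurable_fun setT f -> (forall x, 0 <= f x) ->
    \int[m1]_x f x = \int[m2]_x (f x * (rho x)%:E).
Proof.
move=> /measurable_EFinP mrho rho0' m1E f mf f0.
have rho0 x : 0 <= (rho x)%:E by rewrite lee_fin.
pose f_ := nnsfun_approx measurableT mf.
have cvf x : limn (fun n => (f_ n x)%:E) = f x.
  by apply/cvg_lim => //; apply: cvg_nnsfun_approx => // y _.
have f_ge0 n x : 0 <= (f_ n x)%:E by rewrite lee_fin.
have f_nd x : nondecreasing_seq (fun n => (f_ n x)%:E).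
  by move=> a b ab; rewrite lee_fin; exact/lefP/nd_nnsfun_approx.
transitivity (limn (fun n => \int[m1]_x (f_ n x)%:E)).
  rewrite -monotone_convergence//.
  - by apply: eq_integral => x _; rewrite cvf.
  - by move=> n; exact/measurable_EFinP.
transitivity (limn (fun n => \int[m2]_x ((f_ n x)%:E * (rho x)%:E))); last first.
  rewrite -monotone_convergence//.
  - apply: eq_integral => x _; rewrite -cvf.
    apply/cvg_lim => //; apply: cvgeZr => //.
    by rewrite cvf; apply: cvg_nnsfun_approx => // y _.
  - by move=> n; apply: emeasurable_funM => //; exact/measurable_EFinP.
  - by move=> n x _; rewrite mule_ge0.
  - by move=> x _ a b ab; rewrite lee_wpmul2r// f_nd.
congr (limn _); apply/funext => n.
have mind r : measurable_fun setT (fun x => (r * \1_(f_ n @^-1` [set r]) x)%:E).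
  by apply/measurable_EFinP/measurable_funM => //; exact: measurable_indic.
transitivity (\sum_(r \in range (f_ n)) \int[m1]_x (r * \1_(f_ n @^-1` [set r]) x)%:E).
  under eq_integral do rewrite fimfunE -fsumEFin//.
  by rewrite ge0_integral_fsum// => r x _; rewrite nnfun_muleindic_ge0.
transitivity (\sum_(r \in range (f_ n)) \int[m2]_x ((r * \1_(f_ n @^-1` [set r]) x)%:E * (rho x)%:E)).
  apply: eq_fsbigr => r /set_mem [y _ yr].
  have r0 : (0 <= r)%R by rewrite -yr.
  rewrite integralZl_indic_nnsfun// integral_indic// setIT m1E//.
  rewrite -ge0_integralZl//.
  - by apply: eq_integral => x _; rewrite EFinM muleA.
  - by apply: emeasurable_funM => //; apply/measurable_EFinP; exact: measurable_indic.
  - by move=> x _; rewrite mule_ge0.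
rewrite -ge0_integral_fsum//.
- apply: eq_integral => x _; rewrite [in RHS]fimfunE -fsumEFin//.
  rewrite ge0_mule_fsuml// => r; exact: nnfun_muleindic_ge0.
- by move=> r; apply: emeasurable_funM.
- by move=> r x _; rewrite mule_ge0// nnfun_muleindic_ge0.
Qed.

End density.

Section cameron_martin.
Context {R : realType} {n : nat}.

(** With covariance I/2 the density is proportional to exp(-|z|^2), and the weight is the quotient
    of its values at z - u and at z. Taking [F] nonnegative spares any integrability condition. *)
Definition cameron_martin (gam : probability 'cV[R]_n R) :=
  forall (u : 'cV[R]_n) (F : 'cV[R]_n -> \bar R),
    measurable_fun setT F -> (forall x, 0 <= F x)%E ->
    (\int[gam]_z F (z + u)%R =
     \int[gam]_z (F z * (expR (2 * dot u z - dot u u))%:E))%E.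

Lemma half_gaussian_pdfE (x : 'cV[R]_n) : gaussian_pdf 0 (2^-1)%:M x =
  expR (- dot x x) / Num.sqrt ((2 * pi) ^+ n * \det ((2^-1)%:M : 'M[R]_n)).
Proof.
rewrite /gaussian_pdf subr0 invmx_scalar invrK mul_mx_scalar -scalemxAl mxE.
rewrite mulrAC divff ?mul1r// mxE.
by under eq_bigr do rewrite mxE.
Qed.

(** Translation invariance of Lebesgue measure moves the shift onto the density. The normalising
    constant [C] stands on both sides and is never evaluated. *)
Lemma gaussian_cameron_martin d (T : measurableType d) (P : probability T R)
    (X : {RV P >-> 'cV[R]_n}) :
  is_gaussian P 0 (2^-1)%:M X -> cameron_martin (distribution P X).
Proof.
move=> gX u F mF F0.
have [mu muE] := @lebesgue_int_measure R n.
set C := Num.sqrt ((2 * pi) ^+ n * \det ((2^-1)%:M : 'M[R]_n)).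
have mdot : measurable_fun setT (fun x : 'cV[R]_n => dot x x) by exact: measurable_dot.
pose rho (x : 'cV[R]_n) := expR (- dot x x) / C.
have mrho : measurable_fun setT rho.
  apply: measurable_funM => //; apply: (measurableT_comp (@measurable_expR R)).
  exact: measurable_funN.
have rho0 x : 0 <= rho x by rewrite mulr_ge0 ?expR_ge0 ?invr_ge0 ?sqrtr_ge0.
have dE : forall A, measurable A -> distribution P X A = (\int[mu]_x ((\1_A x)%:E * (rho x)%:E))%E.
  move=> A mA; rewrite [LHS]gX//.
  have -> : (fun x : 'cV[R]_n => (\1_A x * gaussian_pdf 0 (2^-1)%:M x)%:E) =
            (fun x => (\1_A x)%:E * (rho x)%:E)%E.
    by apply/funext => x; rewrite half_gaussian_pdfE EFinM.
  have [||-> //] := muE (fun x => (\1_A x)%:E * (rho x)%:E)%E.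
    by apply: emeasurable_funM; apply/measurable_EFinP => //; exact: measurable_indic.
  by move=> x; rewrite mule_ge0// lee_fin.
have mFu : measurable_fun setT (fun z : 'cV[R]_n => F (z + u)%R).
  by apply: (measurableT_comp mF); exact: measurable_cVD.
have mw : measurable_fun setT (fun z : 'cV[R]_n => (expR (2 * dot u z - dot u u))%:E).
  apply/measurable_EFinP; apply: (measurableT_comp (@measurable_expR R)).
  apply: measurable_funB => //; apply: measurable_funM => //; exact: measurable_dot.
rewrite !(ge0_integral_density mrho rho0 dE)//; last 2 first.
- exact: emeasurable_funM.
- by move=> x; rewrite mule_ge0// lee_fin expR_ge0.
pose G (x : 'cV[R]_n) := (F x * (rho (x - u)%R)%:E)%E.
transitivity (\int[mu]_x G (x + u)%R)%E.
  by apply: eq_integral => x _; rewrite /G addrK.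
have mG : measurable_fun setT G.
  apply: emeasurable_funM => //; apply/measurable_EFinP.
  by apply: (measurableT_comp mrho); exact: measurable_cVB.
rewrite (muE G mG _).2; last by move=> x; rewrite mule_ge0// lee_fin.
apply: eq_integral => x _; rewrite /G -muleA -EFinM; congr (_ * _%:E)%E.
rewrite /rho mulrA -expRD; congr (expR _ / _).
rewrite !(dotDl, dotDr, dotNl, dotNr) (dotC x u); ring.
Qed.

End cameron_martin.

Section cameron_martin_unique.
Local Open Scope ereal_scope.
Context {R : realType} d (S : measurableType d) (add sub : S -> S -> S) (N : S -> R).
Hypothesis addK : forall x y, sub (add x y) y = x.
Hypothesis addC : forall x y, add x y = add y x.
Hypothesis NsubC : forall x y, N (sub x y) = N (sub y x).
Hypothesis madd : measurable_fun setT (fun p : S * S => add p.1 p.2).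
Hypothesis mN : measurable_fun setT N.
Hypothesis mNsub : measurable_fun setT (fun p : S * S => N (sub p.1 p.2)).

Let cm (mu : probability S R) := forall u F, measurable_fun setT F -> (forall x, 0 <= F x) ->
  \int[mu]_x F (add x u) = \int[mu]_x (F x * (expR (N x - N (sub x u)))%:E).

(* The uniqueness proof of Haar measure, applied to [expR (N x) * mu]. *)
Lemma cameron_martin_unique (mu nu : probability S R) : cm mu -> cm nu ->
  forall F, measurable_fun setT F -> (forall x, 0 <= F x) ->
  \int[mu]_x F x = \int[nu]_x F x.
Proof.
move=> cmu cnu F mF F0.
have mexp (g : S * S -> R) : measurable_fun setT g -> measurable_fun setT (fun p => (expR (g p))%:E).
  by move=> mg; apply/measurable_EFinP; exact: (measurableT_comp (@measurable_expR R)).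
have me1 (g : S -> R) : measurable_fun setT g -> measurable_fun setT (fun p => (expR (g p))%:E).
  by move=> mg; apply/measurable_EFinP; exact: (measurableT_comp (@measurable_expR R)).
have mNx y : measurable_fun setT (fun x => N (sub x y)) := measurableT_comp mNsub (pair2_measurable y).
have maddy y : measurable_fun setT (fun x => add x y) := measurableT_comp madd (pair2_measurable y).
have mN1 : measurable_fun setT (fun p : S * S => N p.1) by exact: (measurableT_comp mN).
have mN2 : measurable_fun setT (fun p : S * S => N p.2) by exact: (measurableT_comp mN).
(* The formula for F = 1: the weight is itself a probability density. *)
have cst1 (m : probability S R) : cm m -> forall x, \int[m]_y (expR (N y - N (sub y x)))%:E = 1.
  move=> cmm x; have := cmm x (cst 1) (measurable_cst _) (fun=> lee01).
  rewrite [LHS](_ : _ = 1) => [->|].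
    by apply: eq_integral => y _; rewrite mul1e.
  by under eq_integral do rewrite /=; rewrite integral_cst// mul1e; exact: probability_setT.
pose G (p : S * S) := F p.1 * (expR (N p.2 - N (sub p.2 p.1)))%:E.
have G0 p : 0 <= G p by rewrite mule_ge0// lee_fin expR_ge0.
have mG : measurable_fun setT G.
  apply: emeasurable_funM; first exact: measurableT_comp.
  apply: mexp; apply: measurable_funB => //.
  by under eq_fun do rewrite NsubC; exact: mNsub.
pose H (p : S * S) := F (add p.1 p.2) * (expR (N p.2 - N (add p.1 p.2)))%:E.
have H0 p : 0 <= H p by rewrite mule_ge0// lee_fin expR_ge0.
have mH : measurable_fun setT H.
  apply: emeasurable_funM; first exact: measurableT_comp.
  by apply: mexp; apply: measurable_funB => //; exact: measurableT_comp.
(* A factor of [nu]-integral one is inserted. Once the integrals are exchanged, the formula for [mu]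
   in x and then the formula for [nu] in y leave F y alone under the integrals. *)
transitivity (\int[mu]_x \int[nu]_y G (x, y)).
  apply: eq_integral => x _; rewrite /G/= ge0_integralZl//.
  - by rewrite (cst1 nu)// mule1.
  - by apply: me1; apply: measurable_funB.
rewrite (fubini_tonelli G)//.
transitivity (\int[nu]_y \int[mu]_x H (x, y)).
  apply: eq_integral => y _.
  pose Phi x := F x * (expR (N y - N x))%:E.
  transitivity (\int[mu]_x (Phi x * (expR (N x - N (sub x y)))%:E)).
    apply: eq_integral => x _; rewrite /G/Phi/= -muleA -EFinM -expRD NsubC.
    by congr (_ * (expR _)%:E); ring.
  rewrite -cmu//; first by apply: emeasurable_funM => //; apply: me1; exact: measurable_funB.
  by move=> ?; rewrite mule_ge0// lee_fin expR_ge0.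
rewrite -(fubini_tonelli H)//.
transitivity (\int[mu]_x \int[nu]_y F y); last first.
  by rewrite integral_cst// [X in _ * X = _]probability_setT mule1.
apply: eq_integral => x _.
pose Phi y := F y * (expR (N (sub y x) - N y))%:E.
transitivity (\int[nu]_y Phi (add y x)).
  by apply: eq_integral => y _; rewrite /H/Phi/= addK addC.
rewrite cnu//.
- apply: eq_integral => y _; rewrite /Phi -muleA -EFinM -expRD.
  by rewrite addrA subrK subrr expR0 mule1.
- by apply: emeasurable_funM => //; apply: me1; exact: measurable_funB.
- by move=> ?; rewrite mule_ge0// lee_fin expR_ge0.
Qed.

End cameron_martin_unique.

(** * Rotation invariance of a pair of independent Gaussian vectors *)

Section rotation.
Local Open Scope ereal_scope.
Context {R : realType} {n : nat} (gam : probability 'cV[R]_n R).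
Hypothesis cm : cameron_martin gam.
Variables a b : R.
Hypothesis ab1 : (a ^+ 2 + b ^+ 2 = 1)%R.

Let U := 'cV[R]_n.
Let rot (p : U * U) : U * U := (a *: p.1 + b *: p.2, b *: p.1 - a *: p.2)%R.

Let mrot : measurable_fun setT rot.
Proof.
apply: measurable_fun_pair.
  by apply: measurable_cVD; exact: measurable_cVZ.
by apply: measurable_cVB; exact: measurable_cVZ.
Qed.

(** [rot] is linear, preserves |x|^2 + |y|^2 and, being a reflection, is its own inverse. Hence the
    image of the product law satisfies the same Cameron-Martin formula, and uniqueness identifies
    the two laws. *)
Lemma gaussian_rotation (F : U * U -> \bar R) :
  measurable_fun setT F -> (forall p, 0 <= F p) ->
  \int[gam \x gam]_p F (rot p) = \int[gam \x gam]_p F p.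
Proof.
move=> mF F0.
pose gg : probability (U * U)%type R := gam \x gam.
pose rv : {mfun (U * U)%type >-> (U * U)%type} := HB.pack rot (isMeasurableFun.Build _ _ _ _ _ mrot).
transitivity (\int[distribution gg rv]_p F p); first by rewrite ge0_integral_distribution.
pose add (p q : U * U) : U * U := (p.1 + q.1, p.2 + q.2)%R.
pose sub (p q : U * U) : U * U := (p.1 - q.1, p.2 - q.2)%R.
pose N (p : U * U) : R := (dot p.1 p.1 + dot p.2 p.2)%R.
have mN : measurable_fun setT N by apply: measurable_funD; exact: measurable_dot.
have madd : measurable_fun setT (fun p : (U * U) * (U * U) => add p.1 p.2).
  apply: measurable_fun_pair; apply: measurable_cVD; exact: measurableT_comp.
have msub : measurable_fun setT (fun p : (U * U) * (U * U) => sub p.1 p.2).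
  apply: measurable_fun_pair; apply: measurable_cVB; exact: measurableT_comp.
have NsubC p q : N (sub p q) = N (sub q p).
  by rewrite /N/= -(opprB q.1) -(opprB q.2) !(dotNl, dotNr) !opprK.
have Nexp (p u : U * U) : (N p - N (sub p u) =
    2 * dot u.1 p.1 - dot u.1 u.1 + (2 * dot u.2 p.2 - dot u.2 u.2))%R.
  rewrite /N/= !(dotDl, dotDr, dotNl, dotNr) (dotC p.1) (dotC p.2); ring.
have me (g : U * U -> R) : measurable_fun setT g -> measurable_fun setT (fun p => (expR (g p))%:E).
  by move=> mg; apply/measurable_EFinP; exact: (measurableT_comp (@measurable_expR R)).
have mNsub u : measurable_fun setT (fun p => N p - N (sub p u))%R.
  by apply: measurable_funB => //; exact: (measurableT_comp mN (measurableT_comp msub (pair2_measurable u))).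
(* Cameron-Martin for the product, one coordinate at a time: the second under the inner integral,
   then the first. *)
have cmgg u G : measurable_fun setT G -> (forall x, 0 <= G x) ->
    \int[gg]_x G (add x u) = \int[gg]_x (G x * (expR (N x - N (sub x u)))%:E).
  move=> mG G0.
  have madd_u : measurable_fun setT (fun x => G (add x u)).
    exact: (measurableT_comp mG (measurableT_comp madd (pair2_measurable u))).
  rewrite fubini_tonelli1// fubini_tonelli1//; last 2 first.
    by apply: emeasurable_funM => //; exact: me.
    by move=> p; rewrite mule_ge0// lee_fin expR_ge0.
  rewrite /fubini_F.
  pose Gu x := \int[gam]_y (G (x, y) * (expR (2 * dot u.2 y - dot u.2 u.2))%:E).
  transitivity (\int[gam]_x Gu (x + u.1)%R).
    apply: eq_integral => x _ /=.
    apply: (cm u.2 (F := fun y => G ((x + u.1)%R, y))) => //.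
    exact: (measurableT_comp mG (pair1_measurable _)).
  have mw2 : measurable_fun setT (fun z : U * U => (expR (2 * dot u.2 z.2 - dot u.2 u.2))%:E).
    apply: me; apply: measurable_funB => //; apply: measurable_funM => //.
    exact: measurable_dot.
  rewrite (cm u.1 (F := Gu))//; last 2 first.
    apply: (measurable_fun_fubini_tonelli_F (fun z : U * U => G z * (expR (2 * dot u.2 z.2 - dot u.2 u.2))%:E)).
    - exact: emeasurable_funM.
    - by move=> z; rewrite mule_ge0// lee_fin expR_ge0.
    by move=> x; apply: integral_ge0 => y _; rewrite mule_ge0// lee_fin expR_ge0.
  apply: eq_integral => x _ /=; rewrite -ge0_integralZr//.
  - apply: eq_integral => y _; rewrite Nexp -muleA -EFinM -expRD.
    by congr (_ * (expR _)%:E); exact: addrC.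
  - apply: emeasurable_funM; first exact: (measurableT_comp mG (pair1_measurable _)).
    exact: (measurableT_comp mw2 (pair1_measurable x)).
  - by move=> y _; rewrite mule_ge0// lee_fin expR_ge0.
apply: (@cameron_martin_unique _ _ _ add sub N) => //.
- by move=> [x1 x2] [y1 y2]; rewrite /sub/add/= !addrK.
- by move=> [x1 x2] [y1 y2]; rewrite /add/= addrC (addrC x2).
- exact: (measurableT_comp mN msub).
- move=> u G mG G0.
  have mGu : measurable_fun setT (fun p => G (add p u)).
    exact: (measurableT_comp mG (measurableT_comp madd (pair2_measurable u))).
  have rotK p : rot (rot p) = p.
    case: p => x y; rewrite /rot/= !scalerDr !scalerN !scalerA opprB.
    congr pair.
      rewrite addrACA -scalerDl -!expr2 ab1 scale1r mulrC subrr addr0//.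
    rewrite [X in (_ + X)%R]addrC addrACA (mulrC b a) addrN add0r.
    by rewrite -scalerDl -!expr2 addrC ab1 scale1r.
  have rotD p q : rot (add p q) = add (rot p) (rot q).
    rewrite /rot/add/=; congr pair; rewrite !scalerDr ?opprD; exact: addrACA.
  have rotN p : N (rot p) = N p.
    rewrite /N/= !(dotDl, dotDr, dotNl, dotNr, dotZl, dotZr) (dotC p.2 p.1).
    transitivity ((a ^+ 2 + b ^+ 2) * (dot p.1 p.1 + dot p.2 p.2))%R; first ring.
    by rewrite ab1 mul1r.
  have rotB p q : rot (sub p q) = sub (rot p) (rot q).
    have subE p' q' : sub p' q' = add p' (sub (0, 0)%R q') by rewrite /sub/add/= !sub0r.
    rewrite subE rotD [RHS]subE; congr add.
    rewrite /rot/sub/= !sub0r !scalerN opprD !opprK; congr pair.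
    by rewrite addrC opprB.
  rewrite !ge0_integral_distribution//; last 2 first.
    by apply: emeasurable_funM => //; apply: me.
    by move=> x; rewrite mule_ge0// lee_fin expR_ge0.
  (* A shift by u after [rot] is a shift by [rot u] before it. *)
  transitivity (\int[gg]_x (G \o rot) (add x (rot u))).
    by apply: eq_integral => x _ /=; rewrite rotD rotK.
  rewrite (cmgg (rot u) (G \o rot)).
  + by apply: eq_integral => x _ /=; rewrite -(rotN (sub _ _)) rotB rotK rotN.
  + exact: measurableT_comp.
  + by move=> x; exact: G0.
Qed.

End rotation.

(** * Exponentially bounded functions *)

Section Rintegral_extra.
Context {R : realType} d (S : measurableType d) (m : {measure set S -> \bar R}).

Lemma integrable_sumR (I : Type) (r : seq I) (f : I -> S -> R) :
  (forall i, m.-integrable setT (EFin \o f i)) ->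
  m.-integrable setT (EFin \o (fun x => \sum_(i <- r) f i x)).
Proof.
move=> fi; rewrite (_ : _ \o _ = (fun x => \sum_(i <- r) (EFin \o f i) x)%E).
  exact: integrable_sum.
by apply/funext => x; rewrite /= sumEFin.
Qed.

Lemma Rintegral_sum (I : Type) (r : seq I) (f : I -> S -> R) :
  (forall i, m.-integrable setT (EFin \o f i)) ->
  \int[m]_x (\sum_(i <- r) f i x) = \sum_(i <- r) \int[m]_x f i x.
Proof.
move=> fi; elim: r => [|i r IH].
  rewrite big_nil; under eq_Rintegral do rewrite big_nil.
  by rewrite Rintegral_cst// mul0r.
rewrite big_cons -IH -RintegralD//; last exact: integrable_sumR.
by apply: eq_Rintegral => x _; rewrite big_cons.
Qed.

Lemma integrableDR (f g : S -> R) : m.-integrable setT (EFin \o f) ->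
  m.-integrable setT (EFin \o g) -> m.-integrable setT (EFin \o (fun x => f x + g x)).
Proof. by move=> fi gi; have := integrableD measurableT fi gi. Qed.

Lemma integrableBR (f g : S -> R) : m.-integrable setT (EFin \o f) ->
  m.-integrable setT (EFin \o g) -> m.-integrable setT (EFin \o (fun x => f x - g x)).
Proof. by move=> fi gi; have := integrableB measurableT fi gi. Qed.

Lemma integrableZR k (f : S -> R) : m.-integrable setT (EFin \o f) ->
  m.-integrable setT (EFin \o (fun x => k * f x)).
Proof. by move=> fi; have := integrableZl measurableT k fi. Qed.

Lemma le_integrableR (f g : S -> R) : measurable_fun setT f ->
  (forall x, `|f x| <= g x) -> m.-integrable setT (EFin \o g) ->
  m.-integrable setT (EFin \o f).
Proof.
move=> mf fg; apply: le_integrable => //; first exact/measurable_EFinP.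
by move=> x _ /=; rewrite lee_fin (le_trans (fg x))// ler_norm.
Qed.

Lemma measurable_integrableR (f : S -> R) : m.-integrable setT (EFin \o f) ->
  measurable_fun setT f.
Proof. by move=> /measurable_int/measurable_EFinP. Qed.

End Rintegral_extra.

Lemma probability_fine {R : realType} d (S : measurableType d) (P : probability S R) :
  fine (P setT) = 1.
Proof. by rewrite -[RHS]/(fine 1); congr fine; exact: probability_setT. Qed.

Section expbounded.
Context {R : realType} d (S : measurableType d) (N : S -> R).
Hypothesis N_ge0 : forall s, 0 <= N s.

(** One growth class for polynomials, Lipschitz functions and exponential weights, closed under sums
    and products and integrable as soon as the exponentials of [N] are. The [1 +] lets the exponent
    absorb constant factors. [N] is a parameter because it is used both for |z| and for |z1| +
    |z2|. *)
Definition expbounded (F : S -> R) := measurable_fun setT F /\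
  exists2 c, 0 <= c & forall s, `|F s| <= expR (c * (1 + N s)).

Let N1 s : 1 <= 1 + N s. Proof. by rewrite lerDl. Qed.

Lemma expbounded_cst k : expbounded (fun=> k).
Proof.
split=> //; exists `|k| => // s; have := expR_ge1Dx (`|k| * (1 + N s)).
by have := ler_peMr (normr_ge0 k) (N1 s); lra.
Qed.

Lemma expboundedD F G : expbounded F -> expbounded G -> expbounded (fun s => F s + G s).
Proof.
move=> [mF [c c0 Fc]] [mG [c' c'0 Gc]]; split; first exact: measurable_funD.
(* The extra 1 pays for a factor 2, which is at most exp(1 + N). *)
exists (1 + c + c'); first by rewrite !addr_ge0.
move=> s; have h0 x : 0 <= x -> 0 <= x * (1 + N s) by move=> x0; rewrite mulr_ge0// (le_trans ler01).
apply: (@le_trans _ _ (expR (c * (1 + N s)) + expR (c' * (1 + N s)))).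
  by rewrite (le_trans (ler_normD _ _))// lerD.
apply: (@le_trans _ _ (2 * expR ((c + c') * (1 + N s)))).
  have : expR (c * (1 + N s)) <= expR ((c + c') * (1 + N s)).
    by rewrite ler_expR mulrDl lerDl h0.
  have : expR (c' * (1 + N s)) <= expR ((c + c') * (1 + N s)).
    by rewrite ler_expR mulrDl lerDr h0.
  lra.
have -> : (1 + c + c') * (1 + N s) = 1 + N s + (c + c') * (1 + N s) by ring.
rewrite [leRHS]expRD ler_wpM2r ?expR_ge0//.
by have := expR_ge1Dx (1 + N s); have := N1 s; lra.
Qed.

Lemma expboundedM F G : expbounded F -> expbounded G -> expbounded (fun s => F s * G s).
Proof.
move=> [mF [c c0 Fc]] [mG [c' c'0 Gc]]; split; first exact: measurable_funM.
exists (c + c'); first by rewrite addr_ge0.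
by move=> s; rewrite normrM mulrDl expRD ler_pM.
Qed.

Lemma expboundedZ k F : expbounded F -> expbounded (fun s => k * F s).
Proof. by move=> bF; apply: expboundedM => //; exact: expbounded_cst. Qed.

Lemma expboundedB F G : expbounded F -> expbounded G -> expbounded (fun s => F s - G s).
Proof.
move=> bF bG; under eq_fun do rewrite -mulN1r.
by apply: expboundedD => //; exact: expboundedZ.
Qed.

Lemma expbounded_sum (I : Type) (r : seq I) (F : I -> S -> R) :
  (forall i, expbounded (F i)) -> expbounded (fun s => \sum_(i <- r) F i s).
Proof.
move=> bF; elim: r => [|i r IH].
  by under eq_fun do rewrite big_nil; exact: expbounded_cst.
by under eq_fun do rewrite big_cons; exact: expboundedD.
Qed.

Lemma expboundedX (F : S -> R) k : expbounded F -> expbounded (fun s => F s ^+ k).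
Proof.
move=> bF; elim: k => [|k IH]; first exact: expbounded_cst.
by under eq_fun do rewrite exprS; exact: expboundedM.
Qed.

Lemma expbounded_le (F G : S -> R) : measurable_fun setT F -> (forall s, `|F s| <= G s) ->
  expbounded G -> expbounded F.
Proof.
move=> mF FG [_ [c c0 Gc]]; split=> //; exists c => // s.
by rewrite (le_trans (FG s))// (le_trans (ler_norm _)).
Qed.

Lemma expbounded_norm F : expbounded F -> expbounded (fun s => `|F s|).
Proof.
move=> [mF [c c0 Fc]]; split; first exact: measurableT_comp.
by exists c => // s; rewrite normr_id.
Qed.

Lemma expbounded_weight : measurable_fun setT N -> expbounded N.
Proof.
move=> mN; split=> //; exists 1 => // s; rewrite mul1r ger0_norm//.
by have := expR_ge1Dx (1 + N s); have := N1 s; lra.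
Qed.

Lemma expbounded_exp a b : measurable_fun setT N -> expbounded (fun s => expR (a + b * N s)).
Proof.
move=> mN; split.
  apply: (measurableT_comp (@measurable_expR R)).
  by apply: measurable_funD => //; exact: measurable_funM.
exists (`|a| + `|b|) => [|s]; first by rewrite addr_ge0.
rewrite gtr0_norm ?expR_gt0// ler_expR mulrDl lerD//.
  by rewrite (le_trans (ler_norm _))// ler_peMr.
by rewrite (le_trans (ler_norm _))// normrM (ger0_norm (N_ge0 s)) ler_wpM2l// lerDr.
Qed.

Lemma expbounded_integrable (m : {measure set S -> \bar R}) F :
  (forall c, m.-integrable setT (EFin \o (fun s => expR (c * (1 + N s))))) ->
  expbounded F -> m.-integrable setT (EFin \o F).
Proof. by move=> intN [mF [c c0 Fc]]; exact: le_integrableR (intN c). Qed.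

End expbounded.

Section transfer_real.
Local Open Scope ereal_scope.
Context {R : realType} d1 d2 (S1 : measurableType d1) (S2 : measurableType d2).
Variables (m1 : {measure set S1 -> \bar R}) (m2 : {measure set S2 -> \bar R}).

(** Positive and negative parts have the same integrals on both sides, so the equality needs no
    integrability and holds even where these integrals are infinite. *)
Lemma transfer_integral (phi : S1 -> S2) (w : S2 -> R) (F : S2 -> R) :
  (forall s, (0 <= w s)%R) ->
  (forall G : S2 -> \bar R, measurable_fun setT G -> (forall s, 0 <= G s) ->
    \int[m1]_s G (phi s) = \int[m2]_s (G s * (w s)%:E)) ->
  measurable_fun setT F ->
  (\int[m1]_s F (phi s) = \int[m2]_s (F s * w s) :> R)%R.
Proof.
move=> w0 H mF; congr fine.
have /measurable_EFinP mF' := mF.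
rewrite integralE [RHS]integralE.
rewrite (_ : (fun s => (F (phi s))%:E) = (EFin \o F) \o phi)// funepos_comp funeneg_comp.
congr (_ - _).
  rewrite H//; last exact: measurable_funepos.
  apply: eq_integral => s _; rewrite !funeposE.
  by rewrite [in LHS]muleC maxe_pMr ?lee_fin// mule0 -EFinM mulrC.
rewrite H//; last exact: measurable_funeneg.
apply: eq_integral => s _; rewrite !funenegE.
by rewrite [in LHS]muleC maxe_pMr ?lee_fin// mule0 muleN -EFinM mulrC.
Qed.

End transfer_real.

Section exp_bounds.
Context {R : realType}.
Implicit Types x w : R.

(** From 1 + w <= e^w at w and at -w: the remainder is nonnegative and at most w (e^w - 1), which is
    then bounded separately for each sign of w. *)
Lemma expR_taylor1 w : `|expR w - 1 - w| <= w ^+ 2 * expR `|w|.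
Proof.
have h1 := expR_ge1Dx w.
have h2 : expR w - 1 <= w * expR w.
  have := expR_ge1Dx (- w); rewrite expRN => h.
  have := expR_gt0 w => e0.
  have : (1 - w) * expR w <= 1 by rewrite -ler_pdivlMr// div1r.
  lra.
rewrite ger0_norm; last lra.
have [w0|w0] := leP 0 w.
  rewrite (ger0_norm w0).
  have : w * (expR w - 1) <= w * (w * expR w) by rewrite ler_wpM2l.
  rewrite expr2; lra.
have e1 : 1 <= expR `|w| by have := expR_ge1Dx `|w|; have := normr_ge0 w; lra.
have : - w * (1 - expR w) <= - w * - w by rewrite ler_wpM2l//; lra.
have : w ^+ 2 * 1 <= w ^+ 2 * expR `|w| by rewrite ler_wpM2l// sqr_ge0.
rewrite expr2; lra.
Qed.

(** The derivative of this remainder is the remainder of order one, so the mean value theorem raises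
    the order; the factor 1/6 is given up. *)
Lemma expR_taylor2 w : `|expR w - 1 - w - w ^+ 2 / 2| <= `|w| ^+ 3 * expR `|w|.
Proof.
have [->|w0] := eqVneq w 0.
  by rewrite expR0 expr0n/= normr0 expr0n/= !mul0r !subr0 subrr normr0.
pose f : R -> R := expR - cst 1 - id - 2^-1 *: (id * id).
have fx x : f x = expR x - 1 - x - x ^+ 2 / 2 by rewrite expr2 mulrC.
have df x : is_derive x 1 f (expR x - 1 - x).
  by apply: is_derive_eq; rewrite /= /GRing.scale/= mulr1; lra.
have cf a b : {within `[a, b], continuous f}.
  apply: derivable_within_continuous => x _; exact: (ex_derive (is_derive := df x)).
have f0 : f 0 = 0 by rewrite fx expR0 expr0n/= !mul0r; lra.
have [c cw fE] : exists2 c, `|c| <= `|w| & f w = (expR c - 1 - c) * w.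
  have [w_gt0|w_lt0] : 0 < w \/ w < 0 by apply/orP; rewrite -neq_lt eq_sym.
    have [c] := MVT w_gt0 (fun x _ => df x) (cf _ _).
    rewrite in_itv/= f0 !subr0 => /andP[c0 cw] fE; exists c => //.
    by rewrite !gtr0_norm// ltW.
  have [c] := MVT w_lt0 (fun x _ => df x) (cf _ _).
  rewrite in_itv/= f0 sub0r => /andP[wc c0] fE; exists c.
    by rewrite !ltr0_norm// lerN2 ltW.
  lra.
rewrite -fx fE normrM exprSr.
have {}h : `|expR c - 1 - c| <= `|w| ^+ 2 * expR `|w|.
  apply: (le_trans (expR_taylor1 c)); apply: ler_pM => //; rewrite ?sqr_ge0 ?expR_ge0//.
    by rewrite -(real_normK (num_real c)) lerXn2r// nnegrE.
  by rewrite ler_expR.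
by rewrite mulrAC ler_wpM2r.
Qed.

End exp_bounds.

(** * Gaussian moments and the second order expansion *)

Section small_parameter.
Context {R : realType}.
Implicit Types A B C K s : R.

Lemma le_of_small A B K s0 : 0 < s0 -> (forall s, 0 < s -> s <= s0 -> A <= B + K * s) -> A <= B.
Proof.
move=> s0_gt0 H; apply/ler_addgt0Pr => e e0.
pose s := Num.min s0 (e / (`|K| + 1)).
have K1 : 0 < `|K| + 1 by rewrite ltr_wpDl.
have s_gt0 : 0 < s by rewrite lt_min s0_gt0 divr_gt0.
apply: (le_trans (H s s_gt0 _)); first by rewrite ge_min lexx.
rewrite lerD2l; apply: (@le_trans _ _ ((`|K| + 1) * s)).
  by rewrite ler_wpM2r ?(ltW s_gt0)// (le_trans (ler_norm K))// lerDl.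
by rewrite -ler_pdivlMl// mulrC ge_min lexx orbT.
Qed.

Lemma eq0_of_small A K s0 : 0 < s0 -> (forall s, 0 < s -> s <= s0 -> `|A| <= K * s) -> A = 0.
Proof.
move=> s00 H; apply/eqP; rewrite -normr_le0; apply: (@le_of_small _ _ K s0) => // s *.
by rewrite add0r H.
Qed.

End small_parameter.

Section gaussian_taylor.
Context {R : realType} {n : nat} (gam : probability 'cV[R]_n R).
Hypothesis cm : cameron_martin gam.
Implicit Types (u v z : 'cV[R]_n) (F : 'cV[R]_n -> R).

Local Notation eb := (expbounded (@enorm R n)).

Lemma gaussian_shift u F : measurable_fun setT F ->
  \int[gam]_z F (z + u) = \int[gam]_z (F z * expR (2 * dot u z - dot u u)).
Proof.
move=> mF; apply: (@transfer_integral _ _ _ _ _ gam gam (fun z => z + u)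
  (fun z => expR (2 * dot u z - dot u u))) => // G mG G0.
exact: cm.
Qed.

Lemma measurable_dotr u : measurable_fun setT (dot u).
Proof. exact: measurable_dot. Qed.

(** By Cameron-Martin for F = 1, exp(2 <u, z> - |u|^2) has integral one. *)
Lemma integrable_expdot u : gam.-integrable setT (EFin \o (fun z => expR (2 * dot u z))).
Proof.
have H : gam.-integrable setT (EFin \o (fun z => expR (2 * dot u z - dot u u))).
  apply/integrableP; split.
    apply/measurable_EFinP; apply: (measurableT_comp (@measurable_expR R)).
    apply: measurable_funB => //; apply: measurable_funM => //; exact: measurable_dotr.
  have := cm u (measurable_cst 1%E) (fun=> lee01).
  rewrite [LHS](_ : _ = 1%E); last first.
    by rewrite integral_cst// mul1e; exact: probability_setT.
  move=> H; apply: (@le_lt_trans _ _ 1%E); last by rewrite ltry.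
  rewrite H le_eqVlt; apply/orP; left; apply/eqP; apply: eq_integral => z _.
  by rewrite /= mul1e ger0_norm ?expR_ge0.
rewrite (_ : (fun z => _) = (fun z => expR (dot u u) * expR (2 * dot u z - dot u u))).
  exact: integrableZR.
by apply/funext => z; rewrite -expRD addrC subrK.
Qed.

(** |z| is at most n times its largest coordinate in modulus, and e^|t| <= e^t + e^-t. The vectors
    are scaled so that each exponent 2 <u, z> is c n z_i up to sign, which reduces integrability to
    [integrable_expdot]. The summand 1 covers n = 0. *)
Lemma expR_enorm_le (c : R) z : 0 <= c -> expR (c * enorm z) <=
  1 + \sum_i (expR (2 * dot ((c * n%:R / 2) *: delta_mx i 0) z) +
              expR (2 * dot (- (c * n%:R / 2) *: delta_mx i 0) z)).
Proof.
move=> c0.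
have dotd a i : 2 * dot (a / 2 *: delta_mx i 0) z = a * z i 0.
  rewrite dotZl /dot (bigD1 i)//= !mxE !eqxx big1 => [|j ji].
    by rewrite mul1r addr0; lra.
  by rewrite !mxE (negbTE ji) mul0r.
under eq_bigr do rewrite dotd -mulNr dotd.
have nn : 0 <= \sum_i (expR (c * n%:R * z i 0) + expR (- (c * n%:R) * z i 0)).
  by apply: sumr_ge0 => i _; rewrite addr_ge0 ?expR_ge0.
have [n0|n0] := posnP n.
  rewrite (_ : enorm z = 0) ?mulr0 ?expR0 ?lerDl//.
  apply/eqP; rewrite eq_le enorm_ge0 andbT (le_trans (enorm_le_sum _))// big1// => i _.
  by move: (ltn_ord i); rewrite {2}n0.
pose i0 := [arg max_(i > Ordinal n0) `|z i 0|]%O.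
have hmax i : `|z i 0| <= `|z i0 0|.
  by rewrite /i0; case: arg_maxP => // j _ /(_ i)/(_ isT).
have zn : enorm z <= n%:R * `|z i0 0|.
  apply: (le_trans (enorm_le_sum _)); have -> : n%:R * `|z i0 0| = \sum_(i < n) `|z i0 0|.
    by rewrite sumr_const card_ord mulr_natl.
  exact: ler_sum.
apply: (@le_trans _ _ (expR (c * n%:R * z i0 0) + expR (- (c * n%:R) * z i0 0))).
  apply: (@le_trans _ _ (expR (c * n%:R * `|z i0 0|))).
    by rewrite ler_expR -mulrA ler_wpM2l.
  have [z0|z0] := leP 0 (z i0 0).
    by rewrite ger0_norm// lerDl expR_ge0.
  by rewrite ltr0_norm// mulNr mulrN lerDr expR_ge0.
rewrite (bigD1 i0)//= addrCA lerDl addr_ge0//; apply: sumr_ge0 => i _.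
by rewrite addr_ge0 ?expR_ge0.
Qed.

Lemma measurable_enorm_id : measurable_fun setT (@enorm R n).
Proof. exact: measurable_enorm. Qed.

Lemma gaussian_exp_integrable c :
  gam.-integrable setT (EFin \o (fun z => expR (c * (1 + enorm z)))).
Proof.
pose G z : R := expR `|c| * (1 + \sum_i (expR (2 * dot ((`|c| * n%:R / 2) *: delta_mx i 0) z) +
              expR (2 * dot (- (`|c| * n%:R / 2) *: delta_mx i 0) z))).
apply: (@le_integrableR _ _ _ _ _ G).
- apply: (measurableT_comp (@measurable_expR R)); apply: measurable_funM => //.
  by apply: measurable_funD => //; exact: measurable_enorm_id.
- move=> z; rewrite ger0_norm ?expR_ge0// mulrDr mulr1 expRD.
  apply: ler_pM; rewrite ?expR_ge0//; first by rewrite ler_expR ler_norm.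
  apply: le_trans (expR_enorm_le z (normr_ge0 c)).
  by rewrite ler_expR ler_wpM2r ?enorm_ge0// ler_norm.
- apply: integrableZR; apply: integrableDR.
    exact: finite_measure_integrable_cst.
  apply: integrable_sumR => i; apply: integrableDR; exact: integrable_expdot.
Qed.

Lemma eb_integrable F : eb F -> gam.-integrable setT (EFin \o F).
Proof. by apply: expbounded_integrable; exact: gaussian_exp_integrable. Qed.

Lemma eb_enorm : eb (@enorm R n).
Proof. apply: expbounded_weight; [exact: enorm_ge0|exact: measurable_enorm_id]. Qed.

Lemma eb_dot u : eb (dot u).
Proof.
apply: (@expbounded_le _ _ _ _ _ (fun z => enorm u * enorm z)).
- exact: measurable_dotr.
- by move=> z; exact: dot_le.
- by apply: expboundedZ; [exact: enorm_ge0|exact: eb_enorm].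
Qed.

Lemma eb_expR_enorm a b : eb (fun z => expR (a + b * enorm z)).
Proof. by apply: expbounded_exp; [exact: enorm_ge0|exact: measurable_enorm_id]. Qed.

(* First and second order terms in [u] of the density [exp(2 <u, z> - |u|^2)]. *)
Definition T1 u z : R := 2 * dot u z.
Definition T2 u z : R := 2 * dot u z ^+ 2 - dot u u.

Lemma eb_T1 u : eb (T1 u).
Proof. by apply: expboundedZ; [exact: enorm_ge0|exact: eb_dot]. Qed.

Lemma eb_T2 u : eb (T2 u).
Proof.
apply: expboundedB; [exact: enorm_ge0| |apply: expbounded_cst; exact: enorm_ge0].
apply: expboundedZ; [exact: enorm_ge0|].
apply: expboundedX; [exact: enorm_ge0|exact: eb_dot].
Qed.

Let rho u z : R := expR (2 * dot u z - dot u u) - 1 - T1 u z - T2 u z.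
Let kappa z : R := 28 * expR (2 + 4 * enorm z).

(** With x = 2|z| + 1 the two parts of [rho] are at most |u|^3 x^3 e^x and |u|^3 x. As x^3 <= 6 e^x,
    their sum is at most 7 |u|^3 e^(2x), and 2x = 2 + 4|z| is the exponent in [kappa]. *)
Let rho_le u z : enorm u <= 1 -> `|rho u z| <= enorm u ^+ 3 * kappa z.
Proof.
set r := enorm u => r1; set x := 2 * enorm z + 1.
have r0 : 0 <= r := enorm_ge0 u.
have z0 := enorm_ge0 z.
have x1 : 1 <= x by rewrite /x; lra.
set p := 2 * dot u z; set q := dot u u.
have qE : q = r ^+ 2 by rewrite enorm_sqr.
have rr : r ^+ 2 <= r by rewrite expr2 ler_piMl.
have p_le : `|p| <= 2 * r * enorm z.
  by rewrite /p normrM (ger0_norm (ler0n _ 2)) -mulrA ler_wpM2l// dot_le.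
have q0 : 0 <= q by rewrite qE sqr_ge0.
pose w := p - q.
have w_le : `|w| <= r * x.
  apply: (le_trans (ler_normB _ _)); rewrite (ger0_norm q0) /x; lra.
have wx : `|w| <= x by rewrite (le_trans w_le)// ler_piMl//; lra.
(* [T1] is p and [T2] is p^2/2 - q, so the quadratic Taylor polynomial of e^(p - q) differs from 1 +
   [T1] + [T2] by -pq + q^2/2, of order |u|^3. *)
have -> : rho u z = (expR w - 1 - w - w ^+ 2 / 2) + (- (p * q) + q ^+ 2 / 2).
  rewrite /rho /T1 /T2 -/p -/q -/w /w; have -> : dot u z = p / 2 by rewrite /p mulrAC divff ?mul1r.
  by field.
apply: (le_trans (ler_normD _ _)).
have e1 : `|expR w - 1 - w - w ^+ 2 / 2| <= r ^+ 3 * (x ^+ 3 * expR x).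
  apply: (le_trans (expR_taylor2 w)); rewrite mulrA -exprMn.
  by apply: ler_pM; rewrite ?exprn_ge0 ?expR_ge0 ?ler_expR// lerXn2r// nnegrE mulr_ge0//; lra.
have r3 : r ^+ 4 <= r ^+ 3 by rewrite exprS ler_piMl// exprn_ge0.
have e2 : `|- (p * q) + q ^+ 2 / 2| <= r ^+ 3 * x.
  apply: (le_trans (ler_normD _ _)); rewrite normrN normrM (ger0_norm q0).
  have -> : `|q ^+ 2 / 2| = r ^+ 4 / 2 by rewrite ger0_norm ?divr_ge0 ?sqr_ge0// qE -exprM.
  have : `|p| * q <= 2 * r * enorm z * q by rewrite ler_wpM2r.
  have -> : 2 * r * enorm z * q = r ^+ 3 * (2 * enorm z) by rewrite qE; ring.
  have r30 : 0 <= r ^+ 3 by rewrite exprn_ge0.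
  rewrite /x mulrDr mulr1; lra.
apply: (le_trans (lerD e1 e2)); rewrite -mulrDr ler_wpM2l ?exprn_ge0// /kappa.
have -> : 2 + 4 * enorm z = x + x by rewrite /x; ring.
rewrite (expRD x x).
have ex : 1 + x <= expR x := expR_ge1Dx x.
have e3 : x ^+ 3 <= 6 * expR x.
  have := @expR_ge1Dxn R x 2; rewrite (_ : 3`! = 6%N)// => /(_ ltac:(lra)); lra.
have : x ^+ 3 * expR x <= 6 * expR x * expR x by rewrite ler_wpM2r ?expR_ge0.
have : expR x <= expR x * expR x by rewrite ler_peMl ?expR_ge0//; lra.
have := mulr_ge0 (expR_ge0 x) (expR_ge0 x).
lra.
Qed.

Let KG := \int[gam]_z (kappa z * expR (enorm z)).

Let eb_kappa : eb (fun z => kappa z * expR (enorm z)).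
Proof.
apply: expboundedM; [apply: expboundedZ; [exact: enorm_ge0|exact: eb_expR_enorm]|].
by under eq_fun do rewrite -[enorm _]mul1r -[1 * _]add0r; exact: eb_expR_enorm.
Qed.

Lemma eb_expdot u : eb (fun z => expR (2 * dot u z - dot u u)).
Proof.
apply: (@expbounded_le _ _ _ _ _ (fun z => expR (0 + 2 * enorm u * enorm z))); last exact: eb_expR_enorm.
  apply: (measurableT_comp (@measurable_expR R)).
  apply: measurable_funB => //; apply: measurable_funM => //; exact: measurable_dotr.
move=> z; rewrite ger0_norm ?expR_ge0// ler_expR add0r.
have := dot_ge0 u; have := le_trans (ler_norm _) (dot_le u z); lra.
Qed.

(** [psi] needs no smoothness, since Cameron-Martin moves the shift onto the density and the density
    is expanded. The constant depends on [psi] through [A] only, which is what makes later bounds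
    uniform in the base point. *)
Let shift_taylor_bound (psi : 'cV[R]_n -> R) A u : measurable_fun setT psi ->
  (forall z, `|psi z| <= A * expR (enorm z)) -> enorm u <= 1 ->
  `|\int[gam]_z psi (z + u) - \int[gam]_z psi z - \int[gam]_z (psi z * T1 u z)
    - \int[gam]_z (psi z * T2 u z)| <= A * KG * enorm u ^+ 3.
Proof.
move=> mpsi psiA u1.
have ebpsi : eb psi.
  apply: (@expbounded_le _ _ _ _ _ (fun z => A * expR (0 + 1 * enorm z))) => //.
    by move=> z; rewrite add0r mul1r.
  by apply: expboundedZ; [exact: enorm_ge0|exact: eb_expR_enorm].
have i0 := eb_integrable ebpsi.
have i1 := eb_integrable (expboundedM ebpsi (eb_T1 u)).
have i2 := eb_integrable (expboundedM ebpsi (eb_T2 u)).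
have i3 := eb_integrable (expboundedM ebpsi (eb_expdot u)).
rewrite gaussian_shift// -RintegralB// -RintegralB//; last exact: integrableBR.
rewrite -RintegralB//; last by apply: integrableBR => //; exact: integrableBR.
have i4 : gam.-integrable setT (EFin \o (fun z => psi z * expR (2 * dot u z - dot u u) - psi z -
       psi z * T1 u z - psi z * T2 u z)).
  by do 3 (apply: integrableBR => //).
apply: (le_trans (le_normr_Rintegral _ _)) => //.
rewrite /KG mulrAC -RintegralZl//; last exact: eb_integrable.
apply: le_Rintegral => //.
- exact: integrable_norm.
- by apply: integrableZR; exact: eb_integrable.
move=> z _.
have -> : psi z * expR (2 * dot u z - dot u u) - psi z - psi z * T1 u z - psi z * T2 u z =
  psi z * rho u z by rewrite /rho; ring.
rewrite normrM.
have -> : A * enorm u ^+ 3 * (kappa z * expR (enorm z)) =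
  A * expR (enorm z) * (enorm u ^+ 3 * kappa z) by ring.
by apply: ler_pM => //; exact: rho_le.
Qed.

Lemma shift_taylor : exists2 K, 0 <= K & forall (psi : 'cV[R]_n -> R) A u, measurable_fun setT psi ->
  (forall z, `|psi z| <= A * expR (enorm z)) -> enorm u <= 1 ->
  `|\int[gam]_z psi (z + u) - \int[gam]_z psi z - \int[gam]_z (psi z * T1 u z)
    - \int[gam]_z (psi z * T2 u z)| <= A * K * enorm u ^+ 3.
Proof.
exists KG; last exact: shift_taylor_bound.
by apply: Rintegral_ge0 => z _; rewrite !mulr_ge0 ?expR_ge0.
Qed.

Lemma small_scale u : exists2 s0, 0 < s0 & s0 <= 1 /\
  forall s, 0 < s -> s <= s0 -> enorm (s *: u) <= 1.
Proof.
have u1 : 0 < 1 + enorm u by rewrite ltr_wpDr ?enorm_ge0.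
exists (1 + enorm u)^-1; first by rewrite invr_gt0.
split; first by rewrite invf_le1// lerDl enorm_ge0.
move=> s sp; rewrite enormZ gtr0_norm// -[_^-1]mul1r ler_pdivlMr// => /(le_trans _); apply.
by rewrite ler_wpM2l ?(ltW sp)// lerDr.
Qed.

Let T1T2_bound u : exists2 K, 0 <= K & forall s, enorm (s *: u) <= 1 ->
  `|s * \int[gam]_z T1 u z + s ^+ 2 * \int[gam]_z T2 u z| <= K * `|s| ^+ 3.
Proof.
have [K K0 HK] := shift_taylor; exists (K * enorm u ^+ 3).
  by rewrite mulr_ge0// exprn_ge0 ?enorm_ge0.
move=> s s1; have := HK (fun=> 1) 1 (s *: u) (measurable_cst _) _ s1.
rewrite subrr sub0r mul1r enormZ exprMn.
have -> : \int[gam]_z (1 * T1 (s *: u) z) = s * \int[gam]_z T1 u z.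
  rewrite -RintegralZl//; last by apply: eb_integrable; exact: eb_T1.
  by apply: eq_Rintegral => z _; rewrite mul1r /T1 dotZl mulrCA.
have -> : \int[gam]_z (1 * T2 (s *: u) z) = s ^+ 2 * \int[gam]_z T2 u z.
  rewrite -RintegralZl//; last by apply: eb_integrable; exact: eb_T2.
  apply: eq_Rintegral => z _; rewrite mul1r /T2 !(dotZl, dotZr); ring.
rewrite -opprD normrN => H; rewrite -mulrA (mulrC (enorm u ^+ 3)); apply: H => z.
by rewrite normr1 mul1r; have := expR_ge1Dx (enorm z); have := enorm_ge0 z; lra.
Qed.

(** The moments are found without computing an integral. For psi = 1 the shifted and unshifted
    integrals cancel, so s E(T1) + s^2 E(T2) = O(s^3); the values at s and -s separate the odd part
    from the even part, and both must vanish. *)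
Lemma T12_mean0 u : \int[gam]_z T1 u z = 0 /\ \int[gam]_z T2 u z = 0.
Proof.
have [K K0 HK] := T1T2_bound u.
set A := \int[gam]_z T1 u z in HK *; set B := \int[gam]_z T2 u z in HK *.
have [s0 s00 [s01 s0u]] := small_scale u.
have hs s : 0 < s -> s <= s0 -> `|s * A + s ^+ 2 * B| <= K * s ^+ 3 /\
    `|- (s * A) + s ^+ 2 * B| <= K * s ^+ 3.
  move=> sp ss; split; first by rewrite -{3}(gtr0_norm sp); apply: HK; exact: s0u.
  have := HK (- s); rewrite scaleNr enormN normrN (gtr0_norm sp) mulNr sqrrN; apply.
  exact: s0u.
split.
  apply: (@eq0_of_small _ _ K s0) => // s sp ss; have [h1 h2] := hs s sp ss.
  have s1 : s <= 1 by rewrite (le_trans ss).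
  have h3 : `|s * A| <= K * s ^+ 3.
    move: h1 h2; rewrite !ler_norml => /andP[? ?] /andP[? ?]; apply/andP; split; lra.
  move: h3; rewrite normrM (gtr0_norm sp) mulrC -ler_pdivlMr// => /le_trans; apply.
  rewrite exprS mulrCA mulrAC divff ?mul1r ?gt_eqF// ler_wpM2l// expr2 ler_piMl// ltW//.
apply: (@eq0_of_small _ _ K s0) => // s sp ss; have [h1 h2] := hs s sp ss.
have h3 : `|s ^+ 2 * B| <= K * s ^+ 3.
  move: h1 h2; rewrite !ler_norml => /andP[? ?] /andP[? ?]; apply/andP; split; lra.
move: h3; rewrite normrM ger0_norm ?sqr_ge0// mulrC -ler_pdivlMr ?exprn_gt0// => /le_trans; apply.
by rewrite exprSr mulrA mulrAC mulrK ?unitfE ?expf_eq0 ?gt_eqF// mulrC.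
Qed.
Lemma gaussian_mean u : \int[gam]_z dot u z = 0.
Proof.
have [+ _] := T12_mean0 u; rewrite RintegralZl//; last by apply: eb_integrable; exact: eb_dot.
by move=> /eqP; rewrite mulf_eq0 pnatr_eq0/= => /eqP.
Qed.

Lemma eb_dotM u v : eb (fun z => dot u z * dot v z).
Proof. by apply: expboundedM; exact: eb_dot. Qed.

(** The vanishing mean of [T2] is the variance in one direction; polarisation gives the
    covariance. *)
Lemma gaussian_cov u v : \int[gam]_z (dot u z * dot v z) = dot u v / 2.
Proof.
have var w : \int[gam]_z (dot w z * dot w z) = dot w w / 2.
  have i1 : gam.-integrable setT (EFin \o (fun z => dot w z * dot w z)).
    by apply: eb_integrable; exact: eb_dotM.
  have [_] := T12_mean0 w; rewrite RintegralB//.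
  - by rewrite Rintegral_cst// probability_fine mulr1 RintegralZl//; lra.
  - exact: integrableZR.
  - exact: finite_measure_integrable_cst.
have iuv w w' := eb_integrable (eb_dotM w w').
have := var (u + v).
under eq_Rintegral do rewrite dotDl mulrDl !mulrDr.
rewrite RintegralD//; try exact: integrableDR.
rewrite RintegralD// RintegralD// !var !(dotDl, dotDr) (dotC v u).
under [X in _ + (X + _)]eq_Rintegral do rewrite mulrC.
lra.
Qed.

End gaussian_taylor.

Section gaussian_pair.
Context {R : realType} {n : nat} (gam : probability 'cV[R]_n R).
Hypothesis cm : cameron_martin gam.
Local Notation U := 'cV[R]_n.

Definition enorm2 (p : U * U) : R := enorm p.1 + enorm p.2.

Local Notation eb2 := (expbounded enorm2).

Lemma enorm2_ge0 p : 0 <= enorm2 p. Proof. by rewrite addr_ge0 ?enorm_ge0. Qed.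

Lemma measurable_enorm2 : measurable_fun setT enorm2.
Proof. by apply: measurable_funD; exact: measurable_enorm. Qed.

Lemma gaussian2_exp_integrable c :
  (gam \x gam)%E.-integrable setT (EFin \o (fun p => expR (c * (1 + enorm2 p)))).
Proof.
have mexp : measurable_fun setT (fun p => expR (c * (1 + enorm2 p))).
  apply: (measurableT_comp (@measurable_expR R)); apply: measurable_funM => //.
  by apply: measurable_funD => //; exact: measurable_enorm2.
apply/integrable12ltyP; first exact/measurable_EFinP.
pose M := \int[gam]_z expR (0 + c * enorm z).
have i0 := eb_integrable cm (eb_expR_enorm 0 c).
have -> : (\int[gam]_x \int[gam]_y `|(EFin \o (fun p => expR (c * (1 + enorm2 p)))) (x, y)| =
   \int[gam]_x (expR (c + c * enorm x) * M)%:E)%E.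
  have ME : M%:E = (\int[gam]_z (expR (0 + c * enorm z))%:E)%E.
    by rewrite fineK//; exact: (integrable_fin_num measurableT i0).
  apply: eq_integral => x _; rewrite EFinM ME -integralZl//; apply: eq_integral => y _.
  rewrite /= ger0_norm ?expR_ge0// -EFinM -expRD /enorm2; congr (expR _)%:E => /=; ring.
have : gam.-integrable setT (EFin \o (fun x => M * expR (c + c * enorm x))).
  by apply: integrableZR; exact: (eb_integrable cm (eb_expR_enorm c c)).
move=> /integrable_lty => /(_ measurableT); apply: le_lt_trans.
by rewrite le_eqVlt; apply/orP; left; apply/eqP; apply: eq_integral => x _ /=; rewrite mulrC.
Qed.

Lemma eb2_integrable F : eb2 F -> (gam \x gam)%E.-integrable setT (EFin \o F).
Proof. by apply: expbounded_integrable; exact: gaussian2_exp_integrable. Qed.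

Lemma eb2_fst x F : eb2 F -> expbounded (@enorm R n) (fun y => F (x, y)).
Proof.
move=> [mF [c c0 Fc]]; split; first exact: (measurableT_comp mF (pair1_measurable x)).
exists (c * (1 + enorm x)); first by rewrite mulr_ge0// addr_ge0 ?enorm_ge0.
move=> y; apply: (le_trans (Fc (x, y))); rewrite ler_expR -mulrA ler_wpM2l// /enorm2/=.
by have := mulr_ge0 (enorm_ge0 x) (enorm_ge0 y); lra.
Qed.

Lemma eb2_snd y F : eb2 F -> expbounded (@enorm R n) (fun x => F (x, y)).
Proof.
move=> [mF [c c0 Fc]]; split; first exact: (measurableT_comp mF (pair2_measurable y)).
exists (c * (1 + enorm y)); first by rewrite mulr_ge0// addr_ge0 ?enorm_ge0.
move=> x; apply: (le_trans (Fc (x, y))); rewrite ler_expR -mulrA ler_wpM2l// /enorm2/=.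
by have := mulr_ge0 (enorm_ge0 x) (enorm_ge0 y); lra.
Qed.

Lemma gaussian_fubini1 F : eb2 F ->
  gam.-integrable setT (EFin \o (fun x => \int[gam]_y F (x, y))) /\
  \int[(gam \x gam)%E]_p F p = \int[gam]_x \int[gam]_y F (x, y).
Proof.
move=> bF; have iF := eb2_integrable bF.
have E : fubini_F gam (EFin \o F) = EFin \o (fun x => \int[gam]_y F (x, y)).
  apply/funext => x; rewrite /fubini_F/= fineK//.
  by apply: integrable_fin_num => //; apply: (eb_integrable cm); exact: eb2_fst.
split; first by rewrite -E; exact: integrable_fubini_F.
by rewrite /Rintegral -(integral12_prod_meas1 iF) E.
Qed.

Lemma gaussian_fubini2 F : eb2 F ->
  gam.-integrable setT (EFin \o (fun y => \int[gam]_x F (x, y))) /\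
  \int[(gam \x gam)%E]_p F p = \int[gam]_y \int[gam]_x F (x, y).
Proof.
move=> bF; have iF := eb2_integrable bF.
have E : fubini_G gam (EFin \o F) = EFin \o (fun y => \int[gam]_x F (x, y)).
  apply/funext => y; rewrite /fubini_G/= fineK//.
  by apply: integrable_fin_num => //; apply: (eb_integrable cm); exact: eb2_snd.
split.
  have bF' : eb2 (fun p => F (p.2, p.1)).
    have [mF [c c0 Fc]] := bF; split; first exact:
      (measurableT_comp mF (measurable_fun_pair measurable_snd measurable_fst)).
    by exists c => // -[x y]; rewrite (le_trans (Fc _))// /enorm2/= (addrC (enorm y)).
  exact: (gaussian_fubini1 bF').1.
by rewrite /Rintegral -(integral21_prod_meas1 iF) E.
Qed.

Lemma gaussian_rotationR (a b : R) (F : U * U -> R) : a ^+ 2 + b ^+ 2 = 1 ->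
  measurable_fun setT F ->
  \int[(gam \x gam)%E]_p F (a *: p.1 + b *: p.2, b *: p.1 - a *: p.2) =
  \int[(gam \x gam)%E]_p F p.
Proof.
move=> ab1 mF.
rewrite (@transfer_integral _ _ _ _ _ (gam \x gam)%E (gam \x gam)%E
  (fun p => (a *: p.1 + b *: p.2, b *: p.1 - a *: p.2)) (fun=> 1) F)//.
  by apply: eq_Rintegral => p _; rewrite mulr1.
move=> G mG G0; rewrite (gaussian_rotation cm ab1)//.
by apply: eq_integral => p _; rewrite mule1.
Qed.

Lemma expbounded_fst F : expbounded (@enorm R n) F -> eb2 (fun p => F p.1).
Proof.
move=> [mF [c c0 Fc]]; split; first exact: (measurableT_comp mF).
by exists c => // p; rewrite (le_trans (Fc _))// ler_expR ler_wpM2l// lerD2l lerDl enorm_ge0.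
Qed.

Lemma expbounded_snd F : expbounded (@enorm R n) F -> eb2 (fun p => F p.2).
Proof.
move=> [mF [c c0 Fc]]; split; first exact: (measurableT_comp mF).
by exists c => // p; rewrite (le_trans (Fc _))// ler_expR ler_wpM2l// lerD2l lerDr enorm_ge0.
Qed.

End gaussian_pair.

(** * Gaussian smoothing of a Lipschitz function *)

Section smoothing.
Context {R : realType} {n : nat} (gam : probability 'cV[R]_n R).
Hypothesis cm : cameron_martin gam.
Variable g : 'cV[R]_n -> R.
Hypothesis g_lip : lipschitz_with 1 g.
Local Notation U := 'cV[R]_n.
Local Notation eb := (expbounded (@enorm R n)).
Implicit Types (x y u v D : U) (w : U -> R) (M : 'M[R]_n).

Definition smoothed (b : R) (w : U -> R) (y : U) : R := \int[gam]_z (g (y + b *: z) * w z).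

Let mg : measurable_fun setT g := measurable_lipschitz g_lip.

Lemma measurable_affine b y : measurable_fun setT (fun z : U => y + b *: z).
Proof. by apply: measurable_cVD => //; exact: measurable_cVZ. Qed.

Lemma eb_g b y : eb (fun z => g (y + b *: z)).
Proof.
apply: (@expbounded_le _ _ _ _ _ (fun z => `|g y| + `|b| * enorm z)).
- exact: (measurableT_comp mg (measurable_affine b y)).
- move=> z; have := g_lip (y + b *: z) y; rewrite mul1r addrAC subrr add0r enormZ => h.
  by rewrite -[g (_ + _)](subrK (g y)) (le_trans (ler_normD _ _))// addrC lerD.
- apply: expboundedD; [exact: enorm_ge0|apply: expbounded_cst; exact: enorm_ge0|].
  by apply: expboundedZ; [exact: enorm_ge0|exact: eb_enorm].
Qed.

Let intg b y w : eb w -> gam.-integrable setT (EFin \o (fun z => g (y + b *: z) * w z)).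
Proof. by move=> bw; apply: (eb_integrable cm); apply: expboundedM => //; exact: eb_g. Qed.

Lemma smoothedZ b k w y : eb w -> smoothed b (fun z => k * w z) y = k * smoothed b w y.
Proof.
move=> bw; rewrite /smoothed -RintegralZl//; last exact: intg.
by apply: eq_Rintegral => z _; rewrite mulrCA.
Qed.

Lemma smoothed_sum b (I : Type) (r : seq I) (w : I -> U -> R) y : (forall i, eb (w i)) ->
  smoothed b (fun z => \sum_(i <- r) w i z) y = \sum_(i <- r) smoothed b (w i) y.
Proof.
move=> bw; rewrite /smoothed -Rintegral_sum; last by move=> i; exact: intg.
by apply: eq_Rintegral => z _; rewrite mulr_sumr.
Qed.

Lemma smoothed_lip b w : eb w -> lipschitz_with (\int[gam]_z `|w z|) (smoothed b w).
Proof.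
move=> bw x y; rewrite /smoothed -RintegralB//; try exact: intg.
have iw : gam.-integrable setT (EFin \o (fun z => `|w z|)).
  by apply: (eb_integrable cm); exact: expbounded_norm.
have i1 : gam.-integrable setT (EFin \o (fun z => g (x + b *: z) * w z - g (y + b *: z) * w z)).
  by apply: integrableBR; exact: intg.
apply: (le_trans (le_normr_Rintegral _ i1)) => //.
rewrite mulrC -RintegralZl//; apply: le_Rintegral => //.
- exact: integrable_norm.
- exact: integrableZR.
move=> z _; rewrite -mulrBl normrM ler_wpM2r//.
by have := g_lip (x + b *: z) (y + b *: z); rewrite mul1r opprD addrACA subrr addr0.
Qed.

(** Subtracting g(y) replaces g(y + b z) by a difference of size b |z|. This gives later bounds
    their factor b and frees them from y. *)
Lemma smoothed_centered b w y : eb w -> \int[gam]_z w z = 0 ->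
  smoothed b w y = \int[gam]_z ((g (y + b *: z) - g y) * w z).
Proof.
move=> bw w0; rewrite /smoothed -[LHS]subr0 -(mulr0 (g y)) -w0 -RintegralZl//; last exact: (eb_integrable cm).
rewrite -RintegralB//; first by apply: eq_Rintegral => z _; rewrite mulrBl.
- exact: intg.
- by apply: integrableZR; exact: (eb_integrable cm).
Qed.

Let g_diff b y z : 0 <= b -> `|g (y + b *: z) - g y| <= b * enorm z.
Proof.
move=> b0; have := g_lip (y + b *: z) y; rewrite mul1r addrAC subrr add0r enormZ.
by rewrite (ger0_norm b0).
Qed.

Let eb_diff b y : eb (fun z => g (y + b *: z) - g y).
Proof.
apply: expboundedB; [exact: enorm_ge0|exact: eb_g|apply: expbounded_cst; exact: enorm_ge0].
Qed.

Lemma smoothed_bounded b w y : 0 <= b -> eb w -> \int[gam]_z w z = 0 ->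
  `|smoothed b w y| <= b * \int[gam]_z (enorm z * `|w z|).
Proof.
move=> b0 bw w0; rewrite smoothed_centered//.
have i1 : gam.-integrable setT (EFin \o (fun z => (g (y + b *: z) - g y) * w z)).
  by apply: (eb_integrable cm); exact: expboundedM.
have i2 : gam.-integrable setT (EFin \o (fun z => enorm z * `|w z|)).
  apply: (eb_integrable cm); apply: expboundedM; first exact: eb_enorm.
  exact: expbounded_norm.
apply: (le_trans (le_normr_Rintegral _ i1)) => //.
rewrite -RintegralZl//; apply: le_Rintegral => //.
- exact: integrable_norm.
- exact: integrableZR.
by move=> z _; rewrite normrM mulrA ler_wpM2r// g_diff.
Qed.

Let psi_bound b y z : 0 <= b -> `|g (y + b *: z) - g y| <= b * expR (enorm z).
Proof.
move=> b0; apply: (le_trans (g_diff _ _ b0)); rewrite ler_wpM2l//.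
by have := expR_ge1Dx (enorm z); lra.
Qed.

Let smoothed_shift b y u : \int[gam]_z (g (y + b *: (z + u)) - g y) -
  \int[gam]_z (g (y + b *: z) - g y) = smoothed b (fun=> 1) (y + b *: u) - smoothed b (fun=> 1) y.
Proof.
have i1 y' := eb_integrable cm (eb_g b y').
have ic : gam.-integrable setT (EFin \o (fun=> g y)) by exact: finite_measure_integrable_cst.
have shiftE z : y + b *: (z + u) = (y + b *: u) + b *: z by rewrite scalerDr addrAC addrA.
rewrite /smoothed; under [in RHS]eq_Rintegral do rewrite mulr1.
under [X in _ = _ - X]eq_Rintegral do rewrite mulr1.
under eq_Rintegral do rewrite shiftE.
rewrite RintegralB//; rewrite RintegralB//.
lra.
Qed.

(** [shift_taylor] for psi(z) = g(y + b z) - g(y), which is at most b e^|z|. As [T1] and [T2] have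
    mean zero, the centering leaves their terms unchanged. *)
Let smoothed_taylor_small : exists2 K, 0 <= K & forall b y u, 0 <= b -> enorm u <= 1 ->
  `|smoothed b (fun=> 1) (y + b *: u) - smoothed b (fun=> 1) y
    - smoothed b (T1 u) y - smoothed b (T2 u) y| <= b * K * enorm u ^+ 3.
Proof.
have [K K0 HK] := shift_taylor cm; exists K => // b y u b0 u1.
have mpsi : measurable_fun setT (fun z : U => g (y + b *: z) - g y) by have [] := eb_diff b y.
have := HK _ b u mpsi (fun z => psi_bound y z b0) u1.
have [m1 m2] := T12_mean0 cm u.
rewrite smoothed_shift -(smoothed_centered b y (eb_T1 u) m1).
by rewrite -(smoothed_centered b y (eb_T2 u) m2).
Qed.

(** [smoothed b (T1 v) y] is the derivative at y, in the direction b v, of a 1-Lipschitz function.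
    It is isolated by dividing the expansion for the step s v by s and letting s tend to 0. *)
Lemma smoothed_gradient b y v : 0 <= b -> `|smoothed b (T1 v) y| <= b * enorm v.
Proof.
move=> b0; have [K K0 HK] := smoothed_taylor_small.
have [s0 s00 [s01 s0u]] := small_scale v.
apply: (@le_of_small _ _ _ (`|smoothed b (T2 v) y| + b * K * enorm v ^+ 3) s0) => // s sp ss.
have := HK b y (s *: v) b0 (s0u s sp ss).
have -> : smoothed b (T1 (s *: v)) y = s * smoothed b (T1 v) y.
  rewrite -smoothedZ; last exact: eb_T1.
  by congr smoothed; apply/funext => z; rewrite /T1 dotZl; ring.
have -> : smoothed b (T2 (s *: v)) y = s ^+ 2 * smoothed b (T2 v) y.
  rewrite -smoothedZ; last exact: eb_T2.
  by congr smoothed; apply/funext => z; rewrite /T2 !(dotZl, dotZr); ring.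
rewrite enormZ (gtr0_norm sp).
have : `|smoothed b (fun=> 1) (y + b *: (s *: v)) - smoothed b (fun=> 1) y| <= b * (s * enorm v).
  have := smoothed_lip b (expbounded_cst (@enorm_ge0 R n) 1) (y + b *: (s *: v)) y.
  rewrite addrAC subrr add0r !enormZ (ger0_norm b0) (gtr0_norm sp).
  by rewrite Rintegral_cst// normr1 probability_fine mulr1 mul1r.
set X := _ - _; set A := smoothed _ (T1 _) _; set B := smoothed _ (T2 _) _ => hX hK.
have hA : `|s * A| <= s * (b * enorm v + (`|B| + b * K * enorm v ^+ 3) * s).
  have -> : s * A = X - (X - s * A - s ^+ 2 * B) - s ^+ 2 * B by ring.
  apply: (le_trans (ler_normB _ _)).
  have := ler_normB X (X - s * A - s ^+ 2 * B).
  rewrite (normrM _ B) (ger0_norm (sqr_ge0 s)).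
  have s3 : b * K * (s * enorm v) ^+ 3 <= b * K * enorm v ^+ 3 * s ^+ 2.
    have -> : b * K * (s * enorm v) ^+ 3 = b * K * enorm v ^+ 3 * s ^+ 3 by ring.
    rewrite ler_wpM2l// ?mulr_ge0 ?exprn_ge0 ?enorm_ge0//.
    by rewrite exprS ler_piMl ?sqr_ge0// (le_trans ss).
  rewrite expr2 in s3 *; lra.
by move: hA; rewrite normrM (gtr0_norm sp) ler_pM2l.
Qed.

(** Put u = e / b. For |u| <= 1 the cubic bound is already known and implies the quadratic one. For
    |u| > 1 the increment and both terms of the expansion are each O(|u|^2), which is then below
    |u|^3. *)
Lemma smoothed_taylor b : 0 < b -> exists2 C, 0 <= C & forall y e,
  let r := smoothed b (fun=> 1) (y + e) - smoothed b (fun=> 1) y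
    - smoothed b (T1 (b^-1 *: e)) y - smoothed b (T2 (b^-1 *: e)) y in
  `|r| <= C * enorm e ^+ 2 /\ `|r| <= C * enorm e ^+ 3.
Proof.
move=> b_gt0; have b0 := ltW b_gt0; have [K K0 HK] := smoothed_taylor_small.
pose m3 := \int[gam]_z (enorm z * (3 * enorm z ^+ 2 + 1)).
pose m2 := \int[gam]_z (enorm z * (2 * enorm z ^+ 2 + 1)).
have ebm2 : eb (fun z => enorm z * (2 * enorm z ^+ 2 + 1)).
  apply: expboundedM; first exact: eb_enorm.
  apply: expboundedD; [exact: enorm_ge0| |apply: expbounded_cst; exact: enorm_ge0].
  apply: expboundedZ; [exact: enorm_ge0|apply: expboundedX; [exact: enorm_ge0|exact: eb_enorm]].
have m20 : 0 <= m2.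
  by apply: Rintegral_ge0 => z _; rewrite mulr_ge0 ?enorm_ge0// addr_ge0// mulr_ge0// sqr_ge0.
(* [K] serves short steps. For long steps, 2 accounts for the increment and the gradient term, and
   [m2] for the [T2] term. *)
pose C0 := b * (K + 2 + m2).
have C00 : 0 <= C0 by rewrite /C0 mulr_ge0// !addr_ge0.
have T2b u y : `|smoothed b (T2 u) y| <= b * m2 * enorm u ^+ 2.
  have [_ m0] := T12_mean0 cm u.
  apply: (le_trans (smoothed_bounded _ b0 (eb_T2 u) m0)); rewrite -mulrA ler_wpM2l//.
  rewrite mulrC -RintegralZl//; last exact: (eb_integrable cm).
  apply: le_Rintegral => //.
  - apply: (eb_integrable cm); apply: expboundedM; first exact: eb_enorm.
    by apply: expbounded_norm; exact: eb_T2.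
  - by apply: integrableZR; exact: (eb_integrable cm).
  move=> z _; rewrite mulrCA ler_wpM2l ?enorm_ge0// /T2.
  rewrite (le_trans (ler_normB _ _))// normrM normrX (ger0_norm (dot_ge0 _)) -enorm_sqr.
  rewrite (ger0_norm (ler0n _ 2)).
  have : `|dot u z| ^+ 2 <= (enorm u * enorm z) ^+ 2.
    by rewrite lerXn2r ?nnegrE ?mulr_ge0 ?enorm_ge0// dot_le.
  rewrite exprMn; lra.
have key y u : let r := smoothed b (fun=> 1) (y + b *: u) - smoothed b (fun=> 1) y
    - smoothed b (T1 u) y - smoothed b (T2 u) y in
    `|r| <= C0 * enorm u ^+ 2 /\ `|r| <= C0 * enorm u ^+ 3.
  move=> r; have u0 := enorm_ge0 u; have u20 := sqr_ge0 (enorm u).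
  have [u1|u1] := leP (enorm u) 1.
    have rb := HK b y u b0 u1.
    have u3 : enorm u ^+ 3 <= enorm u ^+ 2 by rewrite exprS ler_piMl.
    have KC : b * K <= C0 by rewrite /C0 ler_wpM2l//; lra.
    split; last by rewrite (le_trans rb)// ler_wpM2r// exprn_ge0.
    rewrite (le_trans rb)// (le_trans (ler_wpM2l (mulr_ge0 b0 K0) u3))//.
    by rewrite ler_wpM2r.
  have rb : `|r| <= C0 * enorm u ^+ 2.
    have h1 : `|smoothed b (fun=> 1) (y + b *: u) - smoothed b (fun=> 1) y| <= b * enorm u.
      have := smoothed_lip b (expbounded_cst (@enorm_ge0 R n) 1) (y + b *: u) y.
      rewrite addrAC subrr add0r enormZ (ger0_norm b0).
      by rewrite Rintegral_cst// normr1 probability_fine mulr1 mul1r.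
    have h2 := smoothed_gradient y u b0.
    have h3 := T2b u y.
    apply: (le_trans (ler_normB _ _)).
    apply: (le_trans (lerD (ler_normB _ _) (lexx _))).
    have u12 : enorm u <= enorm u ^+ 2 by rewrite expr2 ler_peMl// ltW.
    have := ler_wpM2l b0 u12; have := mulr_ge0 (mulr_ge0 b0 K0) u20.
    rewrite /C0; lra.
  split=> //; rewrite (le_trans rb)// ler_wpM2l// [leRHS]exprS ler_peMl//; exact: ltW.
pose k := b^-1.
have k0 : 0 <= k by rewrite invr_ge0.
exists (C0 * (k ^+ 2 + k ^+ 3)); first by rewrite mulr_ge0// addr_ge0 ?exprn_ge0.
move=> y e; have := key y (k *: e).
rewrite scalerA divff ?gt_eqF// scale1r enormZ (ger0_norm k0).
move=> [h1 h2] r; have e0 := enorm_ge0 e; split.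
  apply: (le_trans h1); rewrite exprMn mulrA ler_wpM2r ?sqr_ge0// ler_wpM2l// lerDl exprn_ge0//.
apply: (le_trans h2); rewrite exprMn mulrA ler_wpM2r ?exprn_ge0// ler_wpM2l// lerDr exprn_ge0//.
Qed.

End smoothing.

(** * The Hessian bound for quadratic Hermite weights *)

Section hessian.
Context {R : realType} {n : nat} (gam : probability 'cV[R]_n R).
Hypothesis cm : cameron_martin gam.
Variable g : 'cV[R]_n -> R.
Hypothesis g_lip : lipschitz_with 1 g.
Local Notation U := 'cV[R]_n.
Local Notation eb := (expbounded (@enorm R n)).
Local Notation eb2 := (expbounded (@enorm2 R n)).
Implicit Types (x y u v : U) (M : 'M[R]_n).

Lemma dot_mulmxl M u v : dot (M *m u) v = dot u (M^T *m v).
Proof.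
rewrite /dot; under eq_bigr do rewrite mxE mulr_suml.
rewrite exchange_big; apply: eq_bigr => j _; rewrite mxE mulr_sumr.
by apply: eq_bigr => i _; rewrite mxE mulrCA mulrA.
Qed.

Lemma dot_delta i u : dot (delta_mx i 0) u = u i 0.
Proof.
rewrite /dot (bigD1 i)//= !mxE !eqxx big1 ?mul1r ?addr0// => j ji.
by rewrite !mxE (negbTE ji) mul0r.
Qed.

Lemma mulmx_coord M u i : (M *m u) i 0 = dot (row i M)^T u.
Proof. by rewrite mxE; apply: eq_bigr => j _; rewrite !mxE. Qed.

Lemma measurable_mulmx M : measurable_fun setT (fun z : U => M *m z).
Proof.
apply/measurable_fun_cVP => i; under eq_fun do rewrite mulmx_coord.
exact: measurable_dotr.
Qed.

Lemma eb_mulmx M : eb (fun z => enorm (M *m z)).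
Proof.
apply: (@expbounded_le _ _ _ _ _ (fun z => \sum_i `|(M *m z) i 0|)).
- by apply: measurable_enorm; exact: measurable_mulmx.
- by move=> z; rewrite ger0_norm ?enorm_ge0// enorm_le_sum.
- apply: expbounded_sum; first exact: enorm_ge0.
  move=> i; apply: expbounded_norm; under eq_fun do rewrite mulmx_coord.
  exact: eb_dot.
Qed.

Lemma eb_quad M : eb (fun z => dot (M *m z) z).
Proof.
apply: (@expbounded_le _ _ _ _ _ (fun z => enorm (M *m z) * enorm z)).
- by apply: measurable_dot => //; exact: measurable_mulmx.
- by move=> z; exact: dot_le.
- by apply: expboundedM; [exact: eb_mulmx|exact: eb_enorm].
Qed.

Lemma gaussian_quad M : \int[gam]_z dot (M *m z) z = \tr M / 2.
Proof.
have E z : dot (M *m z) z = \sum_i dot (row i M)^T z * dot (delta_mx i 0) z.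
  by apply: eq_bigr => i _; rewrite mulmx_coord dot_delta.
under eq_Rintegral do rewrite E.
rewrite Rintegral_sum; last by move=> i; apply: (eb_integrable cm); exact: eb_dotM.
rewrite mulr_suml; apply: eq_bigr => i _.
by rewrite (gaussian_cov cm) dotC dot_delta !mxE.
Qed.

(** The second Hermite weight attached to a matrix: \tr M / 2 is the mean of <M Z, Z>, and [T2 u] is
    twice the weight of the rank one matrix u u^T. *)
Definition quad M (z : U) : R := dot (M *m z) z - \tr M / 2.

Lemma eb_quadc M : eb (quad M).
Proof.
apply: expboundedB; [exact: enorm_ge0|exact: eb_quad|apply: expbounded_cst; exact: enorm_ge0].
Qed.

(** The variance of |M Z| is nonnegative, and its second moment is half the sum of the squared
    entries because Z has covariance I/2. *)
Lemma gaussian_mulmx_le M :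
  \int[gam]_z enorm (M *m z) <= Num.sqrt ((\sum_i \sum_j M i j ^+ 2) / 2).
Proof.
set f := fun z : U => enorm (M *m z); set mu := Rintegral _ _ _.
have i1 : gam.-integrable setT (EFin \o f) by apply: (eb_integrable cm); exact: eb_mulmx.
have i2 : gam.-integrable setT (EFin \o (fun z => f z ^+ 2)).
  by apply: (eb_integrable cm); apply: expboundedX; [exact: enorm_ge0|exact: eb_mulmx].
have mu0 : 0 <= mu by apply: Rintegral_ge0 => z _; exact: enorm_ge0.
have -> : (\sum_i \sum_j M i j ^+ 2) / 2 = \int[gam]_z (f z ^+ 2).
  transitivity (\int[gam]_z \sum_i dot (row i M)^T z * dot (row i M)^T z); last first.
    by apply: eq_Rintegral => z _; rewrite /f enorm_sqr; apply: eq_bigr => i _; rewrite mulmx_coord.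
  rewrite Rintegral_sum; last by move=> i; apply: (eb_integrable cm); exact: eb_dotM.
  rewrite mulr_suml; apply: eq_bigr => i _; rewrite (gaussian_cov cm); congr (_ / _).
  by apply: eq_bigr => j _; rewrite !mxE expr2.
rewrite -[leLHS]ger0_norm// -sqrtr_sqr ler_wsqrtr//.
have : 0 <= \int[gam]_z ((f z - mu) ^+ 2) by apply: Rintegral_ge0 => z _; exact: sqr_ge0.
have -> : \int[gam]_z ((f z - mu) ^+ 2) = \int[gam]_z (f z ^+ 2 - 2 * mu * f z + mu ^+ 2).
  by apply: eq_Rintegral => z _; ring.
rewrite RintegralD//; [|by apply: integrableBR => //; exact: integrableZR|exact: finite_measure_integrable_cst].
rewrite RintegralB//; last exact: integrableZR.
rewrite RintegralZl// Rintegral_cst// probability_fine -/mu; lra.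
Qed.

Let eb_lin2 M (a b a' b' : R) : eb2 (fun p => dot (M *m (a *: p.1 + b *: p.2)) (a' *: p.1 + b' *: p.2)).
Proof.
have h0 := @enorm2_ge0 R n.
have E (p : U * U) : dot (M *m (a *: p.1 + b *: p.2)) (a' *: p.1 + b' *: p.2) =
  \sum_i (a * dot (row i M)^T p.1 + b * dot (row i M)^T p.2) * (a' * p.1 i 0 + b' * p.2 i 0).
  apply: eq_bigr => i _; rewrite mulmx_coord !(dotDr, dotZr); congr (_ * _).
  by rewrite !mxE.
have bi i : eb (fun z : U => z i 0).
  split; first exact: measurable_coord.
  have [_ [c c0 Hc]] := eb_enorm (R := R) (n := n); exists c => // z.
  by apply: (le_trans (coord_le_enorm z i)); rewrite (le_trans (ler_norm _)).
under eq_fun do rewrite E.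
apply: expbounded_sum => // i; apply: expboundedM; apply: expboundedD => //; apply: expboundedZ => //;
  by [apply: expbounded_fst; exact: eb_dot|apply: expbounded_snd; exact: eb_dot
     |apply: (expbounded_fst (bi i))|apply: (expbounded_snd (bi i))].
Qed.

Let eb2_g (y : U) (b a a' : R) : eb2 (fun p => g (y + b *: (a *: p.1 + a' *: p.2))).
Proof.
have h0 := @enorm2_ge0 R n.
have mphi : measurable_fun setT (fun p : U * U => y + b *: (a *: p.1 + a' *: p.2)).
  apply: measurable_cVD => //; apply: measurable_cVZ => //; apply: measurable_cVD; exact: measurable_cVZ.
have [_ bg] := eb_g g_lip b y.
apply: (@expbounded_le _ _ _ _ _ (fun p => `|g y| + `|b| * (`|a| * enorm p.1 + `|a'| * enorm p.2))).
- exact: (measurableT_comp (measurable_lipschitz g_lip) mphi).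
- move=> p; have := g_lip (y + b *: (a *: p.1 + a' *: p.2)) y.
  rewrite mul1r addrAC subrr add0r enormZ => h.
  rewrite -[g (_ + _)](subrK (g y)) (le_trans (ler_normD _ _))// addrC lerD//.
  by rewrite (le_trans h)// ler_wpM2l// (le_trans (enormD _ _))// !enormZ.
- apply: expboundedD => //; first exact: expbounded_cst.
  apply: expboundedZ => //; apply: expboundedD => //; apply: expboundedZ => //.
    by apply: expbounded_fst; exact: eb_enorm.
  by apply: expbounded_snd; exact: eb_enorm.
Qed.

(** One Gaussian vector is split into two independent ones of sizes b' and s. In one set of
    variables the integral of g times <M z2, z1> is a gradient in z1 and costs b'/2 |M z2|; in the
    rotated variables it equals [al * be] times the Hessian weight. Dividing by [al * be] = b' s /
    b^2 gives the bound, which requires 0 < s < b. *)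
Let hessian_sigma b s y M : 0 < b -> 0 < s -> s < b ->
  `|smoothed gam g b (quad M) y| <= b ^+ 2 / (2 * s) * \int[gam]_z enorm (M *m z).
Proof.
move=> b0 s0 sb; pose b' := Num.sqrt (b ^+ 2 - s ^+ 2).
have bs : 0 < b ^+ 2 - s ^+ 2 by rewrite subr_gt0 ltrXn2r// ?nnegrE ltW.
have b'0 : 0 < b' by rewrite sqrtr_gt0.
have b'2 : b' ^+ 2 = b ^+ 2 - s ^+ 2 by rewrite sqr_sqrtr// ltW.
pose al := b' / b; pose be := s / b.
have ab1 : al ^+ 2 + be ^+ 2 = 1.
  by rewrite /al /be !expr_div_n b'2 -mulrDl subrK divff// gt_eqF// exprn_gt0.
(* [Phi] is [Psi] in rotated coordinates: [be] p1 - [al] p2 and [al] p1 + [be] p2 recover z2 and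
   z1. *)
pose Phi (p : U * U) := g (y + b *: p.1) * dot (M *m (be *: p.1 - al *: p.2)) (al *: p.1 + be *: p.2).
pose Psi (p : U * U) := g (y + b *: (al *: p.1 + be *: p.2)) * dot (M *m p.2) p.1.
have ebPhi : eb2 Phi.
  have := expboundedM (eb2_g y b 1 0) (eb_lin2 M be (- al) al be).
  rewrite (_ : (fun _ => _) = Phi)//; apply/funext => p.
  by rewrite /Phi scale1r scale0r addr0 scaleNr.
have ebPsi : eb2 Psi.
  have := expboundedM (eb2_g y b al be) (eb_lin2 M 0 1 1 0).
  rewrite (_ : (fun _ => _) = Psi)//; apply/funext => p.
  by rewrite /Psi !scale1r !scale0r addr0 add0r.
have rotE : \int[(gam \x gam)%E]_p Psi p = \int[(gam \x gam)%E]_p Phi p.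
  rewrite -(gaussian_rotationR cm ab1 (F := Phi)); last by have [] := ebPhi.
  apply: eq_Rintegral => -[z1 z2] _; rewrite /Phi /Psi /=; congr (_ * dot (M *m _) _).
    apply/colP => i; rewrite !mxE.
    by transitivity ((al ^+ 2 + be ^+ 2) * z2 i 0); [rewrite ab1 mul1r|ring].
  apply/colP => i; rewrite !mxE.
  by transitivity ((al ^+ 2 + be ^+ 2) * z1 i 0); [rewrite ab1 mul1r|ring].
have [iPsi PsiE] := gaussian_fubini2 cm ebPsi.
have [iPhi PhiE] := gaussian_fubini1 cm ebPhi.
set m := \int[gam]_z enorm (M *m z).
have im : gam.-integrable setT (EFin \o (fun z : U => enorm (M *m z))).
  by apply: (eb_integrable cm); exact: eb_mulmx.
have Psi_le : `|\int[(gam \x gam)%E]_p Psi p| <= b' / 2 * m.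
  rewrite PsiE (le_trans (le_normr_Rintegral _ iPsi))// -RintegralZl//.
  apply: le_Rintegral => //; [exact: integrable_norm|exact: integrableZR|].
  move=> z2 _.
  (* With z2 fixed, the displacement is b' z1 + s z2 and <M z2, z1> is half of [T1 (M z2)], so the
     gradient bound at scale b' applies. *)
  have -> : \int[gam]_x Psi (x, z2) = 2^-1 * smoothed gam g b' (T1 (M *m z2)) (y + s *: z2).
    rewrite /smoothed -RintegralZl//; last first.
      apply: (eb_integrable cm); apply: expboundedM; [exact: eb_g|exact: eb_T1].
    apply: eq_Rintegral => z1 _; rewrite /Psi /T1 /=.
    have -> : y + b *: (al *: z1 + be *: z2) = y + s *: z2 + b' *: z1.
      rewrite scalerDr !scalerA /al /be [b * (b' / b)]mulrC [b * (s / b)]mulrC.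
      by rewrite !divfK ?gt_eqF// -addrA; congr (_ + _); rewrite addrC.
    by field.
  rewrite normrM ger0_norm ?invr_ge0// mulrAC [leRHS]mulrC ler_wpM2l ?invr_ge0//.
  by apply: (smoothed_gradient cm) => //; exact: ltW.
have PhiS : \int[(gam \x gam)%E]_p Phi p = al * be * smoothed gam g b (quad M) y.
  rewrite PhiE /smoothed -RintegralZl//; last first.
    apply: (eb_integrable cm); apply: expboundedM; [exact: eb_g|exact: eb_quadc].
  apply: eq_Rintegral => x _.
  (* On averaging over z the two linear terms vanish and <M z, z> becomes \tr M / 2, which leaves
     [al * be * quad M x]. *)
  have E z : Phi (x, z) = g (y + b *: x) * (al * be * dot (M *m x) x +
      (be ^+ 2 * dot (M *m x) z - al ^+ 2 * dot (M^T *m x) z - al * be * dot (M *m z) z)).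
    rewrite /Phi/=; congr (_ * _).
    rewrite mulmxBr -!scalemxAr !(dotDl, dotDr, dotNl, dotNr, dotZl, dotZr).
    rewrite (dot_mulmxl M z x) (dotC z); ring.
  under eq_Rintegral do rewrite E.
  have id u := eb_integrable cm (eb_dot u).
  have iq := eb_integrable cm (eb_quad M).
  have i1 u k : gam.-integrable setT (EFin \o (fun z => k * dot u z)) by exact: integrableZR.
  have i2 k : gam.-integrable setT (EFin \o (fun z => k * dot (M *m z) z)) by exact: integrableZR.
  have i3 := integrableBR (i1 (M *m x) (be ^+ 2)) (i1 (M^T *m x) (al ^+ 2)).
  have i4 := integrableBR i3 (i2 (al * be)).
  have i5 : gam.-integrable setT (EFin \o (fun=> al * be * dot (M *m x) x)).
    exact: finite_measure_integrable_cst.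
  rewrite RintegralZl//; last exact: integrableDR.
  rewrite RintegralD// RintegralB// RintegralB// Rintegral_cst// probability_fine.
  rewrite (RintegralZl _ measurableT (id (M *m x))) (RintegralZl _ measurableT (id (M^T *m x))).
  rewrite (RintegralZl _ measurableT iq) !(gaussian_mean cm) gaussian_quad /quad; ring.
have alE : al * be = b' * s / b ^+ 2 by rewrite /al /be expr2 mulrACA -invfM.
move: Psi_le; rewrite rotE PhiS alE normrM gtr0_norm; last first.
  by rewrite divr_gt0 ?mulr_gt0 ?exprn_gt0.
have K0 : 0 < b' * s / b ^+ 2 by rewrite divr_gt0 ?mulr_gt0 ?exprn_gt0.
rewrite mulrC -ler_pdivlMr// => /le_trans; apply; rewrite le_eqVlt; apply/orP; left; apply/eqP.
by field; rewrite !gt_eqF.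
Qed.

(** The best split puts nearly all the size on the second vector: b^2 / (2 s) tends to b / 2 as s =
    b (1 - e) tends to b. *)
Lemma smoothed_hessian b y M : 0 < b ->
  `|smoothed gam g b (quad M) y| <= b / 2 * Num.sqrt ((\sum_i \sum_j M i j ^+ 2) / 2).
Proof.
move=> b0; set m := \int[gam]_z enorm (M *m z).
have m0 : 0 <= m by apply: Rintegral_ge0 => z _; exact: enorm_ge0.
apply: (@le_trans _ _ (b / 2 * m)); last first.
  by rewrite ler_wpM2l ?divr_ge0 ?(ltW b0)//; exact: gaussian_mulmx_le.
apply: (@le_of_small _ _ _ (b * m) 2^-1); first by rewrite invr_gt0.
move=> e e0 e2; pose s := b * (1 - e).
have e1 : 0 < 1 - e by lra.
have s0 : 0 < s by rewrite mulr_gt0.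
have sb : s < b by rewrite /s mulrBr mulr1 gtrBl mulr_gt0.
apply: (le_trans (hessian_sigma y M b0 s0 sb)); rewrite -/m.
have -> : b ^+ 2 / (2 * s) = b / 2 * (1 - e)^-1 by rewrite /s; field; rewrite !gt_eqF.
have h : (1 - e)^-1 <= 1 + 2 * e.
  rewrite -[leLHS]mul1r ler_pdivrMr//.
  have : 0 <= e * (1 - 2 * e) by rewrite mulr_ge0//; [exact: ltW|lra].
  lra.
have := ler_wpM2r m0 (ler_wpM2l (ltW b0) h); lra.
Qed.

(* The semigroup property: [a Z1 + b Z2] has the law of [Z] when [a^2 + b^2 = 1]. *)
Lemma smoothed_smoothed b s t y : 0 < t -> b ^+ 2 + s ^+ 2 = t ^+ 2 ->
  \int[gam]_z smoothed gam g b (fun=> 1) (y + s *: z) = smoothed gam g t (fun=> 1) y.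
Proof.
move=> t0 bst; pose al := b / t; pose be := s / t.
have ab1 : al ^+ 2 + be ^+ 2 = 1.
  by rewrite /al /be !expr_div_n -mulrDl bst divff// gt_eqF// exprn_gt0.
have b1 := eb2_g y t al be.
have b2 := eb2_g y t 1 0.
have [_ E1] := gaussian_fubini2 cm b1.
have [_ E2] := gaussian_fubini1 cm b2.
transitivity (\int[(gam \x gam)%E]_p g (y + t *: (al *: p.1 + be *: p.2))).
  rewrite E1; apply: eq_Rintegral => z _; rewrite /smoothed.
  apply: eq_Rintegral => x _; rewrite mulr1 /= scalerDr !scalerA /al /be.
  rewrite [t * (b / t)]mulrC [t * (s / t)]mulrC !divfK ?gt_eqF//.
  by rewrite -addrA; congr (g (_ + _)); rewrite addrC.
transitivity (\int[(gam \x gam)%E]_p g (y + t *: (1 *: p.1 + 0 *: p.2))).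
  rewrite -(gaussian_rotationR cm ab1 (F := fun p => g (y + t *: (1 *: p.1 + 0 *: p.2)))).
    by apply: eq_Rintegral => p _ /=; rewrite scale1r scale0r addr0.
  by have [] := b2.
rewrite E2 /smoothed; apply: eq_Rintegral => x _ /=.
under eq_Rintegral do rewrite scale1r scale0r addr0.
by rewrite Rintegral_cst// probability_fine.
Qed.

End hessian.

(** * Conditional expectation *)

Section condexp_theory.
Context d (T : measurableType d) (R : realType) (P : probability T R).
Context d' (S : measurableType d') (W : T -> S).
Hypothesis mW : measurable_fun setT W.

(** The signed measure with density X, pushed forward by W, is absolutely continuous with respect to
    the law of W. Its Radon-Nikodym derivative composed with W is a version of the conditional
    expectation. *)
Lemma condexp_exists (X : T -> R) : P.-integrable setT (EFin \o X) ->
  exists V, is_condexp P W X V.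
Proof.
move=> iX.
pose rv : {mfun T >-> S} := HB.pack W (isMeasurableFun.Build _ _ _ _ _ mW).
pose mu : probability S R := distribution P rv.
have [nu nuE] : exists nu : {charge set S -> \bar R},
    nu = pushforward (induced_charge iX) W :> (set S -> \bar R).
  by exists (measure_function_pushforward__canonical__charge_Charge (induced_charge iX) mW).
have nu_mu : nu `<< mu.
  apply/null_content_dominatesP => A mA muA.
  rewrite nuE /pushforward /induced_charge.
  apply: null_set_integral => //.
  - by rewrite -[X in measurable X]setTI; exact: mW.
  - by apply: measurable_funTS; exact: (measurable_int P iX).
pose f := Radon_Nikodym nu mu.
have f_fin x : f x \is a fin_num by exact: Radon_Nikodym_fin_num.
have f_int : mu.-integrable setT f by exact: Radon_Nikodym_integrable.
have mf : measurable_fun setT f := measurable_int mu f_int.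
have mV : measurable_fun setT (fun s => fine (f s)) by exact: measurableT_comp.
have VE : (fun w => (fine (f (W w)))%:E) = f \o W by apply/funext => w; rewrite /= fineK.
have ifW : P.-integrable setT (f \o W).
  apply/integrableP; split; first exact: measurableT_comp.
  have /integrableP[_] := f_int; rewrite /mu ge0_integral_distribution//=.
  exact: measurableT_comp.
exists (fun w => fine (f (W w))); split.
- move=> _ B mB; rewrite setTI.
  exists ((fun s => fine (f s)) @^-1` B); last by rewrite setTI.
  by rewrite -[X in measurable X]setTI; exact: mV.
- by rewrite /= (_ : _ \o _ = f \o W)//; exact: VE.
- move=> A [B mB]; rewrite setTI => <-.
  transitivity (nu B); last by rewrite nuE.
  rewrite (Radon_Nikodym_integral nu_mu mB) -/f.
  have -> : (\int[mu]_(x in B) f x = \int[pushforward P W]_(x in B) f x)%E.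
    by [].
  rewrite (integral_pushforward mW)//; last first.
    by apply: (integrableS measurableT) => //; rewrite -[X in measurable X]setTI; exact: mW.
  by apply: eq_integral => w _; rewrite /= fineK.
Qed.

Lemma condexpP (X : T -> R) : P.-integrable setT (EFin \o X) ->
  is_condexp P W X (condexp P W X).
Proof. by move=> iX; apply: xgetPex; exact: condexp_exists. Qed.

Lemma integrable_condexp (X : T -> R) : P.-integrable setT (EFin \o condexp P W X).
Proof.
rewrite /condexp; case: xgetP => [V _ []//|_].
exact: finite_measure_integrable_cst.
Qed.

(** [p] is within 1/(n+1) of a step function constant on level sets of [p], and on the W-preimage of
    each level set [Y] integrates to zero. *)
Lemma integral_preimage_eq0 (Y : T -> R) (p : S -> R) (M : R) :
  P.-integrable setT (EFin \o Y) ->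
  (forall B, measurable B -> \int[P]_(w in W @^-1` B) Y w = 0) ->
  measurable_fun setT p -> (forall s, 0 <= p s <= M) ->
  \int[P]_w (p (W w) * Y w) = 0.
Proof.
move=> iY Y0 mp pM.
have mpW : measurable_fun setT (fun w => p (W w)) by exact: measurableT_comp.
pose B n k := p @^-1` `[k%:R / n.+1%:R, k.+1%:R / n.+1%:R[.
have mB n k : measurable (B n k) by rewrite -[X in measurable X]setTI; apply: mp.
have mWB n k : measurable (W @^-1` B n k) by rewrite -[X in measurable X]setTI; exact: mW.
(* The level containing M can be attained, so levels run up to trunc((n+1) M) inclusive; hence the
   successor. *)
pose N n := (Num.trunc (n.+1%:R * M)).+1.
pose q n w : R := \sum_(k < N n) (k%:R / n.+1%:R) * \1_(W @^-1` B n k) w.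
have inB n s k : B n k s <-> Num.trunc (n.+1%:R * p s) = k.
  rewrite /B /= in_itv/= ler_pdivrMr// ltr_pdivlMr// mulrC.
  have np : 0 <= n.+1%:R * p s by rewrite mulr_ge0//; have /andP[] := pM s.
  split=> [|<-]; first by move=> /andP[h1 h2]; apply/eqP; rewrite truncn_eq// h1 h2.
  by have := truncn_itv np.
have qp n w : `|p (W w) - q n w| <= n.+1%:R^-1.
  pose k0 := Num.trunc (n.+1%:R * p (W w)).
  have /andP[p0 pM'] := pM (W w).
  have np : 0 <= n.+1%:R * p (W w) by rewrite mulr_ge0.
  have k0N : (k0 < N n)%N by rewrite ltnS le_truncn// ler_wpM2l.
  have Bk0 : B n k0 (W w) by apply/inB.
  rewrite /q (bigD1 (Ordinal k0N))//= indicE mem_set// mulr1 big1 ?addr0 => [|j jk].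
    move: Bk0; rewrite /B /= in_itv/= => /andP[h1 h2].
    rewrite ger0_norm; last by rewrite subr_ge0.
    by rewrite lerBlDl; move: h2; rewrite -natr1 mulrDl mul1r => /ltW.
  rewrite indicE memNset ?mulr0// => /inB kj; move: jk; rewrite -val_eqE/= -kj => /eqP.
  by apply.
have mq n : measurable_fun setT (q n).
  by apply: measurable_sum => k; apply: measurable_funM => //; exact: measurable_indic.
have iqY1 n k : P.-integrable setT (EFin \o (fun w => \1_(W @^-1` B n k) w * Y w)).
  apply: (@le_integrableR _ _ _ _ _ (fun w => `|Y w|)); last exact: integrable_norm.
    by apply: measurable_funM; [exact: measurable_indic|exact: measurable_integrableR iY].
  move=> w; rewrite normrM indicE; case: (_ \in _); rewrite ?normr1 ?normr0 ?mul1r ?mul0r//.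
have qY0 n : \int[P]_w (q n w * Y w) = 0.
  transitivity (\int[P]_w (\sum_(k < N n) (k%:R / n.+1%:R) * (\1_(W @^-1` B n k) w * Y w))).
    by apply: eq_Rintegral => w _; rewrite /q mulr_suml; apply: eq_bigr => k _; rewrite mulrA.
  rewrite Rintegral_sum; last by move=> k; exact: integrableZR.
  apply: big1 => k _; rewrite RintegralZl//.
  rewrite (_ : Rintegral _ _ _ = 0) ?mulr0// -[RHS](Y0 _ (mB n k)) [RHS]Rintegral_mkcond.
  apply: eq_Rintegral => w _; rewrite /patch indicE; case: (_ \in _); rewrite ?mul1r ?mul0r//.
have iabs : P.-integrable setT (EFin \o (fun w => `|Y w|)) by exact: integrable_norm.
have iqY n : P.-integrable setT (EFin \o (fun w => q n w * Y w)).
  rewrite (_ : (fun w => _) = (fun w => \sum_(k < N n) (k%:R / n.+1%:R) * (\1_(W @^-1` B n k) w * Y w))).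
    by apply: integrable_sumR => k; exact: integrableZR.
  by apply/funext => w; rewrite /q mulr_suml; apply: eq_bigr => k _; rewrite mulrA.
have ipY : P.-integrable setT (EFin \o (fun w => p (W w) * Y w)).
  apply: (@le_integrableR _ _ _ _ _ (fun w => M * `|Y w|)); last exact: integrableZR.
    by apply: measurable_funM => //; exact: measurable_integrableR iY.
  by move=> w; have /andP[? ?] := pM (W w); rewrite normrM ler_wpM2r// ger0_norm.
apply/eqP; rewrite -normr_le0; apply/ler_addgt0Pr => e e0; rewrite add0r.
have [n ne] : exists n : nat, (\int[P]_w `|Y w|) / e <= n.+1%:R.
  have [N' _ hN] := @nbhs_infty_ger R ((\int[P]_w `|Y w|) / e).
  by exists N'; apply: (le_trans (hN N' (leqnn _))); rewrite ler_nat.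
rewrite -[X in `|X|]subr0 -(qY0 n) -RintegralB//.
have iD : P.-integrable setT (EFin \o (fun w => p (W w) * Y w - q n w * Y w)) by exact: integrableBR.
apply: (le_trans (le_normr_Rintegral _ iD)) => //.
apply: (@le_trans _ _ (\int[P]_w (n.+1%:R^-1 * `|Y w|))).
  apply: le_Rintegral => //; [exact: integrable_norm|exact: integrableZR|].
  by move=> w _; rewrite -mulrBl normrM ler_wpM2r.
by rewrite RintegralZl// mulrC ler_pdivrMr// mulrC -ler_pdivrMr.
Qed.

(** Writing p = (p + M) - M turns a bounded coefficient into two nonnegative ones, to which the step
    function approximation applies. *)
Lemma condexp_pullout (X : T -> R) (p : S -> R) (M : R) :
  P.-integrable setT (EFin \o X) -> measurable_fun setT p -> (forall s, `|p s| <= M) ->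
  \int[P]_w (p (W w) * condexp P W X w) = \int[P]_w (p (W w) * X w).
Proof.
move=> iX mp pM; have [_ iV VX] := condexpP iX.
set V := condexp P W X in iV VX *.
pose Y w := V w - X w.
have iY : P.-integrable setT (EFin \o Y) by exact: integrableBR.
have Y0 B : measurable B -> \int[P]_(w in W @^-1` B) Y w = 0.
  move=> mB; have mWB : measurable (W @^-1` B) by rewrite -[X in measurable X]setTI; exact: mW.
  rewrite /Y RintegralB//; try exact: (integrableS measurableT).
  rewrite /Rintegral VX ?subrr//; exists B => //; by rewrite setTI.
have mpW : measurable_fun setT (fun w => p (W w)) by exact: measurableT_comp.
have ipX (Z : T -> R) : P.-integrable setT (EFin \o Z) ->
    P.-integrable setT (EFin \o (fun w => p (W w) * Z w)).
  move=> iZ; apply: (@le_integrableR _ _ _ _ _ (fun w => M * `|Z w|)).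
  - by apply: measurable_funM => //; exact: measurable_integrableR iZ.
  - by move=> w; rewrite normrM ler_wpM2r.
  - by apply: integrableZR; exact: integrable_norm.
apply/eqP; rewrite -subr_eq0 -RintegralB//; try exact: ipX.
have h1 := @integral_preimage_eq0 Y (fun s => p s + M) (M + M) iY Y0.
have h2 := @integral_preimage_eq0 Y (fun=> M) (M + M) iY Y0.
have : \int[P]_w ((p (W w) + M) * Y w) - \int[P]_w (M * Y w) = 0.
  rewrite h1 ?h2 ?subrr// => s.
  - by have M0 : 0 <= M by [exact: le_trans (normr_ge0 _) (pM s)]; rewrite M0 lerDl.
  - exact: measurable_funD.
  - by have := pM s; rewrite ler_norml => /andP[? ?]; rewrite -lerBlDr sub0r lerD2r; apply/andP.
rewrite -RintegralB//.
- move=> <-; apply/eqP; apply: eq_Rintegral => w _; rewrite /Y; ring.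
- under eq_fun do rewrite mulrDl; apply: integrableDR; [exact: ipX|exact: integrableZR].
- exact: integrableZR.
Qed.

End condexp_theory.

(** * Random complex matrices tested against bounded functions of W *)

Section complex_entries.
Context {R : realType}.
Implicit Types z : R[i].

Lemma Re_le_normc z : `|complex.Re z| <= Normc.normc z.
Proof.
case: z => x y /=; rewrite -sqrtr_sqr ler_wsqrtr// lerDl sqr_ge0//.
Qed.

Lemma Im_le_normc z : `|complex.Im z| <= Normc.normc z.
Proof.
case: z => x y /=; rewrite -sqrtr_sqr ler_wsqrtr// lerDr sqr_ge0//.
Qed.

Lemma normc_le_ReIm z : Normc.normc z <= `|complex.Re z| + `|complex.Im z|.
Proof.
case: z => x y /=.
rewrite -[leRHS]ger0_norm ?addr_ge0// -sqrtr_sqr ler_wsqrtr// sqrrD !real_normK ?num_real//.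
by have := mulr_ge0 (normr_ge0 x) (normr_ge0 y); lra.
Qed.

Lemma ReZ (r : R) z : complex.Re (r%:C * z) = r * complex.Re z.
Proof. by case: z => x y /=; rewrite mul0r subr0. Qed.

Lemma ImZ (r : R) z : complex.Im (r%:C * z) = r * complex.Im z.
Proof. by case: z => x y /=; rewrite mul0r addr0. Qed.

Lemma ReD z z' : complex.Re (z + z') = complex.Re z + complex.Re z'.
Proof. by case: z z' => [? ?] [? ?]. Qed.

Lemma ImD z z' : complex.Im (z + z') = complex.Im z + complex.Im z'.
Proof. by case: z z' => [? ?] [? ?]. Qed.

Lemma ReN z : complex.Re (- z) = - complex.Re z.
Proof. by case: z => [? ?]. Qed.

Lemma ImN z : complex.Im (- z) = - complex.Im z.
Proof. by case: z => [? ?]. Qed.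

Lemma measurable_normc d (T : measurableType d) (f : T -> R[i]) :
  measurable_fun setT (fun w => complex.Re (f w)) ->
  measurable_fun setT (fun w => complex.Im (f w)) ->
  measurable_fun setT (fun w => Normc.normc (f w)).
Proof.
move=> mr mi; rewrite (_ : (fun w => _) =
  (fun w => Num.sqrt (complex.Re (f w) ^+ 2 + complex.Im (f w) ^+ 2))); last first.
  by apply/funext => w; case: (f w).
apply: (measurableT_comp (continuous_measurable_fun (@sqrt_continuous R))) => //=.
by apply: measurable_funD; exact: measurable_funX.
Qed.

End complex_entries.

Lemma cvg_sumR {R : realType} (F : set_system R) (FF : Filter F) (I : Type) (r : seq I)
    (f : I -> R -> R) (a : I -> R) : (forall i, f i @ F --> a i) ->
  (fun e => \sum_(i <- r) f i e) @ F --> \sum_(i <- r) a i.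
Proof.
move=> fa; elim: r => [|i r IH].
  by under eq_fun do rewrite big_nil; rewrite big_nil; exact: cvg_cst.
by under eq_fun do rewrite big_cons; rewrite big_cons; exact: cvgD.
Qed.

Section pairing.
Context d (T : measurableType d) (R : realType) (P : probability T R).
Context d' (S : measurableType d') (W : T -> S) (m n : nat).
Hypothesis mW : measurable_fun setT W.
Implicit Types (X Y L : T -> 'M[R[i]]_(m, n)) (p : S -> 'M[R]_(m, n)).

(* The pairing [Re (sum_(i, j) (p1 s - i * p2 s)_(i, j) * A_(i, j))] in real coordinates. *)
Definition pairing p1 p2 (s : S) (A : 'M[R[i]]_(m, n)) : R :=
  \sum_i \sum_j (p1 s i j * complex.Re (A i j) + p2 s i j * complex.Im (A i j)).

Definition bounded_coeff (M : R) p :=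
  forall i j, measurable_fun setT (fun s => p s i j) /\ forall s, `|p s i j| <= M.

Lemma integrable_mx_condexp X : integrable_mx P (condexp_mx P W X).
Proof.
move=> i j; split.
  rewrite (_ : (fun w => _) = EFin \o condexp P W (fun w => complex.Re (X w i j))).
    exact: integrable_condexp.
  by apply/funext => w; rewrite /= mxE.
rewrite (_ : (fun w => _) = EFin \o condexp P W (fun w => complex.Im (X w i j))).
  exact: integrable_condexp.
by apply/funext => w; rewrite /= mxE.
Qed.

Lemma integrable_mxZ (r : R) X : integrable_mx P X -> integrable_mx P (fun w => r%:C *: X w).
Proof.
move=> iX i j; have [ir ii] := iX i j.
split; under eq_fun do rewrite mxE ?ReZ ?ImZ; exact: integrableZR.
Qed.

Lemma integrable_mxD X Y : integrable_mx P X -> integrable_mx P Y ->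
  integrable_mx P (fun w => X w + Y w).
Proof.
move=> iX iY i j; have [ir ii] := iX i j; have [ir' ii'] := iY i j.
split; under eq_fun do rewrite mxE ?ReD ?ImD; exact: integrableDR.
Qed.

Lemma integrable_mxN X : integrable_mx P X -> integrable_mx P (fun w => - X w).
Proof.
move=> iX i j; have [ir ii] := iX i j.
split; under eq_fun do rewrite mxE ?ReN ?ImN -mulN1r; exact: integrableZR.
Qed.

Lemma integrable_mx_cst (A : 'M[R[i]]_(m, n)) : integrable_mx P (fun=> A).
Proof. by move=> i j; split; exact: finite_measure_integrable_cst. Qed.

Lemma integrable_normc X i j : integrable_mx P X ->
  P.-integrable setT (EFin \o (fun w => Normc.normc (X w i j))).
Proof.
move=> iX; have [ir ii] := iX i j.
apply: (@le_integrableR _ _ _ _ _ (fun w => `|complex.Re (X w i j)| + `|complex.Im (X w i j)|)).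
- by apply: measurable_normc; [exact: measurable_integrableR ir|exact: measurable_integrableR ii].
- by move=> w; rewrite ger0_norm ?normc_le_ReIm//; exact: le_trans (normr_ge0 _) (Re_le_normc _).
- by apply: integrableDR; exact: integrable_norm.
Qed.

Variables (p1 p2 : S -> 'M[R]_(m, n)) (M : R).
Hypothesis p1M : bounded_coeff M p1.
Hypothesis p2M : bounded_coeff M p2.

Let integrable_coeff p (f : T -> R) i j : bounded_coeff M p ->
  P.-integrable setT (EFin \o f) -> P.-integrable setT (EFin \o (fun w => p (W w) i j * f w)).
Proof.
move=> pM fi; have [mp bp] := pM i j.
apply: (@le_integrableR _ _ _ _ _ (fun w => M * `|f w|)).
- apply: measurable_funM; last exact: measurable_integrableR fi.
  exact: (measurableT_comp mp mW).
- by move=> w; rewrite normrM ler_wpM2r.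
- by apply: integrableZR; exact: integrable_norm.
Qed.

Lemma integrable_pairing X : integrable_mx P X ->
  P.-integrable setT (EFin \o (fun w => pairing p1 p2 (W w) (X w))).
Proof.
move=> iX; apply: integrable_sumR => i; apply: integrable_sumR => j.
by have [ir ii] := iX i j; apply: integrableDR; exact: integrable_coeff.
Qed.

Lemma integral_pairing X : integrable_mx P X ->
  \int[P]_w pairing p1 p2 (W w) (X w) =
  \sum_i \sum_j (\int[P]_w (p1 (W w) i j * complex.Re (X w i j)) +
                 \int[P]_w (p2 (W w) i j * complex.Im (X w i j))).
Proof.
move=> iX; rewrite Rintegral_sum => [|i]; last first.
  apply: integrable_sumR => j.
  by have [ir ii] := iX i j; apply: integrableDR; exact: integrable_coeff.
apply: eq_bigr => i _; rewrite Rintegral_sum => [|j]; last first.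
  by have [ir ii] := iX i j; apply: integrableDR; exact: integrable_coeff.
by apply: eq_bigr => j _; have [ir ii] := iX i j; rewrite RintegralD//; exact: integrable_coeff.
Qed.

Lemma pairing_condexp X : integrable_mx P X ->
  \int[P]_w pairing p1 p2 (W w) (condexp_mx P W X w) = \int[P]_w pairing p1 p2 (W w) (X w).
Proof.
move=> iX; rewrite !integral_pairing//; last exact: integrable_mx_condexp.
apply: eq_bigr => i _; apply: eq_bigr => j _; have [ir ii] := iX i j.
have [mp1 bp1] := p1M i j; have [mp2 bp2] := p2M i j.
congr (_ + _).
  rewrite -(condexp_pullout mW ir mp1 bp1).
  by apply: eq_Rintegral => w _; rewrite mxE.
rewrite -(condexp_pullout mW ii mp2 bp2).
by apply: eq_Rintegral => w _; rewrite mxE.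
Qed.

Lemma pairingB s A B : pairing p1 p2 s (A - B) = pairing p1 p2 s A - pairing p1 p2 s B.
Proof.
rewrite /pairing -sumrB; apply: eq_bigr => i _; rewrite -sumrB; apply: eq_bigr => j _.
rewrite !mxE ReD ImD ReN ImN; ring.
Qed.

Lemma pairingZ s (r : R) A : pairing p1 p2 s (r%:C *: A) = r * pairing p1 p2 s A.
Proof.
rewrite /pairing mulr_sumr; apply: eq_bigr => i _; rewrite mulr_sumr; apply: eq_bigr => j _.
rewrite !mxE ReZ ImZ; ring.
Qed.

Lemma le_integral_pairing X : 0 <= M -> integrable_mx P X ->
  `|\int[P]_w pairing p1 p2 (W w) (X w)| <=
    2 * M * \sum_i \sum_j \int[P]_w Normc.normc (X w i j).
Proof.
move=> M0 iX; apply: (le_trans (le_normr_Rintegral _ (integrable_pairing iX))) => //.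
rewrite (_ : \sum_i \sum_j _ = \int[P]_w \sum_i \sum_j Normc.normc (X w i j)); last first.
  rewrite Rintegral_sum => [|i]; last by apply: integrable_sumR => j; exact: integrable_normc.
  by apply: eq_bigr => i _; rewrite Rintegral_sum => // j; exact: integrable_normc.
have iS : P.-integrable setT (EFin \o (fun w => \sum_i \sum_j Normc.normc (X w i j))).
  by apply: integrable_sumR => i; apply: integrable_sumR => j; exact: integrable_normc.
rewrite -RintegralZl//; apply: le_Rintegral => //.
- by apply: integrable_norm; exact: integrable_pairing.
- exact: integrableZR.
move=> w _; apply: (le_trans (ler_norm_sum _ _ _)); rewrite mulr_sumr; apply: ler_sum => i _.
apply: (le_trans (ler_norm_sum _ _ _)); rewrite mulr_sumr; apply: ler_sum => j _.
apply: (le_trans (ler_normD _ _)); rewrite !normrM.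
have [_ b1] := p1M i j; have [_ b2] := p2M i j.
have := ler_pM (normr_ge0 _) (normr_ge0 _) (b1 (W w)) (Re_le_normc (X w i j)).
have := ler_pM (normr_ge0 _) (normr_ge0 _) (b2 (W w)) (Im_le_normc (X w i j)).
lra.
Qed.

Lemma L1_cvg_real (Y_ : R -> T -> 'M[R[i]]_(m, n)) L i j : L1_cvg P Y_ L ->
  \int[P]_w Normc.normc (Y_ e w i j - L w i j) @[e --> 0^'+] --> (0 : R).
Proof.
move=> /(_ i j)/fine_cvg H.
have E : (fun e => \int[P]_w Normc.normc (Y_ e w i j - L w i j)) =
    fine \o (fun e => 'E_P[fun w => (Normc.normc (Y_ e w i j - L w i j))%R])%E.
  by apply/funext => e; rewrite /= unlock.
by rewrite E.
Qed.

(** Coefficients that are bounded functions of [W] can be integrated against an L1 limit, and the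
    pull-out property then removes the conditioning: conditional limits become limits of plain
    expectations. *)
Lemma L1_cvg_pairing (X_ : R -> T -> 'M[R[i]]_(m, n)) L (r : R -> R) :
  0 <= M -> (forall e, 0 < e -> integrable_mx P (X_ e)) -> integrable_mx P L ->
  L1_cvg P (fun e w => (r e)%:C *: condexp_mx P W (X_ e) w) L ->
  r e * \int[P]_w pairing p1 p2 (W w) (X_ e w) @[e --> 0^'+] -->
    \int[P]_w pairing p1 p2 (W w) (L w).
Proof.
move=> M0 iX iL cvgL.
set Y_ := fun e w => (r e)%:C *: condexp_mx P W (X_ e) w in cvgL *.
have S0 : 2 * M * \sum_i \sum_j \int[P]_w Normc.normc (Y_ e w i j - L w i j) @[e --> 0^'+] --> (0 : R).
  have S1 : \sum_i \sum_j \int[P]_w Normc.normc (Y_ e w i j - L w i j) @[e --> 0^'+] -->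
      \sum_(i < m) \sum_(j < n) (0 : R).
    by apply: cvg_sumR => i; apply: cvg_sumR => j; exact: L1_cvg_real.
  move: S1; rewrite big1 => [|i _]; last by rewrite big1.
  by move=> /(@cvgMl_tmp _ _ _ _ _ (2 * M)); rewrite mulr0.
apply/cvgrPdist_le => eps eps0.
have /cvgrPdist_le/(_ _ eps0) := S0; apply: filterS2 (nbhs_right_gt 0) => e e0.
rewrite sub0r normrN => /(le_trans _); apply.
rewrite distrC -(pairing_condexp (iX e e0)).
have iC := @integrable_mx_condexp (X_ e).
rewrite -RintegralZl//; last exact: integrable_pairing.
rewrite (_ : \int[P]_w (r e * _) = \int[P]_w pairing p1 p2 (W w) (Y_ e w)); last first.
  by apply: eq_Rintegral => w _; rewrite pairingZ.
have iY : integrable_mx P (Y_ e) by exact: integrable_mxZ.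
rewrite -RintegralB//; try exact: integrable_pairing.
rewrite (_ : \int[P]_w (_ - _) = \int[P]_w pairing p1 p2 (W w) (Y_ e w - L w)); last first.
  by apply: eq_Rintegral => w _; rewrite pairingB.
have iYL : integrable_mx P (fun w => Y_ e w - L w).
  by apply: integrable_mxD => //; exact: integrable_mxN.
apply: (le_trans (le_integral_pairing M0 iYL)); apply: (le_trans _ (ler_norm _)).
rewrite ler_wpM2l ?mulr_ge0//; apply: ler_sum => i _; apply: ler_sum => j _.
rewrite le_eqVlt; apply/orP; left; apply/eqP; apply: eq_Rintegral => w _.
by rewrite !mxE.
Qed.

End pairing.

(** * Increments and truncated moments *)

Section increments.
Context {R : realType}.

(* A right-derivative mean value inequality, by a supremum argument. *)
Lemma increment_le (phi : R -> R) (B : R) :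
  (forall b, 0 <= b <= 1 -> forall e, 0 < e -> exists2 d, 0 < d &
     forall b', 0 <= b' <= 1 -> `|b' - b| < d -> `|phi b' - phi b| <= e) ->
  (forall b, 0 < b < 1 -> forall e, 0 < e -> exists2 b', b < b' <= 1 &
     `|phi b' - phi b| <= (B + e) * (b' - b)) ->
  0 <= B -> `|phi 1 - phi 0| <= B.
Proof.
move=> phi_cont phi_incr B0.
(* Increments are controlled only in the open interval, so the argument starts at b0 > 0; continuity
   at 0 removes b0 at the end. *)
have from_pos b0 eta : 0 < b0 < 1 -> 0 < eta -> `|phi 1 - phi b0| <= (B + eta) * (1 - b0).
  move=> /andP[b00 b01] eta0.
  have Be : 0 < B + eta by rewrite ltr_wpDl.
  pose A := [set b | b0 <= b <= 1 /\ `|phi b - phi b0| <= (B + eta) * (b - b0)].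
  have Ab0 : A b0 by split; [rewrite lexx ltW|rewrite !subrr normr0 mulr0].
  have ubA : ubound A 1 by move=> b [/andP[_ ?] _].
  have supA : has_sup A by split; [exists b0|exists 1].
  pose s := sup A.
  have s1 : s <= 1 by apply: ge_sup => //; exists b0.
  have b0s : b0 <= s by apply: ub_le_sup Ab0; exists 1.
  (* The supremum belongs to the set: points of [A] approach it from the left and [phi] is
     continuous there. *)
  have As : `|phi s - phi b0| <= (B + eta) * (s - b0).
    apply/ler_addgt0Pr => e e0.
    have s01 : 0 <= s <= 1 by rewrite s1 (le_trans (ltW b00)).
    have [d d0 hd] := phi_cont s s01 e e0.
    have [b [/andP[b0b b1] bA] sb] := sup_adherent d0 supA.
    have bs : b <= s by apply: ub_le_sup; [exists 1|split=> //; rewrite b0b].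
    have b01' : 0 <= b <= 1 by rewrite b1 (le_trans (ltW b00)).
    have := hd b b01'; rewrite ler0_norm ?subr_le0// => /(_ ltac:(rewrite /s in sb *; lra)) h.
    have h1 : (B + eta) * (b - b0) <= (B + eta) * (s - b0) by rewrite ler_wpM2l ?(ltW Be)// lerB.
    have := ler_distD (phi b) (phi s) (phi b0); rewrite (distrC (phi s) (phi b)).
    by move: bA h h1; clear; lra.
  (* If s < 1, the increment hypothesis at s produces a point of [A] beyond its supremum. *)
  have [s_lt1|] := ltP s 1; last by move=> h; have -> : 1 = s by apply/eqP; rewrite eq_le s1 h.
  have s01 : 0 < s < 1 by rewrite s_lt1 (lt_le_trans b00).
  have [b' /andP[sb' b'1] hb'] := phi_incr s s01 eta eta0.
  have : A b'.
    split; first by rewrite b'1 (le_trans b0s)// ltW.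
    rewrite (le_trans (ler_distD (phi s) _ _))//.
    by rewrite (le_trans (lerD hb' As))// -mulrDr ler_wpM2l ?(ltW Be)//; lra.
  by move=> /(ub_le_sup (ex_intro _ 1 ubA)); rewrite leNgt sb'.
apply/ler_addgt0Pr => e e0.
have [d d0 hd] := phi_cont 0 ltac:(by rewrite lexx ler01) (e / 2) ltac:(by rewrite divr_gt0).
pose b0 := Num.min (d / 2) 2^-1.
have b00 : 0 < b0 by rewrite lt_min divr_gt0//= invr_gt0.
have b0d : b0 < d by rewrite gt_min; apply/orP; left; lra.
have b01 : b0 < 1 by rewrite gt_min; apply/orP; right; lra.
have h1 := from_pos b0 (e / 2) ltac:(by rewrite b00 b01) ltac:(by rewrite divr_gt0).
have h2 : `|phi b0 - phi 0| <= e / 2 by apply: hd; rewrite ?subr0 ?gtr0_norm ?ltW.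
have h3 := ler_distD (phi b0) (phi 1) (phi 0).
have : (B + e / 2) * (1 - b0) <= (B + e / 2) * 1 by apply: ler_wpM2l; lra.
lra.
Qed.

End increments.

Section truncated_moment.
Context {R : realType} d (T : measurableType d) (P : probability T R).

(** This replaces a second moment when [Y] has only a first one. The minimum is dominated by [Y] and
    tends to 0 pointwise; as it increases with s, convergence along s = 1/(n+1) suffices. *)
Lemma truncated_moment (Y : T -> R) : P.-integrable setT (EFin \o Y) -> (forall w, 0 <= Y w) ->
  forall e, 0 < e -> exists2 s0, 0 < s0 & forall s, 0 < s -> s <= s0 ->
    \int[P]_w Num.min (Y w) (s * Y w ^+ 2) <= e.
Proof.
move=> iY Y0 e e0.
have mY := measurable_integrableR iY.
pose f s w := Num.min (Y w) (s * Y w ^+ 2).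
have mf s : measurable_fun setT (f s).
  by apply: measurable_minr => //; apply: measurable_funM => //; exact: measurable_funX.
have f_ge0 s w : 0 <= s -> 0 <= f s w by move=> s0; rewrite le_min Y0 mulr_ge0 ?sqr_ge0.
have f_le s w : f s w <= Y w by rewrite ge_min lexx.
have if_ s : 0 <= s -> P.-integrable setT (EFin \o f s).
  by move=> s0; apply: (le_integrableR (mf s) _ iY) => w; rewrite ger0_norm ?f_ge0.
have [] := @dominated_convergence _ _ _ P setT measurableT (fun n => EFin \o f n.+1%:R^-1)
  (cst 0%E) (EFin \o Y).
- by move=> n; exact/measurable_EFinP.
- exact: measurable_cst.
- apply: aeW => w _; apply/cvg_EFin; first by apply: nearW.
  apply/cvgrPdist_le => eps eps0.
  have [N _ hN] := @nbhs_infty_ger R (Y w ^+ 2 / eps).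
  exists N => // m /= Nm; rewrite sub0r normrN ger0_norm ?f_ge0// /f ge_min.
  apply/orP; right; rewrite ler_pdivrMl// -ler_pdivrMr//.
  by rewrite (le_trans (hN _ Nm))// ler_nat.
- by [].
- by apply: aeW => w n _ /=; rewrite lee_fin ger0_norm ?f_ge0.
move=> _ _; rewrite integral0 => /fine_cvg/cvgrPdist_le/(_ _ e0)[N _ /(_ N (leqnn _))].
rewrite /= sub0r normrN => hN; exists N.+1%:R^-1; first by rewrite invr_gt0.
move=> s s0 sN; apply: le_trans (le_trans (ler_norm _) hN).
apply: le_Rintegral => //; [by apply: if_; exact: ltW|exact: if_|].
move=> w _; rewrite le_min ge_min lexx/= ge_min; apply/orP; right.
by rewrite ler_wpM2r ?sqr_ge0.
Qed.

End truncated_moment.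

(** * The Ornstein-Uhlenbeck interpolation *)

(** The three groups are the error of the added Gaussian noise, the error of shrinking the point,
    and the cost of evaluating the quadratic term at the old point. In the application k = 1 -
    sqrt(1 - s^2), so 2k - k^2 is s^2. *)
Lemma ou_decomposition {R : realType} (F H H0 Q Q0 t k c : R) :
  F - H0 - (2 * k - k ^+ 2) * (- t / 2 + c ^+ 2 * Q0) =
  (F - H - c ^+ 2 * (2 * k - k ^+ 2) * Q) + (H - H0 + k * t) +
  (c ^+ 2 * (2 * k - k ^+ 2) * (Q - Q0) - k ^+ 2 / 2 * t).
Proof. by field. Qed.

Section ornstein_uhlenbeck.
Context {R : realType} {n : nat} (gam : probability 'cV[R]_n R).
Hypothesis cm : cameron_martin gam.
Variable g : 'cV[R]_n -> R.
Hypothesis g_lip : lipschitz_with 1 g.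
Context d (T : measurableType d) (P : probability T R) (X : T -> 'cV[R]_n).
Hypothesis mX : measurable_fun setT X.
Hypothesis iX : P.-integrable setT (EFin \o (fun w => enorm (X w))).
Local Notation U := 'cV[R]_n.
Local Notation eb := (expbounded (@enorm R n)).
Local Notation S b := (smoothed gam g b).
Implicit Types (x y u v z : U) (M : 'M[R]_n).

Lemma T2_quad u : T2 u = (fun z => 2 * quad (u *m u^T) z).
Proof.
apply/funext => z; rewrite /T2 /quad mxtrace_mulC.
have -> : \tr (u^T *m u) = dot u u.
  by rewrite /mxtrace big_ord1 mxE; apply: eq_bigr => i _; rewrite mxE.
have -> : u *m u^T *m z = dot u z *: u.
  rewrite -mulmxA; apply/colP => i; rewrite !mxE big_ord1 mxE mulrC; congr (_ * _).
  by apply: eq_bigr => j _; rewrite mxE.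
by rewrite dotZl; field.
Qed.

Lemma quad_sum M z : quad M z = \sum_i \sum_j M i j * quad (delta_mx i j) z.
Proof.
rewrite [LHS]/quad /mxtrace mulr_suml -sumrB; apply: eq_bigr => i _.
have tr_delta j : \sum_k (delta_mx i j : 'M[R]_n) k k = (i == j)%:R.
  rewrite (bigD1 i)//= mxE eqxx/= big1 ?addr0// => k ki.
  by rewrite mxE (negbTE ki).
have dotdelta j : dot (delta_mx i j *m z) z = z j 0 * z i 0.
  rewrite /dot (bigD1 i)//= mxE (bigD1 j)//= mxE !eqxx mul1r !big1 ?addr0// => k ki.
    by rewrite mxE big1 ?mul0r// => l _; rewrite mxE (negbTE ki) mul0r.
  by rewrite mxE (negbTE ki) andbF mul0r.
under [RHS]eq_bigr do rewrite /quad dotdelta /mxtrace tr_delta mulrBr.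
rewrite sumrB; congr (_ - _).
  by rewrite mxE mulr_suml; apply: eq_bigr => j _; rewrite mulrA.
rewrite (bigD1 i)//= eqxx mul1r big1 ?addr0// => j ji.
by rewrite eq_sym (negbTE ji) mul0r mulr0.
Qed.

Lemma smoothed_quad_sum b M y : S b (quad M) y = \sum_i \sum_j M i j * S b (quad (delta_mx i j)) y.
Proof.
have bq i j : eb (fun z => M i j * quad (delta_mx i j) z).
  by apply: expboundedZ; [exact: enorm_ge0|exact: eb_quadc].
rewrite (_ : quad M = (fun z => \sum_i \sum_j M i j * quad (delta_mx i j) z)); last first.
  by apply/funext => z; rewrite quad_sum.
rewrite (smoothed_sum cm g_lip); last by move=> i; apply: expbounded_sum => //; exact: enorm_ge0.
apply: eq_bigr => i _; rewrite (smoothed_sum cm g_lip)//; apply: eq_bigr => j _.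
by rewrite (smoothedZ cm g_lip)//; exact: eb_quadc.
Qed.

Lemma smoothed_T1_sum b u y : S b (T1 u) y = \sum_i u i 0 * S b (T1 (delta_mx i 0)) y.
Proof.
rewrite (_ : T1 u = (fun z => \sum_i u i 0 * T1 (delta_mx i 0) z)); last first.
  apply/funext => z; rewrite /T1 /dot mulr_sumr; apply: eq_bigr => i _.
  by rewrite -/(dot _ _) dot_delta mulrCA.
rewrite (smoothed_sum cm g_lip); last first.
  by move=> i; apply: expboundedZ; [exact: enorm_ge0|exact: eb_T1].
by apply: eq_bigr => i _; rewrite (smoothedZ cm g_lip)//; exact: eb_T1.
Qed.

Lemma smoothed_T1Z b k u y : S b (T1 (k *: u)) y = k * S b (T1 u) y.
Proof.
rewrite !(smoothed_T1_sum b _ y) mulr_sumr; apply: eq_bigr => i _.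
by rewrite mxE mulrA.
Qed.

Lemma smoothed_T2 b u y : S b (T2 u) y = 2 * S b (quad (u *m u^T)) y.
Proof. by rewrite T2_quad (smoothedZ cm g_lip)//; exact: eb_quadc. Qed.

Lemma smoothed_T2Z b k u y : S b (T2 (k *: u)) y = k ^+ 2 * S b (T2 u) y.
Proof.
rewrite !smoothed_T2 !(smoothed_quad_sum b _ y) mulrCA; congr (_ * _).
rewrite mulr_sumr; apply: eq_bigr => i _; rewrite mulr_sumr; apply: eq_bigr => j _.
rewrite !mxE !big_ord1 !mxE; ring.
Qed.

(** The Hessian bound for the rank one matrix u u^T, whose squared entries sum to |u|^4; a factor
    sqrt 2 is given up. *)
Lemma smoothed_T2_le b u y : 0 < b -> `|S b (T2 u) y| <= b * enorm u ^+ 2.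
Proof.
move=> b0; rewrite smoothed_T2 normrM ger0_norm//.
have -> : b * enorm u ^+ 2 = 2 * (b / 2 * enorm u ^+ 2) by field.
rewrite ler_wpM2l// (le_trans (smoothed_hessian cm g_lip y _ b0))//.
rewrite ler_wpM2l ?divr_ge0 ?(ltW b0)//.
have -> : \sum_i \sum_j (u *m u^T) i j ^+ 2 = (enorm u ^+ 2) ^+ 2.
  rewrite enorm_sqr expr2 /dot mulr_suml; apply: eq_bigr => i _; rewrite mulr_sumr.
  by apply: eq_bigr => j _; rewrite mxE big_ord1 mxE; ring.
rewrite -[leRHS]ger0_norm ?sqr_ge0// -[leRHS]sqrtr_sqr ler_wsqrtr//.
by rewrite ler_pdivrMr// ler_peMr ?sqr_ge0//; lra.
Qed.

Lemma eb_coord (i : 'I_n) : eb (fun z => z i 0).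
Proof.
split; first exact: measurable_coord.
have [_ [c c0 Hc]] := eb_enorm (R := R) (n := n); exists c => // z.
by apply: (le_trans (coord_le_enorm z i)); rewrite (le_trans (ler_norm _)).
Qed.

Lemma integral_smoothed_T1 b k y : \int[gam]_z S b (T1 (k *: z)) y = 0.
Proof.
under eq_Rintegral do rewrite smoothed_T1Z smoothed_T1_sum mulr_sumr.
have ic i : gam.-integrable setT (EFin \o (fun z : U => z i 0)).
  by apply: (eb_integrable cm); exact: eb_coord.
rewrite Rintegral_sum => [|i]; last first.
  by under eq_fun do rewrite mulrCA; under eq_fun do rewrite mulrC; exact: integrableZR.
apply: big1 => i _; under eq_Rintegral do rewrite mulrCA mulrC.
rewrite RintegralZl// (_ : Rintegral _ _ _ = 0) ?mulr0//.
rewrite -[RHS](gaussian_mean cm (delta_mx i 0)); apply: eq_Rintegral => z _.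
by rewrite dot_delta.
Qed.

(** [T2 (k z)] is 2 k^2 times the weight of z z^T, and averaging over z replaces z z^T by I/2. *)
Lemma integral_smoothed_T2 b k y :
  \int[gam]_z S b (T2 (k *: z)) y = k ^+ 2 * S b (quad 1%:M) y.
Proof.
have ic i j : gam.-integrable setT (EFin \o (fun z : U => z i 0 * z j 0)).
  by apply: (eb_integrable cm); apply: expboundedM; exact: eb_coord.
have E z : S b (T2 (k *: z)) y =
    \sum_i \sum_j (k ^+ 2 * 2 * S b (quad (delta_mx i j)) y) * (z i 0 * z j 0).
  rewrite smoothed_T2Z smoothed_T2 smoothed_quad_sum !mulr_sumr; apply: eq_bigr => i _.
  rewrite !mulr_sumr; apply: eq_bigr => j _; rewrite mxE big_ord1 mxE; ring.
under eq_Rintegral do rewrite E.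
rewrite Rintegral_sum => [|i]; last by apply: integrable_sumR => j; exact: integrableZR.
rewrite smoothed_quad_sum mulr_sumr; apply: eq_bigr => i _.
rewrite Rintegral_sum => [|j]; last exact: integrableZR.
rewrite mulr_sumr; apply: eq_bigr => j _; rewrite RintegralZl//.
have -> : \int[gam]_z (z i 0 * z j 0) = (i == j)%:R / 2.
  transitivity (\int[gam]_z (dot (delta_mx i 0) z * dot (delta_mx j 0) z)).
    by apply: eq_Rintegral => z _; rewrite !dot_delta.
  by rewrite (gaussian_cov cm) dot_delta mxE eqxx andbT.
by rewrite mxE; field.
Qed.

Lemma integrable_T1_scaled b k y : gam.-integrable setT (EFin \o (fun z => S b (T1 (k *: z)) y)).
Proof.
under eq_fun do rewrite smoothed_T1_sum.
apply: integrable_sumR => i; under eq_fun do rewrite mulrC.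
apply: integrableZR; under eq_fun do rewrite mxE; apply: integrableZR.
by apply: (eb_integrable cm); exact: eb_coord.
Qed.

Lemma integrable_T2_scaled b k y : gam.-integrable setT (EFin \o (fun z => S b (T2 (k *: z)) y)).
Proof.
under eq_fun do rewrite smoothed_T2Z smoothed_T2 smoothed_quad_sum.
do 2 apply: integrableZR; apply: integrable_sumR => i; apply: integrable_sumR => j.
under eq_fun do rewrite mulrC mxE big_ord1 mxE.
apply: integrableZR; apply: (eb_integrable cm); apply: expboundedM; exact: eb_coord.
Qed.

Lemma lipschitz_integrable (Y : T -> U) L (f : U -> R) : lipschitz_with L f ->
  measurable_fun setT Y -> P.-integrable setT (EFin \o (fun w => enorm (Y w))) ->
  P.-integrable setT (EFin \o (fun w => f (Y w))).
Proof.
move=> fL mY iY; apply: (@le_integrableR _ _ _ _ _ (fun w => `|f 0| + `|L| * enorm (Y w))).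
- exact: (measurableT_comp (measurable_lipschitz fL) mY).
- move=> w; have := fL (Y w) 0; rewrite subr0 => h.
  have := ler_normD (f (Y w) - f 0) (f 0); rewrite subrK => h'.
  have : L * enorm (Y w) <= `|L| * enorm (Y w) by rewrite ler_wpM2r ?enorm_ge0 ?ler_norm.
  lra.
- apply: integrableDR; [exact: finite_measure_integrable_cst|exact: integrableZR].
Qed.

Let mXn (a : R) : measurable_fun setT (fun w => a *: X w).
Proof. exact: measurable_cVZ. Qed.

Let iXn a : P.-integrable setT (EFin \o (fun w => enorm (a *: X w))).
Proof. by under eq_fun do rewrite enormZ; exact: integrableZR. Qed.

Lemma integrable_smoothed b w a : eb w -> P.-integrable setT (EFin \o (fun t => S b w (a *: X t))).
Proof. by move=> bw; apply: (lipschitz_integrable (smoothed_lip cm g_lip b bw)). Qed.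

Lemma eb_one : eb (fun=> 1). Proof. by apply: expbounded_cst; exact: enorm_ge0. Qed.

Lemma smoothed_one_lip b : lipschitz_with 1 (S b (fun=> 1)).
Proof.
have := smoothed_lip cm g_lip b eb_one.
rewrite (_ : \int[gam]_z `|1| = 1)//.
by rewrite Rintegral_cst// normr1 probability_fine mulr1.
Qed.

Lemma integrable_smoothed_T1 b c a : 0 <= b ->
  P.-integrable setT (EFin \o (fun t => S b (T1 (c *: X t)) (a *: X t))).
Proof.
move=> b0; apply: (@le_integrableR _ _ _ _ _ (fun t => b * enorm (c *: X t))).
- under eq_fun do rewrite smoothed_T1_sum.
  apply: measurable_sum => i; apply: measurable_funM.
    by have /measurable_fun_cVP := mXn c; exact.
  apply: (measurableT_comp (measurable_lipschitz (smoothed_lip cm g_lip b (eb_T1 _)))).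
  exact: mXn.
- by move=> t; exact: smoothed_gradient.
- exact: integrableZR.
Qed.

Definition interpolation (b : R) := \int[P]_t S b (fun=> 1) (Num.sqrt (1 - b ^+ 2) *: X t).
Let mX1 := \int[P]_t enorm (X t).
Let mg1 := \int[gam]_z enorm z.

Lemma smoothed_one_scale b b' y : `|S b' (fun=> 1) y - S b (fun=> 1) y| <= `|b' - b| * mg1.
Proof.
rewrite /smoothed -RintegralB//; try by apply: (eb_integrable cm); apply: expboundedM;
  [exact: eb_g|exact: eb_one].
have i1 : gam.-integrable setT (EFin \o (fun z => g (y + b' *: z) * 1 - g (y + b *: z) * 1)).
  by apply: integrableBR; apply: (eb_integrable cm); (apply: expboundedM; [exact: eb_g|exact: eb_one]).
apply: (le_trans (le_normr_Rintegral _ i1)) => //.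
have ie : gam.-integrable setT (EFin \o @enorm R n) by apply: (eb_integrable cm); exact: eb_enorm.
rewrite -RintegralZl//; apply: le_Rintegral => //; [exact: integrable_norm|exact: integrableZR|].
move=> z _; rewrite !mulr1 (le_trans (g_lip _ _))// mul1r opprD addrACA subrr add0r.
by rewrite -scalerBl enormZ.
Qed.

Lemma interpolation_diff b b' : `|interpolation b' - interpolation b| <=
  `|Num.sqrt (1 - b' ^+ 2) - Num.sqrt (1 - b ^+ 2)| * mX1 + `|b' - b| * mg1.
Proof.
rewrite /interpolation; set a' := Num.sqrt (1 - b' ^+ 2); set a := Num.sqrt (1 - b ^+ 2).
rewrite -RintegralB//; try exact: (integrable_smoothed _ _ eb_one).
have i1 : P.-integrable setT (EFin \o (fun t => S b' (fun=> 1) (a' *: X t) - S b (fun=> 1) (a *: X t))).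
  by apply: integrableBR; exact: (integrable_smoothed _ _ eb_one).
apply: (le_trans (le_normr_Rintegral _ i1)) => //.
have ic : P.-integrable setT (EFin \o (fun=> `|b' - b| * mg1)) by exact: finite_measure_integrable_cst.
apply: (@le_trans _ _ (\int[P]_t (`|a' - a| * enorm (X t) + `|b' - b| * mg1))).
  apply: le_Rintegral => //; [exact: integrable_norm|by apply: integrableDR => //; exact: integrableZR|].
  move=> t _; apply: (le_trans (ler_distD (S b' (fun=> 1) (a *: X t)) _ _)); apply: lerD.
    by rewrite (le_trans (smoothed_one_lip b' _ _))// mul1r -scalerBl enormZ.
  exact: smoothed_one_scale.
rewrite RintegralD//; last exact: integrableZR.
by rewrite RintegralZl// Rintegral_cst// probability_fine mulr1.
Qed.

Lemma interpolation_continuous b : forall e, 0 < e -> exists2 d, 0 < d &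
     forall b', 0 <= b' <= 1 -> `|b' - b| < d -> `|interpolation b' - interpolation b| <= e.
Proof.
move=> e e0.
have cs : {for b, continuous (fun x : R => Num.sqrt (1 - x ^+ 2))}.
  apply: continuous_comp; last exact: sqrt_continuous.
  by apply: cvgB; [exact: cvg_cst|exact: exprn_continuous].
have mX10 : 0 <= mX1 by apply: Rintegral_ge0 => t _; exact: enorm_ge0.
have mg10 : 0 <= mg1 by apply: Rintegral_ge0 => t _; exact: enorm_ge0.
pose K := mX1 + mg1 + 1.
have K0 : 0 < K by rewrite ltr_wpDl ?addr_ge0.
have eK : 0 < e / K by rewrite divr_gt0.
have /cvgrPdist_le/(_ _ eK)/nbhs_ballP[r /= r0 hr] := cs.
exists (Num.min r (e / K)); first by rewrite lt_min r0.
move=> b' _; rewrite lt_min => /andP[b'd b'e].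
apply: (le_trans (interpolation_diff b b')).
have h1 : `|Num.sqrt (1 - b' ^+ 2) - Num.sqrt (1 - b ^+ 2)| <= e / K.
  by rewrite distrC; apply: hr; rewrite /ball /= distrC.
have h2 := ler_wpM2r mX10 h1; have h3 := ler_wpM2r mg10 (ltW b'e).
have : e / K * K = e by rewrite divfK// gt_eqF.
rewrite {2}/K !mulrDr mulr1; have := ltW eK; lra.
Qed.

(** The error must be o(s^2) after integration over an x having only a first moment. So |x| comes
    with s^3, and |x|^2 occurs only inside a minimum with |x|, which [truncated_moment] can
    handle. *)
Lemma ou_step_pointwise b (a := Num.sqrt (1 - b ^+ 2)) : 0 < b < 1 ->
  exists2 K, 0 <= K & forall s x, 0 < s < 1 ->
  `|S (Num.sqrt (b ^+ 2 + (a * s) ^+ 2)) (fun=> 1) ((a * Num.sqrt (1 - s ^+ 2)) *: x)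
    - S b (fun=> 1) (a *: x)
    - s ^+ 2 * (- S b (T1 ((a / b) *: x)) (a *: x) / 2 + (a / b) ^+ 2 * S b (quad 1%:M) (a *: x))|
  <= K * (s ^+ 3 + s ^+ 3 * enorm x + s ^+ 2 * Num.min (enorm x) (s ^+ 2 * enorm x ^+ 2)).
Proof.
move=> /andP[b0 b1].
have b2 : 0 < 1 - b ^+ 2 by rewrite subr_gt0 expr_lt1// ltW.
have a0 : 0 < a by rewrite sqrtr_gt0.
have a2 : a ^+ 2 = 1 - b ^+ 2 by rewrite sqr_sqrtr// ltW.
have a1 : a <= 1.
  rewrite -(@ler_pXn2r _ 2)// ?nnegrE ?(ltW a0)// a2 expr1n gerBl sqr_ge0//.
pose c := a / b; have c0 : 0 < c by rewrite divr_gt0.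
have [C C0 HC] := smoothed_taylor cm g_lip b0.
pose m3 := \int[gam]_z (enorm z ^+ 3).
have ebe3 : eb (fun z => enorm z ^+ 3) by apply: expboundedX; [exact: enorm_ge0|exact: eb_enorm].
have m30 : 0 <= m3 by apply: Rintegral_ge0 => z _; rewrite exprn_ge0 ?enorm_ge0.
pose m1 := \int[gam]_z `|quad 1%:M z|.
have m10 : 0 <= m1 by exact: Rintegral_ge0.
pose C' := C + b^-1.
have C'0 : 0 <= C' by rewrite addr_ge0 ?invr_ge0 ?(ltW b0).
(* [C * m3] is for the added noise, [2 + C'] for the shrinking of x, [c ^+ 2 * m1] for moving the
   quadratic term from y to a x, and 1 for the kap^2/2 correction of the gradient term. *)
pose K := C * m3 + (2 + C') + c ^+ 2 * m1 + 1.
have cm10 : 0 <= c ^+ 2 * m1 by rewrite mulr_ge0 ?sqr_ge0.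
have Cm30 : 0 <= C * m3 by rewrite mulr_ge0.
have K0 : 0 <= K by rewrite /K; lra.
have K1 : C * m3 <= K by rewrite /K; lra.
have K2 : 2 + C' <= K by rewrite /K; lra.
have K3 : c ^+ 2 * m1 + 1 <= K by rewrite /K; lra.
exists K => // s x /andP[s0 s1].
(* The relative shrinking of x: y = a x - a kap x. As 2 kap - kap^2 = s^2, it is s^2/2 to leading
   order and at most s^2. *)
pose kap := 1 - Num.sqrt (1 - s ^+ 2).
have s2 : 0 < 1 - s ^+ 2 by rewrite subr_gt0 expr_lt1// ltW.
have s21 : s ^+ 2 <= 1 by rewrite expr_le1// ltW.
have kap1 : kap <= 1 by rewrite /kap gerBl sqrtr_ge0.
have kapE : 2 * kap - kap ^+ 2 = s ^+ 2.
  have : Num.sqrt (1 - s ^+ 2) ^+ 2 = 1 - s ^+ 2 by rewrite sqr_sqrtr// ltW.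
  rewrite /kap; set q := Num.sqrt _ => qE.
  have -> : 2 * (1 - q) - (1 - q) ^+ 2 = 1 - q ^+ 2 by ring.
  rewrite qE; ring.
have kap0 : 0 <= kap.
  rewrite /kap subr_ge0 -[leRHS]sqrtr1 ler_wsqrtr// gerBl sqr_ge0//.
have kapk : kap ^+ 2 <= kap by rewrite expr2 ler_piMl.
have kaps : kap <= s ^+ 2 by lra.
have kap2 : kap ^+ 2 <= s ^+ 4.
  by rewrite -[4%N]/(2 * 2)%N exprM lerXn2r// nnegrE// sqr_ge0.
have a'E : (a * Num.sqrt (1 - s ^+ 2)) *: x = a *: x + (- (a * kap)) *: x.
  by rewrite -scalerDl /kap; congr (_ *: _); ring.
set y := (a * Num.sqrt (1 - s ^+ 2)) *: x in a'E *.
pose b' := Num.sqrt (b ^+ 2 + (a * s) ^+ 2).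
have bb : 0 < b ^+ 2 + (a * s) ^+ 2 by rewrite ltr_wpDr ?sqr_ge0// exprn_gt0.
have b'0 : 0 < b' by rewrite sqrtr_gt0.
have b'2 : b ^+ 2 + (a * s) ^+ 2 = b' ^+ 2 by rewrite sqr_sqrtr// ltW.
set Tx := S b (T1 ((a / b) *: x)) (a *: x); set Q := S b (quad 1%:M).
have x0 := enorm_ge0 x.
have s30 : 0 <= s ^+ 3 by rewrite exprn_ge0// ltW.
have s43 : s ^+ 4 <= s ^+ 3 by rewrite exprS ler_piMl// ltW.
have Tx_le : `|Tx| <= enorm x.
  apply: (le_trans (smoothed_gradient cm g_lip _ _ (ltW b0))).
  rewrite enormZ gtr0_norm// mulrA -/c [b * (a / b)]mulrC divfK ?gt_eqF//.
  by rewrite ler_piMl.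
(* Smoothing at b' is smoothing at b averaged over a further displacement a s z. In the averaged
   expansion the [T1] term vanishes and the [T2] term is the quadratic one. *)
have t1 : `|S b' (fun=> 1) y - S b (fun=> 1) y - c ^+ 2 * s ^+ 2 * Q y| <= C * m3 * s ^+ 3.
  have as0 : 0 <= a * s by rewrite mulr_ge0// ltW.
  rewrite -(smoothed_smoothed cm g_lip y b'0 b'2).
  pose k := b^-1 * (a * s).
  have kE z : b^-1 *: ((a * s) *: z) = k *: z by rewrite scalerA.
  have -> : c ^+ 2 * s ^+ 2 * Q y = \int[gam]_z (S b (T1 (k *: z)) y + S b (T2 (k *: z)) y).
    rewrite RintegralD//; [|exact: integrable_T1_scaled|exact: integrable_T2_scaled].
    rewrite integral_smoothed_T1 add0r integral_smoothed_T2 /k /c /Q.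
    by congr (_ * _); field; rewrite gt_eqF.
  have ebf : eb (fun z => S b (fun=> 1) (y + (a * s) *: z)) by exact: (eb_g (smoothed_one_lip b)).
  have i0 := eb_integrable cm ebf.
  have i1 := integrable_T1_scaled b k y; have i2 := integrable_T2_scaled b k y.
  have i12 := integrableDR i1 i2.
  have ic : gam.-integrable setT (EFin \o (fun=> S b (fun=> 1) y)) by exact: finite_measure_integrable_cst.
  have i01 := integrableBR i0 ic.
  have cE : S b (fun=> 1) y = \int[gam]_z (S b (fun=> 1) y).
    by rewrite Rintegral_cst// probability_fine mulr1.
  rewrite [X in _ - X - _]cE -RintegralB// -RintegralB//.
  have i3 := integrableBR i01 i12.
  apply: (le_trans (le_normr_Rintegral _ i3)) => //.
  have -> : C * m3 * s ^+ 3 = \int[gam]_z (C * s ^+ 3 * enorm z ^+ 3).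
    by rewrite RintegralZl//; [rewrite -/m3; ring|exact: (eb_integrable cm)].
  apply: le_Rintegral => //; [exact: integrable_norm|by apply: integrableZR; exact: (eb_integrable cm)|].
  move=> z _; have [_] := HC y ((a * s) *: z).
  rewrite !kE opprD addrA => /le_trans; apply.
  rewrite enormZ (ger0_norm as0).
  have -> : C * (a * s * enorm z) ^+ 3 = a ^+ 3 * (C * s ^+ 3 * enorm z ^+ 3) by ring.
  by rewrite ler_piMl ?mulr_ge0 ?exprn_ge0 ?enorm_ge0// ?exprn_ile1//; exact: ltW.
(* Two bounds for one displacement: the second order expansion gives |x|^2, and the Lipschitz and
   gradient bounds alone give |x|; the smaller is kept. *)
have t2 : `|S b (fun=> 1) y - S b (fun=> 1) (a *: x) + kap * Tx| <=
    (2 + C') * (s ^+ 2 * Num.min (enorm x) (s ^+ 2 * enorm x ^+ 2)).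
  pose e := (- (a * kap)) *: x.
  have eE : enorm e = a * kap * enorm x.
    by rewrite enormZ normrN ger0_norm// mulr_ge0// ltW.
  have e_le : enorm e <= kap * enorm x by rewrite eE ler_wpM2r// ler_piMl.
  have T1E : S b (T1 (b^-1 *: e)) (a *: x) = - kap * Tx.
    have kk : b^-1 * - (a * kap) = - kap * (a / b) by rewrite mulrN mulNr mulrC -mulrA mulrCA mulrA mulrAC.
    by rewrite /e scalerA kk -scalerA smoothed_T1Z.
  have v1 : `|S b (fun=> 1) y - S b (fun=> 1) (a *: x) + kap * Tx| <= C' * (s ^+ 4 * enorm x ^+ 2).
    have [+ _] := HC (a *: x) e; rewrite -/y -a'E T1E mulNr opprK.
    set v := _ + kap * Tx => hv.
    have ht := smoothed_T2_le (b^-1 *: e) (a *: x) b0.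
    have -> : v = v - S b (T2 (b^-1 *: e)) (a *: x) + S b (T2 (b^-1 *: e)) (a *: x) by rewrite subrK.
    apply: (le_trans (ler_normD _ _)).
    have ee : enorm e ^+ 2 <= s ^+ 4 * enorm x ^+ 2.
      apply: (@le_trans _ _ ((kap * enorm x) ^+ 2)).
        by rewrite lerXn2r// nnegrE ?enorm_ge0// mulr_ge0.
      by rewrite exprMn ler_wpM2r// sqr_ge0.
    have : C' * enorm e ^+ 2 <= C' * (s ^+ 4 * enorm x ^+ 2) by rewrite ler_wpM2l.
    have : b * enorm (b^-1 *: e) ^+ 2 = b^-1 * enorm e ^+ 2.
      rewrite enormZ ger0_norm ?invr_ge0 ?(ltW b0)//; field; exact: lt0r_neq0.
    rewrite /C' mulrDl; lra.
  have v2 : `|S b (fun=> 1) y - S b (fun=> 1) (a *: x) + kap * Tx| <= 2 * (s ^+ 2 * enorm x).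
    apply: (le_trans (ler_normD _ _)); rewrite normrM (ger0_norm kap0).
    have h1 : kap * `|Tx| <= kap * enorm x by rewrite ler_wpM2l.
    have h2 : kap * enorm x <= s ^+ 2 * enorm x by rewrite ler_wpM2r.
    rewrite mulr_natl mulr2n; apply: lerD; last exact: le_trans h1 h2.
    apply: (le_trans (smoothed_one_lip b y (a *: x))); rewrite mul1r.
    rewrite {1}a'E addrAC subrr add0r -/e eE; apply: le_trans h2.
    by rewrite ler_wpM2r// ler_piMl.
  have s20 := sqr_ge0 s; have C2 : 2 <= 2 + C' by rewrite -[leLHS]addr0 lerD2l.
  have C3 : C' <= 2 + C' by rewrite -[leLHS]add0r lerD2r.
  have [h|h] := leP (enorm x) (s ^+ 2 * enorm x ^+ 2).
    by apply: (le_trans v2); apply: ler_wpM2r => //; exact: mulr_ge0.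
  apply: (le_trans v1); rewrite [s ^+ 2 * _]mulrA -exprD; apply: ler_wpM2r => //.
  by rewrite mulr_ge0 ?exprn_ge0 ?(ltW s0).
have t3 : `|Q y - Q (a *: x)| <= m1 * (s ^+ 2 * enorm x).
  apply: (le_trans (smoothed_lip cm g_lip b (eb_quadc _) _ _)); rewrite ler_wpM2l//.
  rewrite a'E addrAC subrr add0r enormZ normrN ger0_norm ?mulr_ge0 ?(ltW a0)//.
  by rewrite ler_wpM2r// (le_trans _ kaps)// ler_piMl.
have -> : S b' (fun=> 1) y - S b (fun=> 1) (a *: x) - s ^+ 2 * (- Tx / 2 + c ^+ 2 * Q (a *: x)) =
  (S b' (fun=> 1) y - S b (fun=> 1) y - c ^+ 2 * s ^+ 2 * Q y) +
  (S b (fun=> 1) y - S b (fun=> 1) (a *: x) + kap * Tx) +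
  (c ^+ 2 * s ^+ 2 * (Q y - Q (a *: x)) - kap ^+ 2 / 2 * Tx).
  by rewrite -kapE; exact: ou_decomposition.
have r1 : `|c ^+ 2 * s ^+ 2 * (Q y - Q (a *: x))| <= c ^+ 2 * m1 * (s ^+ 3 * enorm x).
  have cs0 : 0 <= c ^+ 2 * s ^+ 2 := mulr_ge0 (sqr_ge0 c) (sqr_ge0 s).
  rewrite normrM (ger0_norm cs0).
  apply: (@le_trans _ _ (c ^+ 2 * s ^+ 2 * (m1 * (s ^+ 2 * enorm x)))).
    exact: ler_wpM2l.
  have -> : c ^+ 2 * s ^+ 2 * (m1 * (s ^+ 2 * enorm x)) = c ^+ 2 * m1 * (s ^+ 4 * enorm x) by ring.
  by rewrite ler_wpM2l// ler_wpM2r.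
have r2 : `|kap ^+ 2 / 2 * Tx| <= s ^+ 3 * enorm x.
  rewrite normrM ger0_norm ?divr_ge0 ?sqr_ge0//; apply: ler_pM => //.
    by rewrite divr_ge0 ?sqr_ge0.
  have h2k : kap ^+ 2 / 2 <= kap ^+ 2 by rewrite ler_pdivrMr// ler_peMr ?sqr_ge0// ler1n.
  exact: (le_trans h2k (le_trans kap2 s43)).
have mn0 : 0 <= s ^+ 2 * Num.min (enorm x) (s ^+ 2 * enorm x ^+ 2).
  by rewrite mulr_ge0 ?sqr_ge0// le_min x0 mulr_ge0 ?sqr_ge0.
have sx0 : 0 <= s ^+ 3 * enorm x by rewrite mulr_ge0.
have h1 := ler_wpM2r s30 K1; have h2 := ler_wpM2r mn0 K2; have h3 := ler_wpM2r sx0 K3.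
apply: (le_trans (ler_normD _ _)); apply: (le_trans (lerD (ler_normD _ _) (ler_normB _ _))).
apply: (le_trans (lerD (lerD (le_trans t1 h1) (le_trans t2 h2)) (lerD r1 r2))).
by rewrite -{2}[s ^+ 3 * enorm x]mul1r -mulrDl !mulrDr addrAC lerD2r lerD2l.
Qed.

End ornstein_uhlenbeck.

(** With h = b' - b one has h (b' + b) = a^2 s^2, so the main term is B h (b' + b) / (2 b), that is
    B h plus B h^2 / (2 b). This excess and the error term each receive half of e h, one for each
    smallness condition on s. *)
Lemma ou_increment {R : realType} (a b s B K m mu e : R) (b' := Num.sqrt (b ^+ 2 + (a * s) ^+ 2)) :
  0 < b < 1 -> 0 < a -> a ^+ 2 = 1 - b ^+ 2 -> 0 < s < 1 -> 0 <= B ->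
  B * s <= e * b ^+ 2 -> K * (s * (1 + m) + mu) <= e * a ^+ 2 / 4 ->
  [/\ b < b', b' <= 1 &
    s ^+ 2 / 2 * ((a / b) ^+ 2 * b * B) + K * (s ^+ 3 + s ^+ 3 * m + s ^+ 2 * mu) <=
    (B + e) * (b' - b)].
Proof.
move=> /andP[b0 b1] a0 a2 /andP[s0 s1] B0 Bs Ks.
have as0 : 0 < a * s by rewrite mulr_gt0.
have b'2 : b' ^+ 2 = b ^+ 2 + (a * s) ^+ 2 by rewrite sqr_sqrtr// addr_ge0 ?sqr_ge0.
have bb' : b < b'.
  by rewrite -(@ltr_pXn2r _ 2)// ?nnegrE ?sqrtr_ge0 ?(ltW b0)// b'2 ltrDl exprn_gt0.
have b'0 := lt_trans b0 bb'.
have s21 : s ^+ 2 <= 1 by rewrite expr_le1// ltW.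
have ss : s ^+ 2 <= s by rewrite expr2 ler_piMl// ltW.
have b'1 : b' <= 1.
  rewrite -(@ler_pXn2r _ 2)// ?nnegrE ?sqrtr_ge0// b'2 exprMn a2 expr1n.
  have : (1 - b ^+ 2) * s ^+ 2 <= 1 - b ^+ 2 by rewrite ler_piMr// -a2 sqr_ge0.
  lra.
split=> //.
pose h := b' - b; have h0 : 0 < h by rewrite subr_gt0.
have hE : h * (b' + b) = a ^+ 2 * s ^+ 2 by rewrite /h -subr_sqr b'2; ring.
have a21 : a ^+ 2 <= 1 by rewrite a2 gerBl sqr_ge0.
have hb : h * b <= s ^+ 2.
  apply: (@le_trans _ _ (h * (b' + b))); first by rewrite ler_wpM2l ?lerDr// ltW.
  by rewrite hE ler_piMl ?sqr_ge0.
have Bh : B * h <= e * b.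
  rewrite -(ler_pM2r b0) -!mulrA -expr2; apply: le_trans Bs.
  by rewrite ler_wpM2l// (le_trans hb).
have t1 : s ^+ 2 / 2 * ((a / b) ^+ 2 * b * B) <= h * B + h * e / 2.
  have -> : s ^+ 2 / 2 * ((a / b) ^+ 2 * b * B) = (a ^+ 2 * s ^+ 2) * B / (2 * b).
    by field; rewrite gt_eqF.
  have -> : a ^+ 2 * s ^+ 2 * B / (2 * b) = h * B + h * (B * h / (2 * b)).
    by rewrite -hE /h; field; rewrite gt_eqF.
  rewrite -[_ * e / 2]mulrA lerD2l ler_wpM2l ?(ltW h0)//.
  by rewrite ler_pdivrMr ?mulr_gt0//; lra.
have t2 : K * (s ^+ 3 + s ^+ 3 * m + s ^+ 2 * mu) <= h * e / 2.
  have -> : K * (s ^+ 3 + s ^+ 3 * m + s ^+ 2 * mu) = K * (s * (1 + m) + mu) * s ^+ 2 by ring.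
  apply: (le_trans (ler_wpM2r (sqr_ge0 s) Ks)).
  have -> : e * a ^+ 2 / 4 * s ^+ 2 = e / 4 * (a ^+ 2 * s ^+ 2) by ring.
  rewrite -hE.
  have e0 : 0 <= e.
    by rewrite -(@pmulr_lge0 _ (b ^+ 2)) ?exprn_gt0// (le_trans _ Bs)// mulr_ge0// ltW.
  have -> : e / 4 * (h * (b' + b)) = h * e / 4 * (b' + b) by ring.
  have -> : h * e / 2 = h * e / 4 * 2 by field.
  rewrite ler_wpM2l//; first by rewrite divr_ge0 ?mulr_ge0// ltW.
  by lra.
have -> : (B + e) * (b' - b) = (h * B + h * e / 2) + h * e / 2 by rewrite /h; field.
exact: lerD.
Qed.

Section ou_bound.
Context {R : realType} {n : nat} (gam : probability 'cV[R]_n R).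
Hypothesis cm : cameron_martin gam.
Variable g : 'cV[R]_n -> R.
Hypothesis g_lip : lipschitz_with 1 g.
Context d (T : measurableType d) (P : probability T R) (X : T -> 'cV[R]_n).
Hypothesis mX : measurable_fun setT X.
Hypothesis iX : P.-integrable setT (EFin \o (fun w => enorm (X w))).
Local Notation S b := (smoothed gam g b).
Local Notation interp := (interpolation gam g P X).

Lemma ou_step b B (a := Num.sqrt (1 - b ^+ 2)) : 0 < b < 1 -> 0 <= B ->
  `|\int[P]_w (2 * (a / b) ^+ 2 * S b (quad 1%:M) (a *: X w) -
               S b (T1 ((a / b) *: X w)) (a *: X w))| <= (a / b) ^+ 2 * b * B ->
  forall e, 0 < e -> exists2 b', b < b' <= 1 &
    `|interp b' - interp b| <= (B + e) * (b' - b).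
Proof.
move=> b01 B0 HB e e0; have /andP[b0 b1] := b01.
have [K K0 HK] := ou_step_pointwise cm g_lip b01; rewrite -/a in HK.
have b2 : 0 < 1 - b ^+ 2 by rewrite subr_gt0 expr_lt1// ltW.
have a0 : 0 < a by rewrite sqrtr_gt0.
have a2 : a ^+ 2 = 1 - b ^+ 2 by rewrite sqr_sqrtr// ltW.
pose m := \int[P]_w enorm (X w).
have m0 : 0 <= m by apply: Rintegral_ge0 => w _; exact: enorm_ge0.
(* Two quantities of size [e1] multiplied by K must stay below e a^2 / 4. *)
pose e1 := e * a ^+ 2 / (8 * (K + 1)).
have K10 : 0 < 8 * (K + 1) by rewrite mulr_gt0// ltr_wpDl.
have e10 : 0 < e1 by apply: divr_gt0 => //; rewrite mulr_gt0// exprn_gt0.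
have X0 w : 0 <= enorm (X w) by exact: enorm_ge0.
have [s0 s00 Hs0] := truncated_moment iX X0 e10.
have m10 : 0 < 1 + m by rewrite ltr_wpDr.
have B10 : 0 < B + 1 by rewrite ltr_wpDl.
have eb0 : 0 < e * b ^+ 2 by rewrite mulr_gt0// exprn_gt0.
(* In order: s < 1, the bound on B s, the bound on the first moment term, and the range where the
   truncated moment is at most [e1], used at s^2 <= s. *)
pose s := Num.min (Num.min 2^-1 (e * b ^+ 2 / (B + 1))) (Num.min (e1 / (1 + m)) s0).
have s_gt0 : 0 < s.
  by rewrite !lt_min invr_gt0 ltr0n s00 (divr_gt0 eb0 B10) (divr_gt0 e10 m10).
have [s_half sB sm ss0] : [/\ s <= 2^-1, s <= e * b ^+ 2 / (B + 1), s <= e1 / (1 + m) & s <= s0].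
  by split; rewrite /s !ge_min lexx ?orbT.
have s1 : s < 1 by apply: (le_lt_trans s_half); rewrite invf_lt1 ?ltr1n.
have s01 : 0 < s < 1 by rewrite s_gt0.
have s2s0 : s ^+ 2 <= s0.
  by apply: le_trans ss0; rewrite expr2 ler_piMl// ltW.
pose mu := \int[P]_w Num.min (enorm (X w)) (s ^+ 2 * enorm (X w) ^+ 2).
have mu_le : mu <= e1 by apply: Hs0 => //; rewrite exprn_gt0.
have Bs : B * s <= e * b ^+ 2.
  rewrite ler_pdivlMr// in sB; apply: le_trans sB.
  by rewrite mulrC ler_wpM2l ?(ltW s_gt0)// lerDl.
have Ks : K * (s * (1 + m) + mu) <= e * a ^+ 2 / 4.
  have h : s * (1 + m) + mu <= e1 + e1 by apply: lerD => //; rewrite -ler_pdivlMr.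
  apply: (le_trans (ler_wpM2l K0 h)).
  have -> : K * (e1 + e1) = e * a ^+ 2 / 4 * (K / (K + 1)).
    by rewrite /e1; field; rewrite gt_eqF// ltr_wpDl.
  apply: ler_piMr; first by rewrite divr_ge0// mulr_ge0 ?sqr_ge0// ltW.
  by rewrite ler_pdivrMr ?mul1r ?lerDl// ltr_wpDl.
have [bb' b'1 Hinc] := ou_increment b01 a0 a2 s01 B0 Bs Ks.
exists (Num.sqrt (b ^+ 2 + (a * s) ^+ 2)); first by rewrite bb'.
set b' := Num.sqrt _ in bb' b'1 Hinc *.
apply: le_trans Hinc.
(* This is why b' has its form: 1 - b'^2 = a^2 (1 - s^2), so the weight of W in the interpolation
   shrinks as in the pointwise estimate. *)
have a'E : Num.sqrt (1 - b' ^+ 2) = a * Num.sqrt (1 - s ^+ 2).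
  rewrite sqr_sqrtr ?addr_ge0 ?sqr_ge0//.
  have -> : 1 - (b ^+ 2 + (a * s) ^+ 2) = a ^+ 2 * (1 - s ^+ 2) by rewrite mulrBr mulr1 {1}a2; ring.
  by rewrite sqrtrM ?sqr_ge0// sqrtr_sqr gtr0_norm.
pose E w := 2 * (a / b) ^+ 2 * S b (quad 1%:M) (a *: X w) - S b (T1 ((a / b) *: X w)) (a *: X w).
have iE : P.-integrable setT (EFin \o E).
  apply: integrableBR; last by apply: (integrable_smoothed_T1 cm g_lip mX iX); exact: ltW.
  by apply: integrableZR; apply: (integrable_smoothed cm g_lip mX iX); exact: eb_quadc.
have i1 c c' : P.-integrable setT (EFin \o (fun w => S c (fun=> 1) (c' *: X w))).
  by apply: (integrable_smoothed cm g_lip mX iX); exact: eb_one.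
have imin : P.-integrable setT (EFin \o (fun w => Num.min (enorm (X w)) (s ^+ 2 * enorm (X w) ^+ 2))).
  have mN := measurable_integrableR iX.
  apply: (le_integrableR _ _ iX) => [|w].
    by apply: measurable_minr => //; apply: measurable_funM => //; exact: measurable_funX.
  by rewrite ger0_norm ?ge_min ?lexx// le_min enorm_ge0 mulr_ge0 ?sqr_ge0.
pose D w := S b' (fun=> 1) ((a * Num.sqrt (1 - s ^+ 2)) *: X w) - S b (fun=> 1) (a *: X w).
have iD : P.-integrable setT (EFin \o D) by exact: integrableBR.
have iDE : P.-integrable setT (EFin \o (fun w => D w - s ^+ 2 / 2 * E w)).
  by apply: integrableBR => //; exact: integrableZR.
have phiE : interp b' - interp b =
    \int[P]_w (D w - s ^+ 2 / 2 * E w) + s ^+ 2 / 2 * \int[P]_w E w.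
  have iE' := integrableZR (s ^+ 2 / 2) iE.
  rewrite (RintegralB measurableT iD iE') (RintegralZl _ measurableT iE) subrK.
  by rewrite /interpolation a'E -(RintegralB measurableT (i1 _ _) (i1 _ _)).
rewrite phiE addrC; apply: (le_trans (ler_normD _ _)); apply: lerD.
  by rewrite normrM ger0_norm ?divr_ge0 ?sqr_ge0// ler_wpM2l ?divr_ge0 ?sqr_ge0.
apply: (le_trans (le_normr_Rintegral _ iDE)) => //.
have ic c : P.-integrable setT (EFin \o (fun=> c)) by exact: finite_measure_integrable_cst.
have iY : P.-integrable setT (EFin \o (fun w => K * (s ^+ 3 + s ^+ 3 * enorm (X w) +
    s ^+ 2 * Num.min (enorm (X w)) (s ^+ 2 * enorm (X w) ^+ 2)))).
  apply: integrableZR; apply: integrableDR; last exact: integrableZR.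
  by apply: integrableDR => //; exact: integrableZR.
apply: (@le_trans _ _ (\int[P]_w (K * (s ^+ 3 + s ^+ 3 * enorm (X w) +
    s ^+ 2 * Num.min (enorm (X w)) (s ^+ 2 * enorm (X w) ^+ 2))))).
  apply: le_Rintegral => //; first exact: integrable_norm.
  move=> w _; apply: le_trans (HK s (X w) s01); rewrite -/b' /D /E.
  rewrite le_eqVlt; apply/orP; left; apply/eqP; congr `|_|; congr (_ - _); field.
  by rewrite gt_eqF.
have i2 : P.-integrable setT (EFin \o (fun w => s ^+ 3 + s ^+ 3 * enorm (X w))).
  by apply: integrableDR => //; exact: integrableZR.
rewrite RintegralZl//; last by apply: integrableDR => //; exact: integrableZR.
rewrite RintegralD//; last exact: integrableZR.
rewrite RintegralD//; last exact: integrableZR.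
by rewrite !RintegralZl// Rintegral_cst// probability_fine mulr1.
Qed.

Lemma ou_bound B : 0 <= B ->
  (forall b, 0 < b < 1 -> let a := Num.sqrt (1 - b ^+ 2) in
  `|\int[P]_w (2 * (a / b) ^+ 2 * S b (quad 1%:M) (a *: X w) -
               S b (T1 ((a / b) *: X w)) (a *: X w))| <= (a / b) ^+ 2 * b * B) ->
  `|\int[P]_w g (X w) - \int[gam]_z g z| <= B.
Proof.
move=> B0 HB.
have := @increment_le R interp B (fun b _ => interpolation_continuous cm g_lip mX iX b)
  (fun b b01 => ou_step b01 B0 (HB b b01)) B0.
have -> : interp 1 = \int[gam]_z g z.
  rewrite /interpolation expr1n subrr sqrtr0.
  under eq_Rintegral do rewrite scale0r.
  rewrite Rintegral_cst// probability_fine mulr1; apply: eq_Rintegral => z _.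
  by rewrite mulr1 add0r scale1r.
have -> : interp 0 = \int[P]_w g (X w).
  rewrite /interpolation expr0n subr0 sqrtr1; apply: eq_Rintegral => w _.
  rewrite /smoothed; under eq_Rintegral do rewrite mulr1 scale0r addr0 scale1r.
  by rewrite Rintegral_cst// probability_fine mulr1.
by rewrite distrC.
Qed.

End ou_bound.

(** * Complex vectors and matrices as real ones *)

Section real_linear_functionals.
Context d (T : measurableType d) (R : realType) (P : probability T R).
Context d' (S : measurableType d') (W : T -> S) (m n : nat).
Hypothesis mW : measurable_fun setT W.
Implicit Types (X L : T -> 'M[R[i]]_(m, n)).

Definition real_linear p q (f : 'M[R[i]]_(m, n) -> 'M[R]_(p, q)) :=
  (forall A B, f (A + B) = f A + f B) /\ (forall (r : R) A, f (r%:C *: A) = r *: f A).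

Variable l : S -> 'M[R[i]]_(m, n) -> R.
Hypothesis lD : forall s A B, l s (A + B) = l s A + l s B.
Hypothesis lZ : forall s (r : R) A, l s (r%:C *: A) = r * l s A.
Hypothesis ml : forall A, measurable_fun setT (l ^~ A).
Hypothesis bl : forall A, exists M, forall s, `|l s A| <= M.

Let ei i j : 'M[R[i]]_(m, n) := 'i *: delta_mx i j.

(** The functional is linear over the reals only, so it is determined by its values on the matrices
    E_ij and i E_ij. *)
Lemma functional_pairingE s A :
  l s A = pairing (fun s => \matrix_(i, j) l s (delta_mx i j))
                  (fun s => \matrix_(i, j) l s (ei i j)) s A.
Proof.
have l0 : l s 0 = 0 by rewrite -(scale0r 0) (lZ s 0) mul0r.
have lsum (I : Type) (r : seq I) (F : I -> 'M[R[i]]_(m, n)) :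
    l s (\sum_(i <- r) F i) = \sum_(i <- r) l s (F i).
  by elim: r => [|i r IH]; rewrite ?big_nil// !big_cons lD IH.
rewrite {1}(matrix_sum_delta A) lsum; apply: eq_bigr => i _.
rewrite lsum; apply: eq_bigr => j _; rewrite !mxE.
have -> : A i j *: delta_mx i j = (complex.Re (A i j))%:C *: delta_mx i j +
    (complex.Im (A i j))%:C *: ei i j.
  rewrite /ei scalerA -scalerDl; congr (_ *: _).
  by rewrite [LHS]complexE mulrC.
by rewrite lD !lZ; congr (_ + _); rewrite mulrC.
Qed.

(** A bound for each fixed matrix suffices, since only finitely many basis matrices are involved. *)
Lemma functional_bounded : exists2 M, 0 <= M &
  bounded_coeff M (fun s => \matrix_(i, j) l s (delta_mx i j)) /\
  bounded_coeff M (fun s => \matrix_(i, j) l s (ei i j)).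
Proof.
have /choice[M HM] := bl.
pose K := \sum_i \sum_j (`|M (delta_mx i j)| + `|M (ei i j)|).
have leK i j : `|M (delta_mx i j)| + `|M (ei i j)| <= K.
  rewrite /K (bigD1 i)//= (bigD1 j)//= -addrA lerDl addr_ge0//.
    by apply: sumr_ge0 => *; rewrite addr_ge0.
  by apply: sumr_ge0 => *; apply: sumr_ge0 => *; rewrite addr_ge0.
have K0 : 0 <= K by apply: sumr_ge0 => *; apply: sumr_ge0 => *; rewrite addr_ge0.
exists K => //; split=> i j; split.
- by under eq_fun do rewrite mxE; exact: ml.
- move=> s; rewrite mxE (le_trans (HM _ _))// (le_trans (ler_norm _))//.
  by rewrite (le_trans _ (leK i j))// lerDl.
- by under eq_fun do rewrite mxE; exact: ml.
- move=> s; rewrite mxE (le_trans (HM _ _))// (le_trans (ler_norm _))//.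
  by rewrite (le_trans _ (leK i j))// lerDr.
Qed.

Lemma integrable_functional X : integrable_mx P X ->
  P.-integrable setT (EFin \o (fun w => l (W w) (X w))).
Proof.
move=> iX; have [M M0 [b1 b2]] := functional_bounded.
by under eq_fun do rewrite functional_pairingE; exact: integrable_pairing b1 b2 _ iX.
Qed.

Lemma functional_condexp X : integrable_mx P X ->
  \int[P]_w l (W w) (condexp_mx P W X w) = \int[P]_w l (W w) (X w).
Proof.
move=> iX; have [M M0 [b1 b2]] := functional_bounded.
under eq_Rintegral do rewrite functional_pairingE.
by under [RHS]eq_Rintegral do rewrite functional_pairingE; exact: pairing_condexp b1 b2 _ iX.
Qed.

Lemma L1_cvg_functional (X_ : R -> T -> 'M[R[i]]_(m, n)) L (r : R -> R) :
  (forall e, 0 < e -> integrable_mx P (X_ e)) -> integrable_mx P L ->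
  L1_cvg P (fun e w => (r e)%:C *: condexp_mx P W (X_ e) w) L ->
  r e * \int[P]_w l (W w) (X_ e w) @[e --> 0^'+] --> \int[P]_w l (W w) (L w).
Proof.
move=> iX iL cL; have [M M0 [b1 b2]] := functional_bounded.
have E X : \int[P]_w l (W w) (X w) = \int[P]_w pairing (fun s => \matrix_(i, j) l s (delta_mx i j))
    (fun s => \matrix_(i, j) l s (ei i j)) (W w) (X w).
  by apply: eq_Rintegral => w _; exact: functional_pairingE.
rewrite E (_ : (fun e => _) = (fun e => r e * \int[P]_w
    pairing (fun s => \matrix_(i, j) l s (delta_mx i j))
      (fun s => \matrix_(i, j) l s (ei i j)) (W w) (X_ e w))); last first.
  by apply/funext => e; rewrite E.
exact: L1_cvg_pairing b1 b2 _ _ _ M0 iX iL cL.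
Qed.

End real_linear_functionals.

Section realification.
Context {R : realType}.

Lemma realifyD k (u v : 'cV[R[i]]_k) : realify (u + v) = realify u + realify v.
Proof.
by rewrite /realify add_col_mx; congr col_mx; apply/matrixP => i j; rewrite !mxE ?ReD ?ImD.
Qed.

Lemma realifyZ k (r : R) (v : 'cV[R[i]]_k) : realify (r%:C *: v) = r *: realify v.
Proof.
by rewrite /realify scale_col_mx; congr col_mx; apply/matrixP => i j; rewrite !mxE ?ReZ ?ImZ.
Qed.

Lemma realifyN k (v : 'cV[R[i]]_k) : realify (- v) = - realify v.
Proof.
by rewrite /realify opp_col_mx; congr col_mx; apply/matrixP => i j; rewrite !mxE ?ReN ?ImN.
Qed.

Lemma realifyB k (u v : 'cV[R[i]]_k) : realify (u - v) = realify u - realify v.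
Proof. by rewrite realifyD realifyN. Qed.

Definition complexify k (x : 'cV[R]_(k + k)) : 'cV[R[i]]_k :=
  \col_i (usubmx x i 0 +i* dsubmx x i 0).

Lemma realifyK k : cancel (@realify R k) (@complexify k).
Proof.
move=> v; apply/colP => i; rewrite !mxE /realify.
rewrite -[RHS]/(v i 0); have := col_mxEu (map_mx (@complex.Re R) v) (map_mx (@complex.Im R) v) i 0.
have := col_mxEd (map_mx (@complex.Re R) v) (map_mx (@complex.Im R) v) i 0.
by rewrite !mxE => -> ->; case: (v i 0).
Qed.

Lemma complexifyK k : cancel (@complexify k) (@realify R k).
Proof.
move=> x; rewrite -[RHS]vsubmxK /realify; congr col_mx; apply/colP => i; rewrite !mxE//=.
Qed.

Lemma measurable_realify d (T : measurableType d) k (f : T -> 'cV[R[i]]_k) :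
  measurable_fun setT f -> measurable_fun setT (fun w => realify (f w)).
Proof.
move=> /measurable_fun_mxP mf; apply/measurable_fun_cVP => i.
rewrite /realify; under eq_fun do rewrite mxE.
case: (fintype.split i) => j; under eq_fun do rewrite mxE.
  by have [] := (measurable_fun_complexP _).1 (mf j 0).
by have [] := (measurable_fun_complexP _).1 (mf j 0).
Qed.

(* The real matrices of [z |-> A z] and [z |-> A conj(z)] under [realify]. *)
Definition real_mx k (A : 'M[R[i]]_k) : 'M[R]_(k + k) :=
  let X := map_mx (@complex.Re R) A in let Y := map_mx (@complex.Im R) A in
  block_mx X (- Y) Y X.

Definition real_conj_mx k (A : 'M[R[i]]_k) : 'M[R]_(k + k) :=
  let X := map_mx (@complex.Re R) A in let Y := map_mx (@complex.Im R) A in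
  block_mx X Y Y (- X).

Lemma real_mx_linear k : real_linear (@real_mx k).
Proof.
split=> [A B|r A]; rewrite /real_mx ?add_block_mx ?scale_block_mx; congr block_mx;
  apply/matrixP => i j; rewrite !mxE ?ReD ?ImD ?ReZ ?ImZ//; ring.
Qed.

Lemma real_conj_mx_linear k : real_linear (@real_conj_mx k).
Proof.
split=> [A B|r A]; rewrite /real_conj_mx ?add_block_mx ?scale_block_mx; congr block_mx;
  apply/matrixP => i j; rewrite !mxE ?ReD ?ImD ?ReZ ?ImZ//; ring.
Qed.

Lemma real_mx1 k : real_mx (1%:M : 'M[R[i]]_k) = 1%:M.
Proof.
rewrite /real_mx [RHS]scalar_mx_block; congr block_mx; apply/matrixP => i j; rewrite !mxE;
  by case: (i == j) => /=; rewrite ?oppr0.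
Qed.

(** As a map of z this is v Re(v^* z) = (v v^* z + v v^T conj(z)) / 2. The real second order term
    thus splits into the two complex ones governed by (ii) and (iii). *)
Lemma realify_mul_tr k (v : 'cV[R[i]]_k) : realify v *m (realify v)^T =
  2^-1 *: (real_mx (v *m adjmx v) + real_conj_mx (v *m v^T)).
Proof.
rewrite /realify tr_col_mx mul_col_row /real_mx /real_conj_mx add_block_mx scale_block_mx.
congr block_mx; apply/matrixP => i j; rewrite !mxE !big_ord1 !mxE.
all: by case: (v i 0) (v j 0) => [x y] [x' y'] /=; field.
Qed.

Lemma Re_sum (I : Type) (r : seq I) (F : I -> R[i]) :
  complex.Re (\sum_(i <- r) F i) = \sum_(i <- r) complex.Re (F i).
Proof. by apply: (big_morph (@complex.Re R)) => // x y; rewrite ReD. Qed.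

Lemma hs_normE m n (A : 'M[R[i]]_(m, n)) : hs_norm A =
  Num.sqrt (\sum_i \sum_j (complex.Re (A i j) ^+ 2 + complex.Im (A i j) ^+ 2)).
Proof.
rewrite /hs_norm /mxtrace Re_sum; congr Num.sqrt; apply: eq_bigr => i _.
rewrite mxE Re_sum; apply: eq_bigr => j _; rewrite !mxE.
by case: (A i j) => x y /=; ring.
Qed.

(** Each complex entry spreads over four real ones whose squares add up to twice its squared
    modulus; this 2 cancels the 1/2 of the Gaussian covariance. *)
Let hs_norm_block k (A : 'M[R[i]]_k) (B : 'M[R]_(k + k)) :
  (forall i j, B (lshift k i) (lshift k j) ^+ 2 + B (lshift k i) (rshift k j) ^+ 2 +
    (B (rshift k i) (lshift k j) ^+ 2 + B (rshift k i) (rshift k j) ^+ 2) =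
    2 * (complex.Re (A i j) ^+ 2 + complex.Im (A i j) ^+ 2)) ->
  Num.sqrt ((\sum_i \sum_j B i j ^+ 2) / 2) = hs_norm A.
Proof.
move=> BA; rewrite hs_normE; congr Num.sqrt; rewrite big_split_ord/=.
under eq_bigr do rewrite big_split_ord/=.
under [X in _ + X]eq_bigr do rewrite big_split_ord/=.
rewrite -big_split/= mulr_suml; apply: eq_bigr => i _.
rewrite -!big_split/= mulr_suml; apply: eq_bigr => j _.
by rewrite BA mulrAC divff ?mul1r.
Qed.

Lemma sum_sqr_real_mx k (A : 'M[R[i]]_k) :
  Num.sqrt ((\sum_i \sum_j real_mx A i j ^+ 2) / 2) = hs_norm A.
Proof.
apply: hs_norm_block => i j.
by rewrite block_mxEul block_mxEur block_mxEdl block_mxEdr !mxE; ring.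
Qed.

Lemma sum_sqr_real_conj_mx k (A : 'M[R[i]]_k) :
  Num.sqrt ((\sum_i \sum_j real_conj_mx A i j ^+ 2) / 2) = hs_norm A.
Proof.
apply: hs_norm_block => i j.
by rewrite block_mxEul block_mxEur block_mxEdl block_mxEdr !mxE; ring.
Qed.

Lemma sqrtr_sum_le (I : Type) (r : seq I) (F : I -> R) : (forall i, 0 <= F i) ->
  Num.sqrt (\sum_(i <- r) F i) <= \sum_(i <- r) Num.sqrt (F i).
Proof.
move=> F0; elim: r => [|i r IH]; first by rewrite !big_nil sqrtr0.
rewrite !big_cons; apply: le_trans (_ : Num.sqrt (F i) + Num.sqrt (\sum_(j <- r) F j) <= _).
  rewrite -[leRHS]ger0_norm ?addr_ge0 ?sqrtr_ge0// -sqrtr_sqr ler_wsqrtr// sqrrD.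
  rewrite !sqr_sqrtr ?sumr_ge0// addrAC lerDl mulrn_wge0// mulr_ge0 ?sqrtr_ge0//.
by rewrite lerD2l.
Qed.

Lemma hs_norm_le m n (A : 'M[R[i]]_(m, n)) : hs_norm A <= \sum_i \sum_j Normc.normc (A i j).
Proof.
have h0 i j : 0 <= complex.Re (A i j) ^+ 2 + complex.Im (A i j) ^+ 2.
  by rewrite addr_ge0 ?sqr_ge0.
rewrite hs_normE (le_trans (sqrtr_sum_le _ _))// => [i|]; first exact: sumr_ge0.
apply: ler_sum => i _; rewrite (le_trans (sqrtr_sum_le _ _))//.
by apply: ler_sum => j _; case: (A i j).
Qed.

Lemma integrable_hs_norm d (T : measurableType d) (P : probability T R) m n
  (X : T -> 'M[R[i]]_(m, n)) : integrable_mx P X ->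
  P.-integrable setT (EFin \o (fun w => hs_norm (X w))).
Proof.
move=> iX; apply: (@le_integrableR _ _ _ _ _ (fun w => \sum_i \sum_j Normc.normc (X w i j))).
- under eq_fun do rewrite hs_normE.
  apply: (measurableT_comp (continuous_measurable_fun (@sqrt_continuous R))).
  apply: measurable_sum => i; apply: measurable_sum => j; have [ir ii] := iX i j.
  by apply: measurable_funD; apply: measurable_funX; apply: measurable_integrableR; [exact: ir|exact: ii].
- by move=> w; rewrite ger0_norm ?sqrtr_ge0// hs_norm_le.
- by apply: integrable_sumR => i; apply: integrable_sumR => j; exact: integrable_normc.
Qed.

Lemma Re_tr_adjmx k (v : 'cV[R[i]]_k) :
  complex.Re (\tr (v *m adjmx v)) = enorm (realify v) ^+ 2.
Proof.
rewrite enorm_sqr /dot big_split_ord/= /mxtrace Re_sum -big_split; apply: eq_bigr => i _.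
rewrite /realify col_mxEu col_mxEd !mxE big_ord1 !mxE.
by case: (v i 0) => x y /=; ring.
Qed.

End realification.

(** * The infinitesimal exchange W, W_e *)

Section smoothed_functionals.
Context {R : realType} {k : nat} (gam : probability 'cV[R]_(k + k) R).
Hypothesis cm : cameron_martin gam.
Variable g : 'cV[R]_(k + k) -> R.
Hypothesis g_lip : lipschitz_with 1 g.
Local Notation S b := (smoothed gam g b).

Lemma smoothed_quadD b M N y : S b (quad (M + N)) y = S b (quad M) y + S b (quad N) y.
Proof.
rewrite !(smoothed_quad_sum cm g_lip b _ y) -big_split; apply: eq_bigr => i _.
by rewrite -big_split; apply: eq_bigr => j _; rewrite mxE mulrDl.
Qed.

Lemma smoothed_quadZ b r M y : S b (quad (r *: M)) y = r * S b (quad M) y.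
Proof.
rewrite !(smoothed_quad_sum cm g_lip b _ y) mulr_sumr; apply: eq_bigr => i _.
by rewrite mulr_sumr; apply: eq_bigr => j _; rewrite mxE mulrA.
Qed.

Lemma smoothed_T1D b u v y : S b (T1 (u + v)) y = S b (T1 u) y + S b (T1 v) y.
Proof.
rewrite !(smoothed_T1_sum cm g_lip b _ y) -big_split; apply: eq_bigr => i _.
by rewrite mxE mulrDl.
Qed.

Let measurable_S b a w : expbounded (@enorm R _) w ->
  measurable_fun setT (fun v : 'cV[R[i]]_k => S b w (a *: realify v)).
Proof.
move=> bw; apply: (measurableT_comp (measurable_lipschitz (smoothed_lip cm g_lip b bw))).
by apply: measurable_cVZ => //; apply: measurable_realify; exact: measurable_id.
Qed.

Section functionals.
Context d (T : measurableType d) (P : probability T R).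
Variable W : {RV P >-> 'cV[R[i]]_k}.
Variables (a b c : R).
Hypothesis b0 : 0 < b.

Let mW : measurable_fun setT W. Proof. exact: measurable_funP. Qed.

(** Second and first order terms of the expansion, put in the form in which conditional limits can
    be tested: real-linear in [A] and, for fixed [A], bounded and measurable in [v]. The parameter
    [c] is later a / b. *)
Definition quad_functional (f : 'M[R[i]]_k -> 'M[R]_(k + k)) (v : 'cV[R[i]]_k) A :=
  S b (quad (f A)) (a *: realify v).

Definition gradient_functional (v A : 'cV[R[i]]_k) :=
  S b (T1 (c *: realify A)) (a *: realify v).

Section quad_functional.
Variable f : 'M[R[i]]_k -> 'M[R]_(k + k).
Hypothesis fl : real_linear f.
Local Notation lq := (quad_functional f).

Let lqD v A B : lq v (A + B) = lq v A + lq v B.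
Proof. by rewrite /quad_functional fl.1 smoothed_quadD. Qed.

Let lqZ v r A : lq v (r%:C *: A) = r * lq v A.
Proof. by rewrite /quad_functional fl.2 smoothed_quadZ. Qed.

Let mlq A : measurable_fun setT (lq ^~ A).
Proof. by apply: measurable_S; exact: eb_quadc. Qed.

Let blq A : exists M, forall v, `|lq v A| <= M.
Proof. eexists => v; exact: (smoothed_hessian cm g_lip). Qed.

Lemma integrable_quad_functional X : integrable_mx P X ->
  P.-integrable setT (EFin \o (fun w => lq (W w) (X w))).
Proof. exact: (integrable_functional mW lqD lqZ mlq blq). Qed.

Lemma quad_functional_condexp X : integrable_mx P X ->
  \int[P]_w lq (W w) (condexp_mx P W X w) = \int[P]_w lq (W w) (X w).
Proof. exact: (functional_condexp mW lqD lqZ mlq blq). Qed.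

Lemma L1_cvg_quad_functional X_ L (r : R -> R) :
  (forall e, 0 < e -> integrable_mx P (X_ e)) -> integrable_mx P L ->
  L1_cvg P (fun e w => (r e)%:C *: condexp_mx P W (X_ e) w) L ->
  r e * \int[P]_w lq (W w) (X_ e w) @[e --> 0^'+] --> \int[P]_w lq (W w) (L w).
Proof. exact: (L1_cvg_functional mW lqD lqZ mlq blq). Qed.

End quad_functional.

Let lgD v A B : gradient_functional v (A + B) = gradient_functional v A + gradient_functional v B.
Proof. by rewrite /gradient_functional realifyD scalerDr smoothed_T1D. Qed.

Let lgZ v r A : gradient_functional v (r%:C *: A) = r * gradient_functional v A.
Proof.
by rewrite /gradient_functional realifyZ scalerA mulrC -scalerA (smoothed_T1Z cm g_lip).
Qed.

Let mlg A : measurable_fun setT (gradient_functional ^~ A).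
Proof. by apply: measurable_S; exact: eb_T1. Qed.

Let blg A : exists M, forall v, `|gradient_functional v A| <= M.
Proof. by eexists => v; apply: (smoothed_gradient cm g_lip); exact: ltW. Qed.

Lemma integrable_gradient_functional X : integrable_mx P X ->
  P.-integrable setT (EFin \o (fun w => gradient_functional (W w) (X w))).
Proof. exact: (integrable_functional mW lgD lgZ mlg blg). Qed.

Lemma L1_cvg_gradient_functional X_ L (r : R -> R) :
  (forall e, 0 < e -> integrable_mx P (X_ e)) -> integrable_mx P L ->
  L1_cvg P (fun e w => (r e)%:C *: condexp_mx P W (X_ e) w) L ->
  r e * \int[P]_w gradient_functional (W w) (X_ e w) @[e --> 0^'+] -->
    \int[P]_w gradient_functional (W w) (L w).
Proof. exact: (L1_cvg_functional mW lgD lgZ mlg blg). Qed.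

End functionals.
End smoothed_functionals.

Lemma integrable_realify {R : realType} d (T : measurableType d) (P : probability T R) k
    (X : T -> 'cV[R[i]]_k) : measurable_fun setT X -> integrable_mx P X ->
  P.-integrable setT (EFin \o (fun w => enorm (realify (X w)))).
Proof.
move=> mX iX; apply: (@le_integrableR _ _ _ _ _ (fun w => \sum_i `|realify (X w) i 0|)).
- by apply: measurable_enorm; exact: measurable_realify.
- by move=> w; rewrite ger0_norm ?enorm_ge0// enorm_le_sum.
- apply: integrable_sumR => i; apply: integrable_norm => //.
  rewrite /realify; case: (splitP i) => j ij.
    have -> : i = lshift k j by exact: val_inj.
    by under eq_fun do rewrite col_mxEu mxE; exact: (iX j 0).1.
  have -> : i = rshift k j by exact: val_inj.
  by under eq_fun do rewrite col_mxEd mxE; exact: (iX j 0).2.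
Qed.

Section exchangeable_increments.
Context {R : realType} {k : nat} d (T : measurableType d) (P : probability T R).
Variables (W : {RV P >-> 'cV[R[i]]_k}) (W_ : R -> {RV P >-> 'cV[R[i]]_k}) (lambda : R -> R).
Variable Gamma : T -> 'M[R[i]]_k.
Let D e w := W_ e w - W w.
Hypothesis lambda_gt0 : forall e, 0 < e -> 0 < lambda e.
Hypothesis int_ii : forall e, 0 < e -> integrable_mx P (fun w => D e w *m adjmx (D e w)).
Hypothesis cond_ii : L1_cvg P
  (fun e w => ((2 * lambda e)^-1)%:C *: condexp_mx P W (fun w => D e w *m adjmx (D e w)) w)
  (fun w => 1%:M + condexp_mx P W Gamma w).
Hypothesis cond_iv : forall rho, 0 < rho ->
  (((lambda e)^-1)%:E *
     'E_P[fun w => (cnorm (D e w) ^+ 2 * \1_[set w' | rho < cnorm (D e w') ^+ 2] w)%R]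
   @[e --> 0^'+] --> 0)%E.

Let mD e : measurable_fun setT (fun w => realify (D e w)).
Proof.
rewrite (_ : (fun w => _) = (fun w => realify (W_ e w) - realify (W w))).
  by apply: measurable_cVB; apply: measurable_realify; exact: measurable_funP.
by apply/funext => w; rewrite -realifyB.
Qed.

Lemma measurable_increment e : measurable_fun setT (fun w => enorm (realify (D e w))).
Proof. exact: measurable_enorm. Qed.

Lemma integrable_increment_sqr e : 0 < e ->
  P.-integrable setT (EFin \o (fun w => enorm (realify (D e w)) ^+ 2)).
Proof.
move=> e0; under eq_fun do rewrite -Re_tr_adjmx /mxtrace Re_sum.
by apply: integrable_sumR => i; have [] := int_ii e0 i i.
Qed.

(** The trace of (ii), tested with a functional that ignores [W]: E|W_e - W|^2 / (2 lambda)
    converges. *)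
Lemma increment_sqr_bounded : exists2 K, 0 <= K & \forall e \near 0^'+,
  (lambda e)^-1 * \int[P]_w (enorm (realify (D e w)) ^+ 2) <= K.
Proof.
pose l (v : 'cV[R[i]]_k) (A : 'M[R[i]]_k) := complex.Re (\tr A).
have lD v A B : l v (A + B) = l v A + l v B by rewrite /l raddfD ReD.
have lZ v r A : l v (r%:C *: A) = r * l v A by rewrite /l mxtraceZ ReZ.
have ml A : measurable_fun setT (l ^~ A) by exact: measurable_cst.
have bl A : exists M, forall v, `|l v A| <= M by exists `|l 0 A| => v.
have iL : integrable_mx P (fun w => 1%:M + condexp_mx P W Gamma w).
  apply: integrable_mxD; first exact: integrable_mx_cst.
  by apply: integrable_mx_condexp; exact: measurable_funP.
have := L1_cvg_functional (measurable_funP W) lD lZ ml bl int_ii iL cond_ii.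
set L := \int[P]_w l _ _ => cL.
exists (2 * (`|L| + 1)); first by rewrite mulr_ge0// addr_ge0.
have /cvgrPdist_le/(_ 1 ltr01) := cL; apply: filterS2 (nbhs_right_gt 0) => e e0.
under eq_Rintegral do rewrite /l Re_tr_adjmx.
set I := Rintegral _ _ _; rewrite invfM => h.
have -> : (lambda e)^-1 * I = 2 * (2^-1 * (lambda e)^-1 * I) by field; rewrite gt_eqF// lambda_gt0.
rewrite ler_wpM2l//; move: h; rewrite distrC ler_distl => /andP[_ h].
by rewrite (le_trans h)// lerD2r ler_norm.
Qed.

(** The increment is split at |W_e - W| = r. Below r the cube is at most r times the square, whose
    mean over lambda is bounded; above r the square is controlled by (iv). *)
Lemma increment_min_small eta : 0 < eta -> \forall e \near 0^'+,
  (lambda e)^-1 * \int[P]_w Num.min (enorm (realify (D e w)) ^+ 2) (enorm (realify (D e w)) ^+ 3)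
    <= eta.
Proof.
move=> eta0; have [K K0 HK] := increment_sqr_bounded.
have K10 : 0 < K + 1 by rewrite ltr_wpDl.
(* r (K + 1) is half of [eta]. Condition (iv) is used at r^2 because it truncates the squared
   norm. *)
pose r := eta / (2 * (K + 1)).
have r0 : 0 < r by rewrite divr_gt0 ?mulr_gt0.
have eta2 : 0 < eta / 2 by rewrite divr_gt0.
have r20 : 0 < r ^+ 2 by rewrite exprn_gt0.
have /fine_cvg/cvgrPdist_le/(_ _ eta2) := cond_iv r20.
apply: filterS3 HK (nbhs_right_gt 0) => e hK e0.
rewrite sub0r normrN /= unlock => /(le_trans (ler_norm _)).
set N := fun w => enorm (realify (D e w)).
pose A := [set w | r ^+ 2 < N w ^+ 2].
have mA : measurable A.
  have := measurable_funX 2 (measurable_increment e) measurableT (measurable_itv `]r ^+ 2, +oo[).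
  by rewrite setTI; congr measurable; apply/seteqP; split=> w /=; rewrite in_itv/= andbT.
have iN2 := integrable_increment_sqr e0.
have iQ : P.-integrable setT (EFin \o (fun w => N w ^+ 2 * \1_A w)).
  apply: (@le_integrableR _ _ _ _ _ (fun w => N w ^+ 2)) => //.
    by apply: measurable_funM; [exact: (measurable_funX 2 (measurable_increment e))|exact: measurable_indic].
  move=> w; rewrite normrM ger0_norm ?sqr_ge0// ler_piMr ?sqr_ge0//.
  by rewrite indicE normr_nat; case: (_ \in _); rewrite ?ler01.
have fQ : (\int[P]_w (cnorm (D e w) ^+ 2 * \1_A w)%:E)%E \is a fin_num.
  exact: integrable_fin_num.
rewrite -/(cnorm _) -(fineK fQ) /= => hQ.
have l0 := lambda_gt0 e0.
have h w : Num.min (N w ^+ 2) (N w ^+ 3) <= r * N w ^+ 2 + N w ^+ 2 * \1_A w.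
  have N0 : 0 <= N w by exact: enorm_ge0.
  have [wA|wA] := boolP (w \in A).
    by rewrite indicE wA mulr1 ge_min lerDr mulr_ge0 ?sqr_ge0// ltW.
  rewrite indicE (negbTE wA) mulr0 addr0 ge_min exprS; apply/orP; right.
  rewrite ler_wpM2r ?sqr_ge0// -(@ler_pXn2r _ 2)// ?nnegrE ?(ltW r0)// leNgt.
  by apply: contra wA => wA; rewrite inE.
have imin : P.-integrable setT (EFin \o (fun w => Num.min (N w ^+ 2) (N w ^+ 3))).
  apply: (le_integrableR _ _ iN2) => [|w].
    by apply: measurable_minr; apply: measurable_funX; exact: measurable_increment.
  by rewrite ger0_norm ?ge_min ?lexx// le_min !exprn_ge0// enorm_ge0.
have irN : P.-integrable setT (EFin \o (fun w => r * N w ^+ 2)) by exact: integrableZR.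
apply: (@le_trans _ _ ((lambda e)^-1 * \int[P]_w (r * N w ^+ 2 + N w ^+ 2 * \1_A w))).
  have i3 := integrableDR irN iQ.
  by rewrite ler_wpM2l ?invr_ge0 ?(ltW l0)//; apply: le_Rintegral => // w _; exact: h.
rewrite RintegralD// RintegralZl// mulrDr mulrCA.
have -> : eta = r * (K + 1) + eta / 2 by rewrite /r; field; rewrite gt_eqF.
apply: lerD; last exact: hQ.
by rewrite ler_wpM2l ?(ltW r0)// (le_trans hK)// lerDl.
Qed.

End exchangeable_increments.

(** A limit 0 forces the L1 distance to be finite for some e > 0, so [L] differs from an integrable
    matrix by an integrable one. Applied to (i), this gives [W] its first moment. *)
Lemma L1_cvg_integrable {R : realType} d (T : measurableType d) (P : probability T R) m n
    (Y : R -> T -> 'M[R[i]]_(m, n)) (L : T -> 'M[R[i]]_(m, n)) :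
  (forall e, 0 < e -> integrable_mx P (Y e)) -> measurable_fun setT L ->
  L1_cvg P Y L -> integrable_mx P L.
Proof.
move=> iY mL cL i j.
have near_fin : \forall e \near 0^'+,
    ('E_P[fun w => (Normc.normc (Y e w i j - L w i j))%R])%E \is a fin_num /\ 0 < e.
  exact: filterI (cvg_is_fine (cL i j)) (nbhs_right_gt 0).
have [e [fe e0]] := @filter_ex _ _ (at_right_proper_filter (0 : R)) _ near_fin.
have [mr mi] := (measurable_fun_complexP _).1 ((measurable_fun_mxP _).1 mL i j).
have [ir ii] := iY e e0 i j.
have iN : P.-integrable setT (EFin \o (fun w => Normc.normc (Y e w i j - L w i j))).
  apply/integrableP; split.
    apply/measurable_EFinP; apply: measurable_normc; under eq_fun do rewrite ?(ReD, ImD) ?(ReN, ImN).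
      by apply: measurable_funB => //; exact: measurable_integrableR ir.
    by apply: measurable_funB => //; exact: measurable_integrableR ii.
  move: fe; rewrite unlock fin_numElt => /andP[_]; congr (_ < _)%E.
  by apply: eq_integral => w _; rewrite /= ger0_norm// (le_trans (normr_ge0 _) (Re_le_normc _)).
have tri (x y : R) : `|x| <= `|x - y| + `|y| by rewrite -{1}[x](subrK y) ler_normD.
split.
  apply: (@le_integrableR _ _ _ _ _ (fun w => Normc.normc (Y e w i j - L w i j) +
      `|complex.Re (Y e w i j)|)) => // [w|]; last by apply: integrableDR => //; exact: integrable_norm.
  have := Re_le_normc (Y e w i j - L w i j); rewrite ReD ReN distrC.
  by have := tri (complex.Re (L w i j)) (complex.Re (Y e w i j)); lra.
apply: (@le_integrableR _ _ _ _ _ (fun w => Normc.normc (Y e w i j - L w i j) +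
    `|complex.Im (Y e w i j)|)) => // [w|]; last by apply: integrableDR => //; exact: integrable_norm.
have := Im_le_normc (Y e w i j - L w i j); rewrite ImD ImN distrC.
by have := tri (complex.Im (L w i j)) (complex.Im (Y e w i j)); lra.
Qed.

Lemma integrable_distribution {R : realType} d (T : measurableType d) (P : probability T R)
    d' (S : measurableType d') (X : {RV P >-> S}) (f : S -> R) :
  (distribution P X).-integrable setT (EFin \o f) -> P.-integrable setT (EFin \o (f \o X)).
Proof.
move=> /integrableP[mf fi]; apply/integrableP; split.
  exact: (measurableT_comp mf (measurable_funP X)).
by rewrite ge0_integral_distribution in fi => //; exact: measurableT_comp.
Qed.

Lemma increment_rescaling {R : realType} (l x y z t : R) : l != 0 ->
  l^-1 * x + 2 * t * ((2 * l)^-1 * y + (2 * l)^-1 * z) = - (l^-1 * - (x + t * (y + z))).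
Proof. by move=> l0; field. Qed.

Lemma stationarity_limit {R : realType} (t x x' u v w v' w' w0 : R) :
  x' + 2 * t * (w' + v') = 0 -> x' = - x -> w' = u + w -> w = w0 -> v' = v ->
  2 * t * u - x = - (2 * t * (w0 + v)).
Proof. by move=> H E1 E2 E3 E4; subst; lra. Qed.

(** * The identity obtained in the limit from equality in law *)

Section stationarity.
Context {R : realType} {k : nat} (gam : probability 'cV[R]_(k + k) R).
Hypothesis cm : cameron_martin gam.
Variable g : 'cV[R]_(k + k) -> R.
Hypothesis g_lip : lipschitz_with 1 g.
Local Notation S b := (smoothed gam g b).
Context d (T : measurableType d) (P : probability T R).
Variables (W : {RV P >-> 'cV[R[i]]_k}) (W_ : R -> {RV P >-> 'cV[R[i]]_k}) (lambda : R -> R).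
Variables (Gamma Lambda : {RV P >-> 'M[R[i]]_k}).
Let D e w := W_ e w - W w.
Hypothesis W_law : forall e : R, 0 < e -> forall A : set 'cV[R[i]]_k, measurable A ->
  distribution P (W_ e) A = distribution P W A.
Hypothesis lambda_gt0 : forall e, 0 < e -> 0 < lambda e.
Hypothesis int_W : integrable_mx P W.
Hypothesis int_i : forall e, 0 < e -> integrable_mx P (D e).
Hypothesis int_ii : forall e, 0 < e -> integrable_mx P (fun w => D e w *m adjmx (D e w)).
Hypothesis int_iii : forall e, 0 < e -> integrable_mx P (fun w => D e w *m (D e w)^T).
Hypothesis int_Gamma : integrable_mx P Gamma.
Hypothesis int_Lambda : integrable_mx P Lambda.
Hypothesis cond_i : L1_cvg P
  (fun e w => ((lambda e)^-1)%:C *: condexp_mx P W (D e) w) (fun w => - W w).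
Hypothesis cond_ii : L1_cvg P
  (fun e w => ((2 * lambda e)^-1)%:C *: condexp_mx P W (fun w => D e w *m adjmx (D e w)) w)
  (fun w => 1%:M + condexp_mx P W Gamma w).
Hypothesis cond_iii : L1_cvg P
  (fun e w => ((2 * lambda e)^-1)%:C *: condexp_mx P W (fun w => D e w *m (D e w)^T) w)
  (fun w => condexp_mx P W Lambda w).
Hypothesis cond_iv : forall rho, 0 < rho ->
  (((lambda e)^-1)%:E *
     'E_P[fun w => (cnorm (D e w) ^+ 2 * \1_[set w' | rho < cnorm (D e w') ^+ 2] w)%R]
   @[e --> 0^'+] --> 0)%E.

Variables (a b : R).
Hypotheses (a01 : 0 <= a <= 1) (b0 : 0 < b).
Let c := a / b.
Let lg := gradient_functional gam g a b c.
Let lr := quad_functional gam g a b (@real_mx R k).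
Let lc := quad_functional gam g a b (@real_conj_mx R k).
Let h (v : 'cV[R[i]]_k) := S b (fun=> 1) (a *: realify v).
Let rest e w := h (W_ e w) - h (W w) - lg (W w) (D e w)
  - c ^+ 2 * (lr (W w) (D e w *m adjmx (D e w)) + lc (W w) (D e w *m (D e w)^T)).

(** The expansion of [smoothed b 1] at a W with step a (W_e - W), where 0 <= a <= 1 lets a be
    dropped from the bound. The 2 relating [T2] to [quad] cancels the 1/2 of [realify_mul_tr], hence
    the plain factor c^2 in [rest]. *)
Let rest_le : exists2 C, 0 <= C & forall e w, `|rest e w| <=
  C * Num.min (enorm (realify (D e w)) ^+ 2) (enorm (realify (D e w)) ^+ 3).
Proof.
have [C C0 HC] := smoothed_taylor cm g_lip b0; exists C => // e w.
have /andP[a0 a1] := a01.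
have := HC (a *: realify (W w)) (a *: realify (D e w)).
rewrite -scalerDr -realifyD [W w + _]addrC subrK -/(h _) -/(h _) scalerA [b^-1 * a]mulrC -/c.
rewrite (smoothed_T2Z cm g_lip) (smoothed_T2 cm g_lip) realify_mul_tr.
rewrite (smoothed_quadZ cm g_lip) (smoothed_quadD cm g_lip) [2 * _]mulrA divff// mul1r.
rewrite -/(lg _ _) -/(lr _ _) -/(lc _ _) -/(rest e w) => -[h2 h3].
have N0 : 0 <= enorm (realify (D e w)) by exact: enorm_ge0.
have Nle : enorm (a *: realify (D e w)) <= enorm (realify (D e w)).
  by rewrite enormZ ger0_norm// ler_piMl.
have Na0 : 0 <= enorm (a *: realify (D e w)) by exact: enorm_ge0.
have [_|_] := leP (enorm (realify (D e w)) ^+ 2) (enorm (realify (D e w)) ^+ 3).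
  by rewrite (le_trans h2)// ler_wpM2l// lerXn2r.
by rewrite (le_trans h3)// ler_wpM2l// lerXn2r.
Qed.

Let mh : measurable_fun setT h.
Proof.
apply: (measurableT_comp (measurable_lipschitz (smoothed_one_lip cm g_lip b))).
by apply: measurable_cVZ => //; apply: measurable_realify; exact: measurable_id.
Qed.

Let integrable_h (Y : {RV P >-> 'cV[R[i]]_k}) : integrable_mx P Y ->
  P.-integrable setT (EFin \o (fun w => h (Y w))).
Proof.
move=> iY; apply: (lipschitz_integrable (smoothed_one_lip cm g_lip b)).
  by apply: measurable_cVZ => //; apply: measurable_realify; exact: measurable_funP.
under eq_fun do rewrite enormZ.
by apply: integrableZR; apply: integrable_realify => //; exact: measurable_funP.
Qed.

Let int_W_ e : 0 < e -> integrable_mx P (W_ e).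
Proof.
move=> e0; rewrite (_ : (W_ e : T -> _) = (fun w => W w + D e w)).
  by apply: integrable_mxD => //; exact: int_i.
by apply/funext => w; rewrite /D addrC subrK.
Qed.

Let integral_h e : 0 < e -> \int[P]_w h (W_ e w) = \int[P]_w h (W w).
Proof.
move=> e0.
have mhE : measurable_fun setT (EFin \o h) by exact/measurable_EFinP.
have E (Y : {RV P >-> 'cV[R[i]]_k}) : integrable_mx P Y ->
    \int[P]_w h (Y w) = fine (\int[distribution P Y]_v (EFin \o h) v)%E.
  by move=> iY; rewrite (integral_distribution mhE (integrable_h iY)).
rewrite (E _ (int_W_ e0)) (E _ int_W); congr fine.
by apply: eq_measure_integral => A mA _; exact: W_law.
Qed.

Let expansion e : 0 < e ->
  \int[P]_w rest e w = - (\int[P]_w lg (W w) (D e w) +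
  c ^+ 2 * (\int[P]_w lr (W w) (D e w *m adjmx (D e w)) +
            \int[P]_w lc (W w) (D e w *m (D e w)^T))) /\
  P.-integrable setT (EFin \o rest e).
Proof.
move=> e0.
have ig := integrable_gradient_functional cm g_lip W a c b0 (int_i e0).
have ir := integrable_quad_functional cm g_lip W a b0 (@real_mx_linear R k) (int_ii e0).
have ic := integrable_quad_functional cm g_lip W a b0 (@real_conj_mx_linear R k) (int_iii e0).
have irc := integrableDR ir ic; have icrc := integrableZR (c ^+ 2) irc.
have ih1 := integrable_h (int_W_ e0); have ih2 := integrable_h int_W.
have ih := integrableBR ih1 ih2; have ihg := integrableBR ih ig.
split; last exact: integrableBR ihg icrc.
rewrite (RintegralB measurableT ihg icrc) (RintegralB measurableT ih ig).
rewrite (RintegralB measurableT ih1 ih2) integral_h// subrr sub0r.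
by rewrite (RintegralZl _ measurableT irc) (RintegralD measurableT ir ic) -opprD.
Qed.

(** The expansion divided by lambda has a limit computed in two ways: term by term through
    (i)-(iii), and as zero through equality in law and the Lindeberg estimate. The minus sign in (i)
    makes the gradient term that of W itself. *)
Lemma stationarity :
  \int[P]_w (2 * c ^+ 2 * S b (quad 1%:M) (a *: realify (W w)) -
             S b (T1 (c *: realify (W w))) (a *: realify (W w))) =
  - (2 * c ^+ 2 * (\int[P]_w lr (W w) (Gamma w) + \int[P]_w lc (W w) (Lambda w))).
Proof.
have iCG : integrable_mx P (condexp_mx P W Gamma).
  by apply: integrable_mx_condexp; exact: measurable_funP.
have iCL : integrable_mx P (condexp_mx P W Lambda).
  by apply: integrable_mx_condexp; exact: measurable_funP.
have i1 : integrable_mx P (fun=> 1%:M : 'M[R[i]]_k) by exact: integrable_mx_cst.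
have iNW : integrable_mx P (fun w => - W w) by exact: integrable_mxN.
have cg := L1_cvg_gradient_functional (a := a) (c := c) cm g_lip b0 int_i iNW cond_i.
have cr := L1_cvg_quad_functional (a := a) cm g_lip b0 (@real_mx_linear R k) int_ii
  (integrable_mxD i1 iCG) cond_ii.
have cc := L1_cvg_quad_functional (a := a) cm g_lip b0 (@real_conj_mx_linear R k) int_iii iCL cond_iii.
(* The coefficient c^2 / lambda is written as 2 c^2 times 1 / (2 lambda) to match the normalisation
   of (ii) and (iii). *)
pose q e := (lambda e)^-1 * \int[P]_w lg (W w) (D e w) +
  2 * c ^+ 2 * ((2 * lambda e)^-1 * \int[P]_w lr (W w) (D e w *m adjmx (D e w)) +
                (2 * lambda e)^-1 * \int[P]_w lc (W w) (D e w *m (D e w)^T)).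
have cq : q @ 0^'+ --> \int[P]_w lg (W w) (- W w) +
    2 * c ^+ 2 * (\int[P]_w lr (W w) (1%:M + condexp_mx P W Gamma w) +
                  \int[P]_w lc (W w) (condexp_mx P W Lambda w)).
  exact: cvgD cg (@cvgMl_tmp _ _ _ _ _ (2 * c ^+ 2) _ (cvgD cr cc)).
(* [q] is minus the mean of [rest] divided by lambda, which [increment_min_small] makes small. *)
have q0 : q @ 0^'+ --> (0 : R).
  have [C C0 HC] := rest_le.
  have C10 : 0 < C + 1 by rewrite ltr_wpDl.
  apply/cvgrPdist_le => eta eta0.
  have eC : 0 < eta / (C + 1) by rewrite divr_gt0.
  have := increment_min_small lambda_gt0 int_ii cond_ii cond_iv eC.
  apply: filterS2 (nbhs_right_gt 0) => e e0 hmin.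
  have l0 := lambda_gt0 e0; have [rE ir] := expansion e0.
  have -> : q e = - ((lambda e)^-1 * \int[P]_w rest e w).
    by rewrite rE; apply: increment_rescaling; rewrite gt_eqF.
  rewrite sub0r opprK normrM gtr0_norm ?invr_gt0//.
  set m := \int[P]_w Num.min _ _ in hmin.
  have iN2 := integrable_increment_sqr int_ii e0.
  have imin : P.-integrable setT (EFin \o (fun w =>
      Num.min (enorm (realify (D e w)) ^+ 2) (enorm (realify (D e w)) ^+ 3))).
    have mN : measurable_fun setT (fun w => enorm (realify (D e w))).
      exact: (measurable_increment W W_ e).
    apply: (le_integrableR _ _ iN2) => [|w].
      by apply: measurable_minr; apply: measurable_funX; exact: mN.
    by rewrite ger0_norm ?ge_min ?lexx// le_min !exprn_ge0// enorm_ge0.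
  have : `|\int[P]_w rest e w| <= C * m.
    apply: (le_trans (le_normr_Rintegral _ ir)) => //.
    rewrite -RintegralZl//; apply: le_Rintegral => //; [exact: integrable_norm|exact: integrableZR|].
    by move=> w _; exact: HC.
  move=> hr; apply: (le_trans (ler_wpM2l _ hr)); first by rewrite invr_ge0 ltW.
  rewrite mulrCA; apply: (le_trans (ler_wpM2l C0 hmin)).
  by rewrite mulrCA ler_piMr ?(ltW eta0)// ler_pdivrMr// mul1r lerDl.
have H := @cvg_unique _ (@Rhausdorff R) _ (fmap_proper_filter q (at_right_proper_filter (0 : R))) _ _ cq q0.
have ir1 := integrable_quad_functional cm g_lip W a b0 (@real_mx_linear R k) i1.
have irC := integrable_quad_functional cm g_lip W a b0 (@real_mx_linear R k) iCG.
have ig := integrable_gradient_functional cm g_lip W a c b0 int_W.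
have crC : \int[P]_w lr (W w) (condexp_mx P W Gamma w) = \int[P]_w lr (W w) (Gamma w).
  exact: (quad_functional_condexp cm g_lip W a b0 (@real_mx_linear R k) int_Gamma).
have ccC : \int[P]_w lc (W w) (condexp_mx P W Lambda w) = \int[P]_w lc (W w) (Lambda w).
  exact: (quad_functional_condexp cm g_lip W a b0 (@real_conj_mx_linear R k) int_Lambda).
have lr1 : \int[P]_w lr (W w) (1%:M + condexp_mx P W Gamma w) =
    \int[P]_w lr (W w) 1%:M + \int[P]_w lr (W w) (condexp_mx P W Gamma w).
  rewrite -(RintegralD measurableT ir1 irC); apply: eq_Rintegral => w _.
  by rewrite /lr /quad_functional (real_mx_linear k).1 (smoothed_quadD cm g_lip).
have lgN : \int[P]_w lg (W w) (- W w) = - \int[P]_w lg (W w) (W w).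
  rewrite -mulN1r -(RintegralZl _ measurableT ig); apply: eq_Rintegral => w _.
  rewrite /lg /gradient_functional realifyN (_ : c *: - _ = -1 *: (c *: realify (W w))).
    exact: (smoothed_T1Z cm g_lip).
  by rewrite scaleN1r scalerN.
have ir1' := integrableZR (2 * c ^+ 2) ir1.
transitivity (2 * c ^+ 2 * \int[P]_w lr (W w) 1%:M - \int[P]_w lg (W w) (W w)).
  rewrite -(RintegralZl _ measurableT ir1) -(RintegralB measurableT ir1' ig).
  by apply: eq_Rintegral => w _; rewrite /lr /quad_functional real_mx1.
exact: (stationarity_limit H lgN lr1 crC ccC).
Qed.

End stationarity.

(** * Lipschitz functions on C^k and the Wasserstein bound *)

Lemma cnorm_gt0 {R : realType} k (v : 'cV[R[i]]_k) : v <> 0 -> 0 < cnorm v.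
Proof.
move=> v0; rewrite lt_neqAle enorm_ge0 andbT eq_sym; apply/eqP => n0; apply: v0.
rewrite -[LHS]realifyK; have -> : realify v = 0.
  apply/colP => i; apply/eqP; rewrite [X in _ == X]mxE -normr_le0 -[leRHS]n0.
  exact: coord_le_enorm.
by apply/colP => i; rewrite !mxE.
Qed.

Lemma lipschitz_complexify {R : realType} k (g : 'cV[R[i]]_k -> R) : (M1 g <= 1)%E ->
  lipschitz_with 1 (g \o @complexify R k).
Proof.
move=> g1 x y; have [->|/eqP xy] := eqVneq x y; first by rewrite !subrr normr0 enorm0 mulr0.
have xy' : complexify x <> complexify y by move=> /(can_inj (@complexifyK R k)).
have d0 : 0 < cnorm (complexify x - complexify y) by apply: cnorm_gt0 => /subr0_eq.
have -> : enorm (x - y) = cnorm (complexify x - complexify y).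
  by rewrite /cnorm realifyB !complexifyK.
rewrite -ler_pdivrMr//= -lee_fin; apply: le_trans g1.
by apply: ereal_sup_ubound; exists (complexify x, complexify y).
Qed.

Lemma integral_quad_functional_le {R : realType} k (gam : probability 'cV[R]_(k + k) R) g
    d (T : measurableType d) (P : probability T R) (W : {RV P >-> 'cV[R[i]]_k})
    (A : T -> 'M[R[i]]_k) f a b :
  cameron_martin gam -> lipschitz_with 1 g -> 0 < b -> real_linear f ->
  (forall B, Num.sqrt ((\sum_i \sum_j f B i j ^+ 2) / 2) = hs_norm B) -> integrable_mx P A ->
  `|\int[P]_w quad_functional gam g a b f (W w) (A w)| <= b / 2 * \int[P]_w hs_norm (A w).
Proof.
move=> cm g_lip b0 fl fhs iA.
have ir := integrable_quad_functional cm g_lip W a b0 fl iA.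
have ih := integrable_hs_norm iA.
apply: (le_trans (le_normr_Rintegral _ ir)) => //.
rewrite -RintegralZl//; apply: le_Rintegral => //; [exact: integrable_norm|exact: integrableZR|].
by move=> w _; rewrite -fhs; exact: smoothed_hessian.
Qed.

Lemma expectationE {R : realType} d (T : measurableType d) (P : probability T R) (f : T -> R) :
  P.-integrable setT (EFin \o f) -> ('E_P[f] = (\int[P]_w f w)%:E)%E.
Proof. by move=> fi; rewrite unlock fineK//; exact: integrable_fin_num. Qed.

Theorem corollary6 (R : realType) (k : nat)
    (d : measure_display) (T : measurableType d) (P : probability T R)
    (d' : measure_display) (T' : measurableType d') (P' : probability T' R)
    (W : {RV P >-> 'cV[R[i]]_k}) (W_ : R -> {RV P >-> 'cV[R[i]]_k})
    (Z : {RV P' >-> 'cV[R[i]]_k})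
    (lambda : R -> R) (Gamma Lambda : {RV P >-> 'M[R[i]]_k})
    (W_law : forall e : R, 0 < e -> forall A : set 'cV[R[i]]_k, measurable A ->
      distribution P (W_ e) A = distribution P W A)
    (W_as : {ae P, forall w, cnorm (W_ e w - W w) @[e --> 0^'+] --> 0})
    (Z_gauss : standard_complex_gaussian Z)
    (lambda_gt0 : forall e : R, 0 < e -> 0 < lambda e)
    (int_i : forall e : R, 0 < e ->
      integrable_mx P (fun w => W_ e w - W w))
    (int_ii : forall e : R, 0 < e ->
      integrable_mx P (fun w => (W_ e w - W w) *m adjmx (W_ e w - W w)))
    (int_iii : forall e : R, 0 < e ->
      integrable_mx P (fun w => (W_ e w - W w) *m (W_ e w - W w)^T))
    (int_Gamma : integrable_mx P Gamma)
    (int_Lambda : integrable_mx P Lambda)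
    (cond_i : L1_cvg P
      (fun e w => ((lambda e)^-1)%:C *:
         condexp_mx P W (fun w => W_ e w - W w) w)
      (fun w => - W w))
    (cond_ii : L1_cvg P
      (fun e w => ((2 * lambda e)^-1)%:C *:
         condexp_mx P W
           (fun w => (W_ e w - W w) *m adjmx (W_ e w - W w)) w)
      (fun w => 1%:M + condexp_mx P W Gamma w))
    (cond_iii : L1_cvg P
      (fun e w => ((2 * lambda e)^-1)%:C *:
         condexp_mx P W
           (fun w => (W_ e w - W w) *m (W_ e w - W w)^T) w)
      (fun w => condexp_mx P W Lambda w))
    (cond_iv : forall rho : R, 0 < rho ->
      (((lambda e)^-1)%:E *
         'E_P[fun w => (cnorm (W_ e w - W w) ^+ 2 *
                \1_[set w' | rho < cnorm (W_ e w' - W w') ^+ 2] w)%R]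
       @[e --> 0^'+] --> 0)%E) :
  (wasserstein W Z <=
     'E_P[fun w => hs_norm (Gamma w)] + 'E_P[fun w => hs_norm (Lambda w)])%E.
Proof.
(* (i) makes -W an L1 limit of integrable vectors. *)
have int_W : integrable_mx P W.
  have iNW : integrable_mx P (fun w => - W w).
    apply: L1_cvg_integrable cond_i => [e e0|].
      by apply: integrable_mxZ; apply: integrable_mx_condexp; exact: measurable_funP.
    apply/measurable_fun_mxP => i j; apply/measurable_fun_complexP.
    have [mr mi] := (measurable_fun_complexP _).1 ((measurable_fun_mxP _).1 (measurable_funP W) i j).
    split; under eq_fun do rewrite mxE ?ReN ?ImN; exact: measurable_funN.
  rewrite (_ : (W : T -> _) = (fun w => - - W w)); first exact: integrable_mxN.
  by apply/funext => w; rewrite opprK.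
pose mX := measurable_realify (measurable_funP W).
have iX := integrable_realify (measurable_funP W) int_W.
have mZ : measurable_fun setT (fun w => realify (Z w)).
  exact: measurable_realify (measurable_funP Z).
pose ZR : {RV P' >-> 'cV[R]_(k + k)} :=
  HB.pack (fun w => realify (Z w)) (isMeasurableFun.Build _ _ _ _ _ mZ).
have cm : cameron_martin (distribution P' ZR) by exact: (@gaussian_cameron_martin R (k + k) _ _ _ ZR Z_gauss).
pose gam := distribution P' ZR.
have iG := integrable_hs_norm int_Gamma; have iL := integrable_hs_norm int_Lambda.
pose B := \int[P]_w hs_norm (Gamma w) + \int[P]_w hs_norm (Lambda w).
have hs0 (A : 'M[R[i]]_k) : 0 <= hs_norm A by exact: sqrtr_ge0.
have B0 : 0 <= B by apply: addr_ge0; apply: Rintegral_ge0.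
have main (g : 'cV[R]_(k + k) -> R) : lipschitz_with 1 g ->
    `|\int[P]_w g (realify (W w)) - \int[gam]_z g z| <= B.
  move=> g_lip; apply: (ou_bound cm g_lip mX iX B0) => b /andP[b0 b1]; cbv zeta.
  set a := Num.sqrt (1 - b ^+ 2).
  have a01 : 0 <= a <= 1.
    by rewrite sqrtr_ge0 -[leRHS]sqrtr1 ler_wsqrtr// gerBl sqr_ge0.
  rewrite (stationarity cm g_lip W_law lambda_gt0 int_W int_i int_ii int_iii
    int_Gamma int_Lambda cond_i cond_ii cond_iii cond_iv a01 b0).
  have c0 : 0 <= 2 * (a / b) ^+ 2 := mulr_ge0 (ler0n R 2) (sqr_ge0 (a / b)).
  rewrite normrN normrM (ger0_norm c0).
  have h1 := integral_quad_functional_le W a cm g_lip b0 (@real_mx_linear R k)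
    (@sum_sqr_real_mx R k) int_Gamma.
  have h2 := integral_quad_functional_le W a cm g_lip b0 (@real_conj_mx_linear R k)
    (@sum_sqr_real_conj_mx R k) int_Lambda.
  have h := le_trans (ler_normD _ _) (lerD h1 h2).
  apply: (le_trans (ler_wpM2l c0 h)); rewrite -mulrDr -/B.
  (* 2 c^2 from stationarity times b / 2 from the Hessian bound is the c^2 b that [ou_bound] asks
     for. *)
  by rewrite le_eqVlt; apply/orP; left; apply/eqP; field; rewrite gt_eqF.
rewrite (expectationE iG) (expectationE iL) -EFinD -/B.
apply: ge_ereal_sup => _ [g /lipschitz_complexify g_lip <-].
(* Lipschitz functions have linear growth, so both expectations are finite and their difference is
   one of real numbers. *)
have iW : P.-integrable setT (EFin \o (g \o W)).
  have := lipschitz_integrable g_lip mX iX.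
  by under eq_fun do rewrite /= realifyK.
have iZ : P'.-integrable setT (EFin \o (g \o Z)).
  have : gam.-integrable setT (EFin \o (g \o @complexify R k)).
    apply: (lipschitz_integrable (P := gam) g_lip (@measurable_id _ _ _)).
    by apply: (eb_integrable cm); exact: eb_enorm.
  move=> /integrable_distribution; congr (_.-integrable _ _).
  by apply/funext => w; rewrite /= realifyK.
rewrite (expectationE iW) (expectationE iZ) -EFinB abse_EFin lee_fin.
have -> : \int[P]_w (g \o W) w = \int[P]_w (g \o @complexify R k) (realify (W w)).
  by apply: eq_Rintegral => w _; rewrite /= realifyK.
have -> : \int[P']_w (g \o Z) w = \int[gam]_z (g \o @complexify R k) z.
  rewrite /Rintegral integral_distribution.
  - by congr fine; apply: eq_integral => w _; rewrite /= realifyK.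
  - by apply/measurable_EFinP; exact: measurable_lipschitz g_lip.
  - move: iZ; congr (_.-integrable _ _).
    by apply/funext => w; rewrite /= realifyK.
exact: main.
Qed.
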